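(* Let $M_{23}=\langle a,b,c,d,t,g,h,i,j\rangle$ be the Mathieu group in Todd's presentation, let $F=\mathrm{GF}(2)$, and let $\rho_1(a),\dots,\rho_1(j)\in\mathrm{GL}_{11}(2)$ be the nine matrices listed in the context. Then: (a) $M_{23}$ has a faithful permutation representation of degree $23$ (Todd's, recorded in Michler's book ''Theory of Finite Simple Groups''). (b) The first irreducible representation $(\rho_1,V_1)$ of $M_{23}$ (of dimension $11$ over $F$) is described by the matrices $\rho_1(a),\rho_1(b),\rho_1(c),\rho_1(d),\rho_1(t),\rho_1(g),\rho_1(h),\rho_1(i),\rho_1(j)$. (c) The second irreducible representation $(\rho_2,V_2)$ of $M_{23}$ (of dimension $11$ over $F$) is described by the transpose inverse matrices $\rho_2(s)=[\rho_1(s)^{-1}]^{T}$, $s\in\{a,b,c,d,t,g,h,i,j\}$. (d) $\dim_F H^2(M_{23},V_1)=1$ and $\dim_F H^2(M_{23},V_2)=0$. (e) The presentations of the split extensions $E_1$ and $E_2$ of $M_{23}$ by $V_1$ and $V_2$, respectively, can be constructed from the matrices of (b) and (c) using the computer algebra system Magma. (f) The unique non-split extension $E$ of $M_{23}$ by $V_1$ has the presentation $E=\langle a_1,b_1,c_1,d_1,t_1,g_1,h_1,i_1,j_1,v_r\mid 1\le r\le 11\rangle$ with the following set $\mathcal R(E)$ of defining relations, where $v[k,l,\dots]$ abbreviates $v_k^{-1}v_l^{-1}\cdots$: - $a_1^2=b_1^2=c_1^2=d_1^2=t_1^3=g_1^4=h_1^4=i_1^2=j_1^2=1$; - $(b_1,a_1)=(c_1,a_1)=(d_1,a_1)=(h_1,a_1)=(c_1,b_1)=(d_1,b_1)=(d_1,c_1)=1$,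 $(j_1,b_1)=(j_1,c_1)=(j_1,g_1)=1$; - $v_r^2=1$ and $(v_r,v_s)=1$ for $1\le r,s\le11$; - $s_1^{-1}v_rs_1=\prod_{k=1}^{11}v_k^{\rho_1(s)_{r,k}}$ for $1\le r\le 11$ and $s\in\{a,b,c,d,t,g,h,i,j\}$, where $\rho_1(s)_{r,k}\in\{0,1\}$ is the entry of $\rho_1(s)$ in row $r$, column $k$; - $t_1^{-1}a_1t_1d_1^{-1}c_1^{-1}v[6,9]=t_1^{-1}b_1t_1d_1^{-1}a_1^{-1}v[6,9]=t_1^{-1}c_1t_1d_1^{-1}b_1^{-1}v[6,9]=t_1^{-1}d_1t_1c_1^{-1}b_1^{-1}a_1^{-1}v[1,2,3,5,9]=1$; - $g_1^2v[1,3,8,9,10,11]=(g_1a_1)^3v[10,11]=(g_1b_1)^3v[1,2,3,5,6,9]=(g_1c_1)^3=(i_1j_1)^3=(g_1t_1)^2v[1,3,8,10,11]=1$; - $h_1^2v[6]=h_1^{-1}b_1h_1d_1^{-1}b_1^{-1}a_1^{-1}v[1,2,3,5]=h_1^{-1}c_1h_1c_1^{-1}a_1^{-1}v[1,2,3,5,6,9]=h_1^{-1}d_1h_1d_1^{-1}v[6]=h_1^{-1}t_1h_1t_1v[9]=(g_1h_1)^3v[3,7,9,10,11]=1$; - $i_1^{-1}a_1i_1d_1^{-1}c_1^{-1}v[1,2,3,5,6,9,10,11]=i_1^{-1}b_1i_1d_1^{-1}a_1^{-1}v[1,2,3,5,6,9,10,11]=i_1^{-1}c_1i_1d_1^{-1}c_1^{-1}b_1^{-1}a_1^{-1}v[1,2,3,5,6,9,10,11]=i_1^{-1}d_1i_1d_1^{-1}c_1^{-1}b_1^{-1}=i_1^{-1}t_1i_1t_1=i_1^{-1}g_1i_1g_1^{-1}t_1^{-1}v[5,6,7,9,10,11]=(h_1i_1)^3v[1,2,3,5,6,8,10]=1$;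 - $j_1^{-1}a_1j_1c_1^{-1}b_1^{-1}a_1^{-1}=j_1^{-1}d_1j_1d_1^{-1}c_1^{-1}v[1,2,3,5,6,9]=j_1^{-1}t_1j_1t_1=j_1^{-1}h_1j_1h_1^{-1}t_1^{-1}=1$.
   Context: $M_{23}$ is the sporadic simple Mathieu group of order $2^7\cdot3^2\cdot5\cdot7\cdot11\cdot23$; it has exactly two non-isomorphic irreducible modules $V_1,V_2$ of dimension $11$ over $\mathrm{GF}(2)$, dual to each other. $a,b,c,d,t,g,h,i,j$ are its generators in Todd's presentation; they are identified by the matrices below. $(r,s)=r^{-1}s^{-1}rs$. Matrices act on row vectors from the right; each matrix is listed by its rows $1,\dots,11$, each row a string of $11$ entries in $\mathrm{GF}(2)$. $\rho_1(a)$: 01001111100, 01100011111, 00000010000, 00110111010, 11000110011, 00000100000, 00100000000, 00000001000, 00000000100, 00000000010, 00000000001. $\rho_1(b)$: 01000000000, 10000000000, 00001000000, 11010101110, 00100000000, 00000100000, 11000110011, 00000001000, 00000000100, 00000000010, 00000000001. $\rho_1(c)$: 00001000000, 00100000000, 01000000000, 10011101001, 10000000000, 00000100000, 01100011111, 00000001000, 00000000100, 00000000010, 00000000001. $\rho_1(d)$: 01111010001, 10111011100, 00110111010, 00000010000, 00011110111, 00000100000, 00010000000, 00000001000, 00000000100, 00000000010, 00000000001. $\rho_1(t)$: 01000000100, 10011101101, 01001111000, 10111011000, 01111010101, 00000000100, 11010101010, 00000001100, 00000100100, 00000000110, 00000000101. $\rho_1(g)$: 01010000000, 10010000000, 01011111100,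 00010000000, 11010110011, 10101011100, 01110011111, 10100000111, 00001110111, 00010000010, 00010000001. $\rho_1(h)$: 10000100000, 10011001001, 00110011010, 00000110000, 11000010011, 00000100000, 00010100000, 00000100010, 00000100100, 00000101000, 00000100001. $\rho_1(i)$: 10011001001, 01000100000, 11010001110, 00010100000, 00001100000, 00000100000, 01001011100, 00000101000, 00000100100, 11101000101, 00000100001. $\rho_1(j)$: 01000000000, 10000000000, 00001000000, 00010000000, 00100000000, 00000000100, 01100011111, 00000001000, 00000100000, 00000000010, 11101100101. *)

(* Defs.v *)
From HB Require Import structures.
From Stdlib Require Import Ascii String.
From mathcomp Require Import all_boot all_order all_fingroup all_algebra.
From mathcomp Require Import all_solvable all_character.
From mathcomp Require Import ring.

Set Implicit Arguments.
Unset Strict Implicit.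
Unset Printing Implicit Defensive.

Import GroupScope.

(* Words in the free group on I, not necessarily reduced: the letter (i, false)
   is the generator i, the letter (i, true) is its inverse. *)
Definition gword (I : finType) : Type := seq (I * bool).

Section Words.

Variable I : finType.

Definition winv (w : gword I) : gword I := rev [seq (l.1, ~~ l.2) | l <- w].

Fact winvK : involutive winv.
Proof.
move=> w; rewrite /winv map_rev revK -map_comp -[RHS]map_id.
by apply: eq_map => -[i b] /=; rewrite negbK.
Qed.

Fact winvM : {morph winv : u v / u ++ v >-> v ++ u}.
Proof. by move=> u v; rewrite /winv map_cat rev_cat. Qed.

HB.instance Definition _ := Choice.on (gword I).
HB.instance Definition _ :=
  isStarMonoid.Build (gword I) (@catA _) (@cat0s _) winvK winvM.

Definition wgen (i : I) : gword I := [:: (i, false)].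

Definition word_eval (gT : finGroupType) (x : I -> gT) (w : gword I) : gT :=
  \prod_(l <- w) (if l.2 then (x l.1)^-1 else x l.1).

(* The words representing an element of the normal closure of R in the free
   group; the last two rules are free expansion and free reduction. *)
Inductive normal_closure (R : seq (gword I)) : gword I -> Prop :=
| NcRel r of r \in R : normal_closure R r
| NcOne : normal_closure R 1
| NcMul u v of normal_closure R u & normal_closure R v :
    normal_closure R (u * v)
| NcInv u of normal_closure R u : normal_closure R u^-1
| NcConj u w of normal_closure R u : normal_closure R (u ^ w)
| NcExpand u l v of normal_closure R (u * v) :
    normal_closure R (u * ([:: l] : gword I) * ([:: l] : gword I)^-1 * v)
| NcReduce u l v of
    normal_closure R (u * ([:: l] : gword I) * ([:: l] : gword I)^-1 * v) :
    normal_closure R (u * v).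

Definition presents (gT : finGroupType) (G : {set gT}) (x : I -> gT)
    (R : seq (gword I)) : Prop :=
  <<[set x i | i : I]>> = G /\
  (forall w, word_eval x w = 1 <-> normal_closure R w).

End Words.

(* The nine generators a, b, c, d, t, g, h, i, j, in this order. *)
Definition todd_gen : finType := 'I_9.

(* Todd's presentation of M_23: the image of nonsplit_relators below modulo the
   v_r, where g ^+ 4 and h ^+ 4 have become redundant. *)
Definition todd_relators (J : finType) (y : todd_gen -> gword J) :
    seq (gword J) :=
  let a := y (@Ordinal 9 0 isT) in let b := y (@Ordinal 9 1 isT) in
  let c := y (@Ordinal 9 2 isT) in let d := y (@Ordinal 9 3 isT) in
  let t := y (@Ordinal 9 4 isT) in let g := y (@Ordinal 9 5 isT) in
  let h := y (@Ordinal 9 6 isT) in let i := y (@Ordinal 9 7 isT) in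
  let j := y (@Ordinal 9 8 isT) in
  [:: a ^+ 2; b ^+ 2; c ^+ 2; d ^+ 2; t ^+ 3; g ^+ 2; h ^+ 2; i ^+ 2; j ^+ 2;
      [~ b, a]; [~ c, a]; [~ d, a]; [~ h, a]; [~ c, b]; [~ d, b]; [~ d, c];
      [~ j, b]; [~ j, c]; [~ j, g];
      t^-1 * a * t * d^-1 * c^-1;
      t^-1 * b * t * d^-1 * a^-1;
      t^-1 * c * t * d^-1 * b^-1;
      t^-1 * d * t * c^-1 * b^-1 * a^-1;
      (g * a) ^+ 3; (g * b) ^+ 3; (g * c) ^+ 3; (i * j) ^+ 3; (g * t) ^+ 2;
      h^-1 * b * h * d^-1 * b^-1 * a^-1;
      h^-1 * c * h * c^-1 * a^-1;
      h^-1 * d * h * d^-1;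
      h^-1 * t * h * t;
      (g * h) ^+ 3;
      i^-1 * a * i * d^-1 * c^-1;
      i^-1 * b * i * d^-1 * a^-1;
      i^-1 * c * i * d^-1 * c^-1 * b^-1 * a^-1;
      i^-1 * d * i * d^-1 * c^-1 * b^-1;
      i^-1 * t * i * t;
      i^-1 * g * i * g^-1 * t^-1;
      (h * i) ^+ 3;
      j^-1 * a * j * c^-1 * b^-1 * a^-1;
      j^-1 * d * j * d^-1 * c^-1;
      j^-1 * t * j * t;
      j^-1 * h * j * h^-1 * t^-1].

(* The generators of the extensions: inl s lifts the generator s of M_23, and
   inr r is v_(r+1). *)
Definition ext_gen : finType := (todd_gen + 'I_11)%type.

Definition lift_gen (s : todd_gen) : gword ext_gen := wgen (inl s).

Definition vgen (r : 'I_11) : gword ext_gen := wgen (inr r).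

Definition module_relators (rho : todd_gen -> 'M['F_2]_11) :
    seq (gword ext_gen) :=
  [seq vgen r ^+ 2 | r : 'I_11] ++
  [seq [~ vgen r, vgen s] | r <- enum 'I_11, s <- enum 'I_11] ++
  [seq (lift_gen s)^-1 * vgen r * lift_gen s
         * (\prod_(k < 11) vgen k ^+ nat_of_ord (rho s r k))^-1
     | s <- enum todd_gen, r <- enum 'I_11].

Definition split_relators (rho : todd_gen -> 'M['F_2]_11) :
    seq (gword ext_gen) :=
  todd_relators lift_gen ++ module_relators rho.

(* The abbreviation v[k, l, ...] = v_k^-1 * v_l^-1 * ..., with indices counted
   from 1. *)
Definition vtail (ks : seq nat) : gword ext_gen :=
  \prod_(k <- ks) (vgen (inord k.-1))^-1.

Definition nonsplit_relators (rho : todd_gen -> 'M['F_2]_11) :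
    seq (gword ext_gen) :=
  let a := lift_gen (@Ordinal 9 0 isT) in
  let b := lift_gen (@Ordinal 9 1 isT) in
  let c := lift_gen (@Ordinal 9 2 isT) in
  let d := lift_gen (@Ordinal 9 3 isT) in
  let t := lift_gen (@Ordinal 9 4 isT) in
  let g := lift_gen (@Ordinal 9 5 isT) in
  let h := lift_gen (@Ordinal 9 6 isT) in
  let i := lift_gen (@Ordinal 9 7 isT) in
  let j := lift_gen (@Ordinal 9 8 isT) in
  [:: a ^+ 2; b ^+ 2; c ^+ 2; d ^+ 2; t ^+ 3; g ^+ 4; h ^+ 4; i ^+ 2; j ^+ 2;
      [~ b, a]; [~ c, a]; [~ d, a]; [~ h, a]; [~ c, b]; [~ d, b]; [~ d, c];
      [~ j, b]; [~ j, c]; [~ j, g]] ++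
  module_relators rho ++
  [:: t^-1 * a * t * d^-1 * c^-1 * vtail [:: 6; 9]%N;
      t^-1 * b * t * d^-1 * a^-1 * vtail [:: 6; 9]%N;
      t^-1 * c * t * d^-1 * b^-1 * vtail [:: 6; 9]%N;
      t^-1 * d * t * c^-1 * b^-1 * a^-1 * vtail [:: 1; 2; 3; 5; 9]%N;
      g ^+ 2 * vtail [:: 1; 3; 8; 9; 10; 11]%N;
      (g * a) ^+ 3 * vtail [:: 10; 11]%N;
      (g * b) ^+ 3 * vtail [:: 1; 2; 3; 5; 6; 9]%N;
      (g * c) ^+ 3;
      (i * j) ^+ 3;
      (g * t) ^+ 2 * vtail [:: 1; 3; 8; 10; 11]%N;
      h ^+ 2 * vtail [:: 6]%N;
      h^-1 * b * h * d^-1 * b^-1 * a^-1 * vtail [:: 1; 2; 3; 5]%N;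
      h^-1 * c * h * c^-1 * a^-1 * vtail [:: 1; 2; 3; 5; 6; 9]%N;
      h^-1 * d * h * d^-1 * vtail [:: 6]%N;
      h^-1 * t * h * t * vtail [:: 9]%N;
      (g * h) ^+ 3 * vtail [:: 3; 7; 9; 10; 11]%N;
      i^-1 * a * i * d^-1 * c^-1 * vtail [:: 1; 2; 3; 5; 6; 9; 10; 11]%N;
      i^-1 * b * i * d^-1 * a^-1 * vtail [:: 1; 2; 3; 5; 6; 9; 10; 11]%N;
      i^-1 * c * i * d^-1 * c^-1 * b^-1 * a^-1
        * vtail [:: 1; 2; 3; 5; 6; 9; 10; 11]%N;
      i^-1 * d * i * d^-1 * c^-1 * b^-1;
      i^-1 * t * i * t;
      i^-1 * g * i * g^-1 * t^-1 * vtail [:: 5; 6; 7; 9; 10; 11]%N;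
      (h * i) ^+ 3 * vtail [:: 1; 2; 3; 5; 6; 8; 10]%N;
      j^-1 * a * j * c^-1 * b^-1 * a^-1;
      j^-1 * d * j * d^-1 * c^-1 * vtail [:: 1; 2; 3; 5; 6; 9]%N;
      j^-1 * t * j * t;
      j^-1 * h * j * h^-1 * t^-1].

Definition rho1_rows : seq (seq string) :=
  [:: (* a *)
      [:: "01001111100"; "01100011111"; "00000010000"; "00110111010";
          "11000110011"; "00000100000"; "00100000000"; "00000001000";
          "00000000100"; "00000000010"; "00000000001"]%string;
      (* b *)
      [:: "01000000000"; "10000000000"; "00001000000"; "11010101110";
          "00100000000"; "00000100000"; "11000110011"; "00000001000";
          "00000000100"; "00000000010"; "00000000001"]%string;
      (* c *)
      [:: "00001000000"; "00100000000"; "01000000000"; "10011101001";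
          "10000000000"; "00000100000"; "01100011111"; "00000001000";
          "00000000100"; "00000000010"; "00000000001"]%string;
      (* d *)
      [:: "01111010001"; "10111011100"; "00110111010"; "00000010000";
          "00011110111"; "00000100000"; "00010000000"; "00000001000";
          "00000000100"; "00000000010"; "00000000001"]%string;
      (* t *)
      [:: "01000000100"; "10011101101"; "01001111000"; "10111011000";
          "01111010101"; "00000000100"; "11010101010"; "00000001100";
          "00000100100"; "00000000110"; "00000000101"]%string;
      (* g *)
      [:: "01010000000"; "10010000000"; "01011111100"; "00010000000";
          "11010110011"; "10101011100"; "01110011111"; "10100000111";
          "00001110111"; "00010000010"; "00010000001"]%string;
      (* h *)
      [:: "10000100000"; "10011001001"; "00110011010"; "00000110000";
          "11000010011"; "00000100000"; "00010100000"; "00000100010";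
          "00000100100"; "00000101000"; "00000100001"]%string;
      (* i *)
      [:: "10011001001"; "01000100000"; "11010001110"; "00010100000";
          "00001100000"; "00000100000"; "01001011100"; "00000101000";
          "00000100100"; "11101000101"; "00000100001"]%string;
      (* j *)
      [:: "01000000000"; "10000000000"; "00001000000"; "00010000000";
          "00100000000"; "00000000100"; "01100011111"; "00000001000";
          "00000100000"; "00000000010"; "11101100101"]%string].

Definition bit_at (s : string) (k : nat) : bool :=
  if String.get k s is Some ch then Ascii.eqb ch "1"%char else false.

Definition rho1_mx (s : todd_gen) : 'M['F_2]_11 :=
  \matrix_(r < 11, k < 11)
    ((bit_at (nth EmptyString (nth [::] rho1_rows s) r) k)%:R)%R.

Definition rho2_mx (s : todd_gen) : 'M['F_2]_11 := ((invmx (rho1_mx s))^T)%R.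

Section SecondCohomology.

Import GRing.Theory.
Local Open Scope ring_scope.

(* Inhomogeneous cochains with values in the right module of row vectors; an
   extension with section sigma has the cocycle f given by
   sigma x * sigma y = sigma (x * y) * f (x, y). *)
Variables (F : fieldType) (gT : finGroupType) (G : {group gT}) (n : nat).
Variable rG : mx_representation F G n.

Let H := subg_of G.
Let V := 'rV[F]_n.

Definition cobound1 (h : {ffun H -> V}) : {ffun H * H -> V} :=
  [ffun p => h p.1 *m rG (sgval p.2) - h (p.1 * p.2)%g + h p.2].

Definition cobound2 (f : {ffun H * H -> V}) : {ffun H * H * H -> V} :=
  [ffun p => let: (x, y, z) := p in
     f (x, y) *m rG (sgval z) + f ((x * y)%g, z) - f (x, (y * z)%g) - f (y, z)].

Fact cobound1_is_linear : linear cobound1.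
Proof.
move=> k u v; apply/ffunP=> p; rewrite !ffunE mulmxDl -scalemxAl.
set A := u _ *m _; set B := v _ *m _.
by apply/rowP=> i; rewrite !mxE; ring.
Qed.

Fact cobound2_is_linear : linear cobound2.
Proof.
move=> k u v; apply/ffunP=> -[[y z] t]; rewrite !ffunE mulmxDl -scalemxAl.
set A := u _ *m _; set B := v _ *m _.
by apply/rowP=> i; rewrite !mxE; ring.
Qed.

HB.instance Definition _ :=
  GRing.isLinear.Build F {ffun H -> V} {ffun H * H -> V} *:%R cobound1
    cobound1_is_linear.
HB.instance Definition _ :=
  GRing.isLinear.Build F {ffun H * H -> V} {ffun H * H * H -> V} *:%R cobound2
    cobound2_is_linear.

Definition cocycles2 : {vspace {ffun H * H -> V}} := lker (linfun cobound2).

Definition coboundaries2 : {vspace {ffun H * H -> V}} := limg (linfun cobound1).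

Lemma coboundaries2_sub : (coboundaries2 <= cocycles2)%VS.
Proof.
apply/subvP=> _ /memv_imgP[h _ ->]; rewrite memv_ker !lfunE /=.
apply/eqP/ffunP=> -[[x y] z]; rewrite !ffunE /=.
have -> : rG (sgval (y * z)%g) = rG (sgval y) *m rG (sgval z).
  by rewrite /= repr_mxM ?subgP.
rewrite !mulmxDl mulNmx -mulmxA mulgA.
set A := _ *m (_ *m _); set B := h _ *m _; set C := h _ *m _.
by apply/rowP=> i; rewrite !mxE; ring.
Qed.

Definition dim_H2 : nat := \dim cocycles2 - \dim coboundaries2.

End SecondCohomology.

Section Extensions.

Variables (F : finFieldType) (gT : finGroupType) (G : {group gT}) (n : nat).
Variable rG : mx_representation F G n.

Definition is_extension (eT : finGroupType) (E : {group eT})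
    (iota : {morphism [set: 'rV[F]_n] >-> eT}) (pi : {morphism E >-> gT}) :
    Prop :=
  [/\ 'injm iota, iota @* [set: 'rV[F]_n] = 'ker pi, pi @* E = G
    & forall v e, e \in E -> iota v ^ e = iota (v *m rG (pi e))%R].

Definition is_nonsplit_extension (eT : finGroupType) (E : {group eT})
    (iota : {morphism [set: 'rV[F]_n] >-> eT}) (pi : {morphism E >-> gT}) :
    Prop :=
  is_extension iota pi /\ ~~ [splits E, over 'ker pi].

Definition equivalent_extensions (eT1 eT2 : finGroupType)
    (E1 : {group eT1}) (E2 : {group eT2})
    (iota1 : {morphism [set: 'rV[F]_n] >-> eT1}) (pi1 : {morphism E1 >-> gT})
    (iota2 : {morphism [set: 'rV[F]_n] >-> eT2}) (pi2 : {morphism E2 >-> gT}) :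
    Prop :=
  exists f : {morphism E1 >-> eT2},
    [/\ isom E1 E2 f, forall v, f (iota1 v) = iota2 v
      & {in E1, forall e, pi2 (f e) = pi1 e}].

Definition split_extension : finGroupType := sdprod_by ('MR rG)%gact.

End Extensions.

Definition split_gens (gT : finGroupType) (G : {group gT})
    (rG : mx_representation 'F_2 G 11) (x : todd_gen -> gT) (k : ext_gen) :
    split_extension rG :=
  match k with
  | inl s => sdpair2 ('MR rG)%gact (x s)
  | inr r => sdpair1 ('MR rG)%gact (delta_mx 0%R r)
  end.

(* Main.v *)
From HB Require Import structures.
From Stdlib Require Import NArith Setoid Morphisms.
Require Import Defs.
From mathcomp Require Import all_boot all_order all_fingroup all_algebra.
From mathcomp Require Import all_solvable all_character.
From mathcomp Require Import zify ring.

(* M_23 is simple, so V_1 is faithful and identities between words in the generators of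
   M_23 can be checked on 11 x 11 matrices.

   On an irreducible module of dimension 11 an element z of order 23 acts as one of two
   companion matrices with respect to the images of a vector fixed by an element f of
   order 11 normalising <z>; a third element u, which also normalises <f>, is then
   determined by a relation between z and u.

   Restriction to a Sylow 2-subgroup is injective on H^2. A cocycle is determined there by
   the tails of the lifted relations of a power-conjugate presentation. Linear relations
   between the tails of a larger rewriting system come from its overlaps; once the lifts
   are normalised, they leave one bit of freedom for V_1 and none for V_2.

   The non-split extension acts on F_2 x V_2 by (b, w) |-> (b + q(w), w A) with q a
   quadratic form; V_1 is the group of those with A = 1 and q linear. It does not split
   because the linear system for the generators of a complement is inconsistent.

   In each presentation of an extension every word reduces to a lift of a word in the
   generators of M_23 times a vector, so the group presented is not larger than the
   extension. *)

Set Implicit Arguments.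
Unset Strict Implicit.
Unset Printing Implicit Defensive.

Import GroupScope GRing.Theory.

Local Arguments N.lxor : simpl never.
Local Arguments N.shiftl : simpl never.
Local Arguments N.odd : simpl never.
Local Arguments N.div2 : simpl never.

(** * Vectors and matrices over F_2 as binary numbers *)

Section BinaryMatrices.

Local Open Scope ring_scope.

(** M_23 is given only by a presentation, its simplicity and its order, and it has about ten million
    elements, so it is never enumerated. The results of long searches, such as linear eliminations
    and words in z, f, u, enter as tables that are only replayed.

    The rules of a Sylow 2-subgroup S alone would describe H^2(S, V), which is in general larger
    than H^2(M_23, V). The extra letters of the rewriting system conjugate elements of S into S, and
    their overlaps supply the conditions that single out the stable classes.

    Why quadratic forms: V_1 is dual to V_2, and over F_2 a linear form equals its square. Hence the
    quadratic forms on V_2 contain V_1, with the alternating forms as quotient. The polar forms of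
    the forms q attached to the generators define a 1-cocycle of M_23 with values in the alternating
    forms, and the non-split class is its image under the connecting map to H^2(M_23, V_1). *)

Definition bitF (v : N) (k : nat) : 'F_2 := (N.testbit v (N.of_nat k))%:R.

Lemma bitF0 k : bitF 0%num k = 0.
Proof. by []. Qed.

Lemma natF_addb (a b : bool) : (a (+) b)%:R = a%:R + b%:R :> 'F_2.
Proof. by case: a; case: b; apply/val_inj. Qed.

Lemma bitF_xor u v k : bitF (N.lxor u v) k = bitF u k + bitF v k.
Proof.
rewrite /bitF -natF_addb N.lxor_spec; congr (nat_of_bool _)%:R.
by case: N.testbit; case: N.testbit.
Qed.

Lemma bitF_div2 v k : bitF (N.div2 v) k = bitF v k.+1.
Proof. by rewrite /bitF N.testbit_div2 Nnat.Nat2N.inj_succ. Qed.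

Lemma bitF_shiftl v n k :
  bitF (N.shiftl v (N.of_nat n)) k = if (k < n)%N then 0 else bitF v (k - n).
Proof.
rewrite /bitF; case: ltnP => h.
  by rewrite N.shiftl_spec_low //; lia.
rewrite N.shiftl_spec_high'; last by lia.
by congr (nat_of_bool (N.testbit _ _))%:R; lia.
Qed.

Lemma bitF_odd v : bitF v 0 = (N.odd v)%:R.
Proof. by rewrite /bitF N.bit0_odd. Qed.

(** Bit k of a number is coordinate k of a row vector, and a matrix is the list of its rows. The
    bits of [v] select the rows to add and are consumed from the low end. *)
Fixpoint vmul (v : N) (A : seq N) : N :=
  match A with
  | [::] => 0%num
  | r :: A' => if N.odd v then N.lxor r (vmul (N.div2 v) A')
               else vmul (N.div2 v) A'
  end.

Definition mmul (A B : seq N) : seq N := [seq vmul v B | v <- A].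

Lemma bitF_vmul v A k :
  bitF (vmul v A) k = \sum_(r < size A) bitF v r * bitF (nth 0%num A r) k.
Proof.
elim: A v => [|r A IH] v /=; first by rewrite big_ord0.
rewrite big_ord_recl /= bitF_odd.
under eq_bigr => i _ do rewrite -bitF_div2.
by case: N.odd; rewrite ?bitF_xor IH ?mul1r ?mul0r ?add0r.
Qed.

Definition rvN (v : N) : 'rV['F_2]_11 := \row_k bitF v k.
Definition mxN (A : seq N) : 'M['F_2]_11 := \matrix_(r, k) bitF (nth 0%num A r) k.

Lemma rvN_xor u v : rvN (N.lxor u v) = rvN u + rvN v.
Proof. by apply/rowP=> k; rewrite !mxE bitF_xor. Qed.

Lemma rvN_vmul v A : size A = 11%N -> rvN (vmul v A) = rvN v *m mxN A.
Proof.
move=> sA; apply/rowP=> k; rewrite !mxE bitF_vmul sA.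
by apply: eq_bigr => r _; rewrite !mxE.
Qed.

Lemma row_mxN A r : row r (mxN A) = rvN (nth 0%num A r).
Proof. by apply/rowP=> k; rewrite !mxE. Qed.

Lemma mxN_mmul A B : size A = 11%N -> size B = 11%N -> mxN (mmul A B) = mxN A *m mxN B.
Proof.
move=> sA sB; apply/row_matrixP=> r; rewrite row_mul !row_mxN -rvN_vmul //.
by rewrite (nth_map 0%num) // sA.
Qed.

Lemma size_mmul A B : size (mmul A B) = size A.
Proof. exact: size_map. Qed.

Lemma F2_sqr (a : 'F_2) : a + a = 0.
Proof. by apply: addrr_pchar2; apply: pchar_Fp. Qed.

Lemma F2P (a : 'F_2) : a = (a == 1)%:R.
Proof. by case: a => -[|[|n]] h //; apply/val_inj. Qed.

Lemma F2_01 (a : 'F_2) : a = 0 \/ a = 1.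
Proof. by rewrite [a]F2P; case: (a == 1); [right | left]. Qed.

Definition encb (n : nat) (a : nat -> bool) : N :=
  foldr (fun k v => if a k then N.lxor (N.shiftl 1 (N.of_nat k)) v else v)
    0%num (iota 0 n).

Lemma bitF_encb n a k : bitF (encb n a) k = ((k < n)%N && a k)%:R.
Proof.
rewrite /encb -[(k < n)%N]/(0 <= k < 0 + n)%N -mem_iota.
elim: (iota 0 n) (iota_uniq 0 n) => [|j s IH] //= /andP[js us].
have H : bitF (N.shiftl 1 (N.of_nat j)) k = (k == j)%:R.
  rewrite bitF_shiftl; case: ltngtP => h //; last by rewrite h subnn.
  have -> : (k - j = (k - j).-1.+1)%N by lia.
  by rewrite -bitF_div2.
rewrite in_cons; case: (eqVneq k j) H js => [<- | kj] H js /=; last first.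
  by rewrite -IH //; case: (a j) => //; rewrite bitF_xor H add0r.
move: IH; rewrite (negPf js) => /(_ us) IH.
by case: (a k); rewrite ?bitF_xor IH // H addr0.
Qed.

Definition encV (v : 'rV['F_2]_11) : N := encb 11 (fun k => v 0 (inord k) == 1).

Lemma encVK v : rvN (encV v) = v.
Proof.
by apply/rowP=> k; rewrite !mxE bitF_encb ltn_ord inord_val -F2P.
Qed.

Definition trmxN (A : seq N) : seq N :=
  [seq encb 11 (fun i => N.testbit (nth 0%num A i) (N.of_nat k)) | k <- iota 0 11].

Lemma mxN_tr A : mxN (trmxN A) = (mxN A)^T.
Proof.
apply/matrixP=> r k; rewrite !mxE (nth_map 0%N) ?size_iota // nth_iota //.
by rewrite bitF_encb ltn_ord.
Qed.

Lemma size_trmxN A : size (trmxN A) = 11%N.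
Proof. by rewrite size_map. Qed.

Lemma rvN_bit (c : 'I_11) : rvN (N.shiftl 1 (N.of_nat c)) = delta_mx 0 c.
Proof.
apply/rowP=> k; rewrite !mxE bitF_shiftl eqxx /= -val_eqE /=.
case: ltngtP => //= [ck|->]; last by rewrite subnn.
by have -> : (k - c = (k - c).-1.+1)%N by [lia]; rewrite -bitF_div2.
Qed.

(** A functional may be masked by [k] when it is applied to a vector supported on [k]. This lets the
    elimination forget the coordinates of tails that have been normalised to 0. *)
Lemma rvN_land_eq u k (t : 'rV['F_2]_11) :
  (forall r : 'I_11, ~~ N.testbit k (N.of_nat r) -> t 0 r = 0) ->
  t *m (rvN (N.land u k))^T = t *m (rvN u)^T.
Proof.
move=> t0; apply/matrixP=> i j; rewrite !mxE; apply: eq_bigr => r _.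
rewrite !mxE ord1 /bitF N.land_spec.
have [kr|/t0 ->] := boolP (N.testbit k (N.of_nat r)); last by rewrite !mul0r.
by case: N.testbit.
Qed.

End BinaryMatrices.

(** * Evaluation of words and homomorphisms from presented groups *)

Section WordEvaluation.

Variables (I : finType) (gT : finGroupType).
Implicit Types (x y : I -> gT) (u v w : gword I).

Lemma word_eval1 x : word_eval x 1 = 1.
Proof. by rewrite /word_eval big_nil. Qed.

Lemma word_evalM x u v : word_eval x (u * v) = word_eval x u * word_eval x v.
Proof. by rewrite /word_eval big_cat. Qed.

Lemma word_eval_cons x l u :
  word_eval x (l :: u) = (if l.2 then (x l.1)^-1 else x l.1) * word_eval x u.
Proof. by rewrite /word_eval big_cons. Qed.

Lemma word_eval_gen x i : word_eval x (wgen i) = x i.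
Proof. by rewrite /word_eval big_seq1. Qed.

Lemma word_evalV x u : word_eval x u^-1 = (word_eval x u)^-1.
Proof.
elim: u => [|l u IH]; first by rewrite -[[::]]/(1 : gword I) !word_eval1 invg1.
rewrite -[l :: u]/(([:: l] : gword I) * u) invgM !word_evalM invMg IH.
congr (_ * _); rewrite -[_^-1]/([:: (l.1, ~~ l.2)] : gword I).
by rewrite !word_eval_cons !word_eval1 !mulg1 /=; case: l.2; rewrite /= ?invgK.
Qed.

Lemma word_evalX x u n : word_eval x (u ^+ n) = word_eval x u ^+ n.
Proof.
by elim: n => [|n IH]; rewrite ?word_eval1 // !expgS word_evalM IH.
Qed.

Lemma word_evalJ x u v : word_eval x (u ^ v) = word_eval x u ^ word_eval x v.
Proof. by rewrite !word_evalM word_evalV. Qed.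

Lemma word_evalR x u v :
  word_eval x [~ u, v] = [~ word_eval x u, word_eval x v].
Proof. by rewrite word_evalM word_evalV word_evalJ. Qed.

Lemma word_eval_prod x (T : Type) (s : seq T) (F : T -> gword I) :
  word_eval x (\prod_(k <- s) F k) = \prod_(k <- s) word_eval x (F k).
Proof.
by elim: s => [|k s IH]; rewrite ?big_nil ?word_eval1 // !big_cons word_evalM IH.
Qed.

Lemma word_eval_closure x R w :
  (forall r, r \in R -> word_eval x r = 1) ->
  normal_closure R w -> word_eval x w = 1.
Proof.
move=> xR; elim=> {w} [r /xR//||u v _ xu _ xv|u _ xu|u w _ xu|u l v _|u l v _].
- exact: word_eval1.
- by rewrite word_evalM xu xv mulg1.
- by rewrite word_evalV xu invg1.
- by rewrite word_evalJ xu conj1g.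
- by rewrite !word_evalM word_evalV mulgK.
- by rewrite !word_evalM word_evalV mulgK.
Qed.

(** The equation is boolean so that [xchoose] can pick a word for each element. *)
Lemma word_eval_onto (G : {group gT}) x g :
  <<[set x i | i : I]>> = G -> g \in G -> exists w, word_eval x w == g.
Proof.
move=> <- /gen_prodgP[n [c cX ->]].
elim: n c cX => [|n IH] c cX; first by exists 1; rewrite word_eval1 big_ord0.
have [w /eqP Dw] := IH _ (fun i => cX (lift ord0 i)).
have /imsetP[i _ ci] := cX ord0.
by exists (wgen i * w); rewrite word_evalM big_ord_recl word_eval_gen ci Dw.
Qed.

Lemma word_eval_in (G : {group gT}) x w : (forall i, x i \in G) -> word_eval x w \in G.
Proof.
by move=> xG; apply: group_prod => l _; case: l.2; rewrite ?groupV.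
Qed.

End WordEvaluation.

Lemma word_eval_morph (I : finType) (aT rT : finGroupType) (G : {group aT})
    (f : {morphism G >-> rT}) (x : I -> aT) w :
  (forall i, x i \in G) -> f (word_eval x w) = word_eval (f \o x) w.
Proof.
move=> xG; elim: w => [|l w IH].
  by rewrite -[[::]]/(1 : gword I) !word_eval1 morph1.
rewrite !word_eval_cons morphM ?IH ?word_eval_in //; last first.
  by case: l.2; rewrite ?groupV.
by congr (_ * _); case: l.2; rewrite ?morphV.
Qed.

Lemma presents_gen (I : finType) (gT : finGroupType) (G : {group gT})
    (x : I -> gT) R i : presents G x R -> x i \in G.
Proof. by case=> <- _; apply: mem_gen; apply: imset_f. Qed.

(** This is von Dyck's theorem. If two words have the same value at [x], their quotient lies in the
    normal closure, so they have the same value at [y]; any choice of words then gives a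
    homomorphism. *)
Lemma presents_hom (I : finType) (gT : finGroupType) (G : {group gT})
    (x : I -> gT) R (hT : finGroupType) (y : I -> hT) :
  presents G x R -> (forall r, r \in R -> word_eval y r = 1) ->
  exists f : {morphism G >-> hT}, forall i, f (x i) = y i.
Proof.
move=> prG yR; have [Gx Rx] := prG.
pose wd g := if @idP (g \in G) is ReflectT Gg
             then xchoose (word_eval_onto Gx Gg) else 1.
have wdK g : g \in G -> word_eval x (wd g) = g.
  rewrite /wd; case: {-}_ / idP => // Gg _.
  by apply/eqP/(xchooseP (word_eval_onto Gx Gg)).
have Ey u v : word_eval x u = word_eval x v -> word_eval y u = word_eval y v.
  move=> Duv; apply/eqP; rewrite eq_mulgV1 -word_evalV -word_evalM; apply/eqP.
  apply: (word_eval_closure yR); apply/Rx.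
  by rewrite word_evalM word_evalV Duv mulgV.
have fM : {in G &, {morph (fun g => word_eval y (wd g)) : g h / g * h}}.
  move=> g h Gg Gh; rewrite -word_evalM; apply: Ey.
  by rewrite word_evalM !wdK ?groupM.
exists (Morphism fM) => i /=; rewrite -[RHS]word_eval_gen; apply: Ey.
by rewrite wdK ?(presents_gen _ prG) // word_eval_gen.
Qed.

(** * Equality in a presented group *)

Section ContextualEquivalence.

Variables (I : finType) (R : seq (gword I)).
Implicit Types (u v w p q : gword I).

(* Equality in the group presented by R: a context can be completed to a word of
   the normal closure by either word or by neither. *)
Definition weq u v : Prop :=
  forall p q, normal_closure R (p * u * q) <-> normal_closure R (p * v * q).

Lemma weq_refl u : weq u u. Proof. by []. Qed.

Lemma weq_sym u v : weq u v -> weq v u.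
Proof. by move=> uv p q; rewrite (uv p q). Qed.

Lemma weq_trans u v w : weq u v -> weq v w -> weq u w.
Proof. by move=> uv vw p q; rewrite (uv p q). Qed.

Lemma weqM u u' v v' : weq u u' -> weq v v' -> weq (u * v) (u' * v').
Proof.
move=> uu' vv' p q; rewrite !mulgA -(mulgA (p * u)) (uu' p) !mulgA.
exact: (vv' (p * u')).
Qed.

Lemma weq_mulgV u : weq (u * u^-1) 1.
Proof.
elim: u => [|l s]; first by [].
rewrite -[l :: s]/(([:: l] : gword I) * (s : gword I)).
move: (s : gword I) => u; set a : gword I := [:: l] => IH p q; rewrite invgM.
have -> : p * (a * u * (u^-1 * a^-1)) * q = p * a * (u * u^-1) * (a^-1 * q).
  by rewrite !mulgA.
rewrite (IH (p * a) (a^-1 * q)) !mulg1 !mulgA.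
by split; [apply: NcReduce | apply: NcExpand].
Qed.

Lemma weq_mulVg u : weq (u^-1 * u) 1.
Proof. by rewrite -{2}(invgK u); apply: weq_mulgV. Qed.

Lemma weqV u v : weq u v -> weq u^-1 v^-1.
Proof.
move=> uv; apply: weq_trans (_ : weq (u^-1 * (v * v^-1)) _).
  rewrite -[X in weq X]mulg1; apply: weqM => //.
  exact/weq_sym/weq_mulgV.
rewrite mulgA -[X in weq _ X]mul1g; apply: weqM => //.
apply: weq_trans (weq_mulVg u); apply: weqM => //; exact: weq_sym.
Qed.

Lemma closure_weq w : normal_closure R w <-> weq w 1.
Proof.
split=> [Rw p q|/(_ 1 1)]; last first.
  by rewrite !mulg1 !mul1g => ->; apply: NcOne.
(* Inside a context, [w] is moved to the front as a conjugate, which is again in the normal closure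
   and can be multiplied away. *)
have E : weq (p * w * q) ((w ^ p^-1) * (p * q)).
  rewrite conjgE invgK !mulgA -(mulgA (p * w)).
  apply: weqM (weq_refl q); rewrite -[X in weq X]mulg1.
  by apply: weqM => //; apply/weq_sym/weq_mulVg.
have Rc := NcConj p^-1 Rw.
have := E 1 1; rewrite !mulg1 !mul1g => ->; split=> [N|N]; last exact: NcMul.
have := weqM (weq_mulVg (w ^ p^-1)) (weq_refl (p * q)).
move/(_ 1 1); rewrite !mulg1 !mul1g -mulgA => <-.
exact: NcMul (NcInv Rc) N.
Qed.

Lemma weq_rel r u : r * u \in R -> weq r u^-1.
Proof.
move/NcRel/closure_weq => H; apply: weq_trans (_ : weq (r * (u * u^-1)) _).
  rewrite -[X in weq X]mulg1; apply: weqM => //; exact/weq_sym/weq_mulgV.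
by rewrite mulgA -[X in weq _ X]mul1g; apply: weqM.
Qed.

Lemma weq_eval (gT : finGroupType) (x : I -> gT) u v :
  (forall r, r \in R -> word_eval x r = 1) ->
  weq u v -> word_eval x u = word_eval x v.
Proof.
move=> xR /(_ 1 v^-1); rewrite !mul1g => -[_ H].
have /(word_eval_closure xR) : normal_closure R (u * v^-1).
  by apply: H; apply/closure_weq/weq_mulgV.
by rewrite word_evalM word_evalV => /eqP; rewrite -eq_mulgV1 => /eqP.
Qed.

End ContextualEquivalence.

#[export] Instance weq_equiv (I : finType) (R : seq (gword I)) :
  Equivalence (weq R).
Proof. by split=> *; [apply: weq_refl | apply: weq_sym | apply: weq_trans; eassumption]. Qed.

#[export] Instance weq_mulg (I : finType) (R : seq (gword I)) :
  Proper (weq R ==> weq R ==> weq R) (@mulg (gword I)).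
Proof. by move=> u u' uu' v v' vv'; apply: weqM. Qed.

(** * Presentations of extensions by a module *)

Definition wlift (u : gword todd_gen) : gword ext_gen :=
  [seq (inl l.1, l.2) | l <- u].

Lemma wliftM u v : wlift (u * v) = wlift u * wlift v.
Proof. exact: map_cat. Qed.

Lemma wliftV u : wlift u^-1 = (wlift u)^-1.
Proof.
rewrite -[u^-1]/(winv u) -[_^-1]/(winv (wlift u)).
by rewrite /wlift /winv map_rev -!map_comp.
Qed.

Lemma todd_relators_lift :
  todd_relators lift_gen = [seq wlift r | r <- todd_relators (@wgen todd_gen)].
Proof. by []. Qed.

Definition vw (e : 'rV['F_2]_11) : gword ext_gen :=
  \prod_(k < 11) vgen k ^+ nat_of_ord (e ord0 k).

Section ExtensionPresentation.

Variables (R : seq (gword ext_gen)) (rho : todd_gen -> 'M['F_2]_11).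
Hypothesis modR : {subset module_relators rho <= R}.
Hypothesis rhoU : forall s, rho s \in unitmx.

Local Notation "u =w v" := (weq R u v) (at level 70).

Lemma vgen_sqr r : vgen r * vgen r =w 1.
Proof.
apply/closure_weq/NcRel/modR; rewrite !mem_cat; apply/orP; left.
by apply/imageP; exists r.
Qed.

Lemma vgenC r s : vgen r * vgen s =w vgen s * vgen r.
Proof.
have /closure_weq H : normal_closure R [~ vgen r, vgen s].
  apply/NcRel/modR; rewrite !mem_cat; apply/orP; right; apply/orP; left.
  by apply/allpairsP; exists (r, s); rewrite !mem_enum.
have : vgen s * vgen r * [~ vgen r, vgen s] =w vgen s * vgen r.
  by rewrite H mulg1.
move=> <-; rewrite commgEl conjgE.
have -> : vgen s * vgen r * ((vgen r)^-1 * ((vgen s)^-1 * (vgen r * vgen s)))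
  = vgen s * (vgen r * (vgen r)^-1) * (vgen s)^-1 * (vgen r * vgen s).
  by rewrite !mulgA.
by rewrite weq_mulgV mulg1 weq_mulgV mul1g.
Qed.

Lemma vgenJ s r :
  (lift_gen s)^-1 * vgen r * lift_gen s =w vw (row r (rho s)).
Proof.
rewrite -[vw _]invgK; apply: weq_rel; apply: modR.
rewrite !mem_cat; apply/orP; right; apply/orP; right.
apply/allpairsP; exists (s, r); rewrite !mem_enum; split=> //=.
by congr (_ * _^-1); apply: eq_bigr => k _; rewrite mxE.
Qed.

Let vprod (s : seq 'I_11) (e : 'rV['F_2]_11) : gword ext_gen :=
  \prod_(k <- s) vgen k ^+ nat_of_ord (e ord0 k).

Let vwE e : vw e = vprod (index_enum _) e. Proof. by []. Qed.

Let vprod_cons k s e :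
  vprod (k :: s) e = vgen k ^+ nat_of_ord (e ord0 k) * vprod s e.
Proof. by rewrite /vprod big_cons. Qed.

Let vgen_vprod k s e : vgen k * vprod s e =w vprod s e * vgen k.
Proof.
elim: s => [|l s IH]; first by rewrite /vprod big_nil mulg1 mul1g.
rewrite vprod_cons -mulgA -IH !mulgA.
have [->|->] := F2_01 (e ord0 l); first by rewrite !expg0 mulg1 mul1g.
by rewrite !expg1 vgenC.
Qed.

Let vprodD s e e' : vprod s e * vprod s e' =w vprod s (e + e')%R.
Proof.
elim: s => [|k s IH]; first by rewrite /vprod !big_nil mulg1.
rewrite !vprod_cons mulgA -(mulgA _ (vprod s e)).
have H : vprod s e * vgen k ^+ nat_of_ord (e' ord0 k) =w
         vgen k ^+ nat_of_ord (e' ord0 k) * vprod s e.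
  have [->|->] := F2_01 (e' ord0 k); first by rewrite !expg0 mulg1 mul1g.
  by rewrite !expg1 vgen_vprod.
rewrite H !mulgA -mulgA IH mxE; apply: weqM; last by [].
have [->|->] := F2_01 (e ord0 k); have [->|->] := F2_01 (e' ord0 k).
- by rewrite addr0 !expg0 mulg1.
- by rewrite add0r expg0 mul1g.
- by rewrite addr0 expg0 mulg1.
- by rewrite F2_sqr !expg1 vgen_sqr.
Qed.

Lemma vwD e e' : vw e * vw e' =w vw (e + e')%R.
Proof. exact: vprodD. Qed.

Lemma vw0 : vw 0%R = 1.
Proof. by rewrite /vw big1 // => k _; rewrite mxE expg0. Qed.

Lemma vw_delta r : vw (delta_mx 0%R r) = vgen r.
Proof.
have H (s : seq 'I_11) : uniq s ->
    vprod s (delta_mx 0%R r) = if r \in s then vgen r else 1.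
  elim: s => [|k s IH] /=; first by rewrite /vprod big_nil.
  case/andP=> ks us; rewrite vprod_cons IH // in_cons mxE eqxx /=.
  case: eqVneq ks => [->|rk] ks; last by rewrite expg0 mul1g.
  by rewrite (negPf ks) mulg1.
by rewrite vwE H ?index_enum_uniq ?mem_index_enum.
Qed.

Lemma vwJ s e : vw e * lift_gen s =w lift_gen s * vw (e *m rho s)%R.
Proof.
suff H : (lift_gen s)^-1 * vw e * lift_gen s =w vw (e *m rho s)%R.
  by rewrite -H !mulgA weq_mulgV mul1g.
suff H (l : seq 'I_11) : (lift_gen s)^-1 * vprod l e * lift_gen s =w
    vw (\sum_(k <- l) e ord0 k *: row k (rho s))%R.
  rewrite vwE H; apply: eq_subrelation; rewrite mulmx_sum_row.
  by [].
elim: l => [|k l IH].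
  by rewrite /vprod !big_nil mulg1 vw0 weq_mulVg.
rewrite vprod_cons big_cons -vwD -IH.
have -> : vw (e ord0 k *: row k (rho s))%R =w
   (lift_gen s)^-1 * vgen k ^+ nat_of_ord (e ord0 k) * lift_gen s.
  have [->|->] := F2_01 (e ord0 k).
    by rewrite scale0r vw0 expg0 mulg1 weq_mulVg.
  by rewrite scale1r expg1 vgenJ.
by rewrite !mulgA -(mulgA _ (lift_gen s)) weq_mulgV mulg1.
Qed.

Lemma vwJV s e :
  vw e * (lift_gen s)^-1 =w (lift_gen s)^-1 * vw (e *m invmx (rho s))%R.
Proof.
have H := vwJ s (e *m invmx (rho s))%R; rewrite mulmxKV // in H.
have : (lift_gen s)^-1 * (vw (e *m invmx (rho s)) * lift_gen s) * (lift_gen s)^-1 =w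
   (lift_gen s)^-1 * vw (e *m invmx (rho s))%R.
  by rewrite -!mulgA weq_mulgV mulg1.
by move=> <-; rewrite H !mulgA weq_mulVg mul1g.
Qed.

Lemma vw_lift w e : exists e', vw e * wlift w =w wlift w * vw e'.
Proof.
elim: w e => [|[s b] w IH] e.
  by exists e; rewrite -[wlift _]/(1 : gword ext_gen) mulg1 mul1g.
rewrite -[wlift _]/(([:: (inl s, b)] : gword ext_gen) * wlift w).
have [e1 H1] : exists e1, vw e * ([:: (inl s, b)] : gword ext_gen) =w
    ([:: (inl s, b)] : gword ext_gen) * vw e1.
  case: b; first by exists (e *m invmx (rho s))%R; apply: vwJV.
  by exists (e *m rho s)%R; apply: vwJ.
have [e2 H2] := IH e1; exists e2.
by rewrite mulgA H1 -!mulgA H2.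
Qed.

(** Vectors are collected on the right: the conjugation relators move them past lifted letters, and
    [vgen_sqr] removes inverses of the [vgen r]. *)
Lemma ext_normal_form w : exists u e, w =w wlift u * vw e.
Proof.
elim: w => [|[[s|r] b] w [u [e H]]].
- by exists 1, 0%R; rewrite vw0 mulg1.
- exists ((s, b) :: u), e.
  rewrite -[wlift _]/(([:: (inl s, b)] : gword ext_gen) * wlift u).
  rewrite -[_ :: w]/(([:: (inl s, b)] : gword ext_gen) * (w : gword ext_gen)).
  by rewrite H mulgA.
- have [e1 H1] := vw_lift u (delta_mx 0%R r).
  exists u, (e1 + e)%R; rewrite -vwD mulgA -H1 -mulgA -H vw_delta.
  case: b => //.
  rewrite -[_ :: w]/((vgen r)^-1 * (w : gword ext_gen)).
  apply: weqM => //; rewrite -[X in X =w _]mulg1 -(vgen_sqr r) mulgA.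
  by rewrite weq_mulVg mul1g.
Qed.

Hypothesis toddR :
  forall r, r \in todd_relators (@wgen todd_gen) -> exists e, wlift r =w vw e.

(** In the presented group the vector words form a normal subgroup, so having a vector word as lift
    is preserved by every rule of the normal closure. Stating [toddR] with an arbitrary vector
    covers both kinds of extension: the vector is 0 in the split case and the tail of the relator
    otherwise. *)
Lemma closure_lift u :
  normal_closure (todd_relators (@wgen todd_gen)) u -> exists e, wlift u =w vw e.
Proof.
elim=> {u} [r /toddR//||u v _ [e ue] _ [f vf]|u _ [e ue]|u w _ [e ue]|u l v _ [e H]|u l v _ [e H]].
- by exists 0%R; rewrite vw0.
- by exists (e + f)%R; rewrite wliftM ue vf vwD.
- exists (- e)%R; rewrite wliftV (weqV ue).
  rewrite -[X in X =w _]mulg1 -vw0 -(subrr e) -vwD mulgA weq_mulVg.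
  by rewrite mul1g.
- have [e' H] := vw_lift w e; exists e'.
  by rewrite conjgE !wliftM wliftV ue H mulgA weq_mulVg mul1g.
- by exists e; rewrite !wliftM wliftV -[wlift u * _ * _]mulgA weq_mulgV mulg1 -wliftM.
- by exists e; move: H; rewrite !wliftM wliftV -[wlift u * _ * _]mulgA weq_mulgV mulg1.
Qed.

Variables (gT eT : finGroupType) (M : {group gT}) (E : {group eT}).
Variables (x : todd_gen -> gT) (y : ext_gen -> eT).
Variables (iota : {morphism [set: 'rV['F_2]_11] >-> eT}) (pi : {morphism E >-> gT}).
Hypothesis M_pres : presents M x (todd_relators (@wgen todd_gen)).
Hypotheses (iota_inj : 'injm iota) (iota_ker : iota @* [set: 'rV['F_2]_11] = 'ker pi).
Hypothesis pi_onto : pi @* E = M.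
Hypotheses (yE : forall s, y (inl s) \in E) (pi_y : forall s, pi (y (inl s)) = x s).
Hypothesis y_v : forall r, y (inr r) = iota (delta_mx 0%R r).
Hypothesis yR : forall r, r \in R -> word_eval y r = 1.

Let iotaK v : iota v \in 'ker pi.
Proof. by rewrite -iota_ker mem_morphim ?inE. Qed.

Let yEE k : y k \in E.
Proof. by case: k => // r; rewrite y_v; have := iotaK (delta_mx 0%R r); case/setIP. Qed.

Lemma word_eval_vw e : word_eval y (vw e) = iota e.
Proof.
rewrite word_eval_prod [in RHS](row_sum_delta e).
elim: (index_enum _) => [|k s IH].
  by rewrite !big_nil; apply/esym/morph1.
rewrite !big_cons IH morphM ?in_setT //; congr (_ * _).
rewrite word_evalX word_eval_gen y_v.
have [->|->] := F2_01 (e ord0 k); last by rewrite scale1r.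
by rewrite scale0r; apply/esym/morph1.
Qed.

(** A word trivial in [E] has normal form [wlift u * vw e] with [u] trivial in [M]. By
    [closure_lift] the whole word is then equal, in the presented group, to one vector word, and
    injectivity of [iota] makes its vector 0. *)
Lemma presents_extension : presents E y R.
Proof.
split.
  apply/eqP; rewrite eqEsubset gen_subG; apply/andP; split.
    by apply/subsetP=> _ /imsetP[k _ ->].
  pose Y := <<[set y k | k : ext_gen]>>%G; rewrite -[<<_>>]/(gval Y).
  have yY k : y k \in Y by apply: mem_gen; apply: imset_f.
  apply/subsetP=> e Ee.
  have Me : pi e \in M by rewrite -pi_onto mem_morphim.
  have [w /eqP Dw] := word_eval_onto M_pres.1 Me.
  have Yw : word_eval y (wlift w) \in Y by apply: word_eval_in.
  have piw : pi (word_eval y (wlift w)) = pi e.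
    rewrite (word_eval_morph _ _ yEE) -Dw /word_eval big_map.
    by apply: eq_bigr => l _ /=; rewrite pi_y.
  have : (word_eval y (wlift w))^-1 * e \in 'ker pi.
    apply/kerP; first by rewrite groupM ?groupV // word_eval_in.
    by rewrite morphM ?groupV ?morphV ?word_eval_in // piw mulVg.
  rewrite -iota_ker => /morphimP[v _ _ Dv].
  rewrite -(mulKVg (word_eval y (wlift w)) e) groupM // Dv -word_eval_vw.
  exact: word_eval_in.
move=> w; split; last exact: word_eval_closure.
move=> yw; have [u [e H]] := ext_normal_form w.
have Dy := weq_eval yR H; rewrite yw word_evalM word_eval_vw in Dy.
have : word_eval x u = 1.
  have : pi (word_eval y (wlift u) * iota e) = 1 by rewrite -Dy morph1.
  rewrite morphM ?word_eval_in //; last by case/setIP: (iotaK e).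
  rewrite (mker (iotaK e)) mulg1 (word_eval_morph _ _ yEE) => <-.
  by rewrite /word_eval big_map; apply: eq_bigr => l _ /=; rewrite pi_y.
case/M_pres.2/closure_lift => f Hf.
have {}H : w =w vw (f + e)%R by rewrite H Hf vwD.
have := weq_eval yR H; rewrite yw word_eval_vw => Dfe.
(* Here [1] is the unit of the additive group of row vectors, that is the zero vector. *)
have : (f + e)%R = 1 by apply: (injmP iota_inj); rewrite ?in_setT // -Dfe morph1.
by move=> fe0; apply/closure_weq; rewrite H fe0 -vw0.
Qed.

End ExtensionPresentation.

(** * Matrix tables of the two modules *)

Definition rho1N : seq (seq N) :=
  [:: [:: 498; 1990; 64; 748; 1635; 32; 4; 128; 256; 512; 1024]%num;
      [:: 2; 1; 16; 939; 4; 32; 1635; 128; 256; 512; 1024]%num;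
      [:: 16; 4; 2; 1209; 1; 32; 1990; 128; 256; 512; 1024]%num;
      [:: 1118; 477; 748; 64; 1912; 32; 8; 128; 256; 512; 1024]%num;
      [:: 258; 1465; 242; 221; 1374; 256; 683; 384; 288; 768; 1280]%num;
      [:: 10; 9; 506; 8; 1643; 469; 1998; 1797; 1904; 520; 1032]%num;
      [:: 33; 1177; 716; 96; 1603; 32; 40; 544; 288; 160; 1056]%num;
      [:: 1177; 34; 907; 40; 48; 32; 466; 160; 288; 1303; 1056]%num;
      [:: 2; 1; 16; 8; 4; 256; 1990; 128; 32; 512; 1335]%num].

(** The inverses of the matrices in [rho1N]. Only that of t differs, since the other eight
    generators of M_23 are involutions. *)
Definition rho1VN : seq (seq N) :=
  [:: [:: 498; 1990; 64; 748; 1635; 32; 4; 128; 256; 512; 1024]%num;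
      [:: 2; 1; 16; 939; 4; 32; 1635; 128; 256; 512; 1024]%num;
      [:: 16; 4; 2; 1209; 1; 32; 1990; 128; 256; 512; 1024]%num;
      [:: 1118; 477; 748; 64; 1912; 32; 8; 128; 256; 512; 1024]%num;
      [:: 1177; 33; 716; 1880; 1603; 288; 2022; 160; 32; 544; 1056]%num;
      [:: 10; 9; 506; 8; 1643; 469; 1998; 1797; 1904; 520; 1032]%num;
      [:: 33; 1177; 716; 96; 1603; 32; 40; 544; 288; 160; 1056]%num;
      [:: 1177; 34; 907; 40; 48; 32; 466; 160; 288; 1303; 1056]%num;
      [:: 2; 1; 16; 8; 4; 256; 1990; 128; 32; 512; 1335]%num].

Definition rho2N : seq (seq N) :=
  [:: [:: 16; 19; 74; 8; 1; 57; 31; 139; 259; 538; 1042]%num;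
      [:: 74; 73; 16; 8; 4; 104; 64; 136; 264; 584; 1088]%num;
      [:: 24; 68; 66; 8; 9; 40; 64; 200; 320; 576; 1096]%num;
      [:: 2; 1; 7; 87; 19; 52; 31; 134; 274; 532; 1041]%num;
      [:: 19; 80; 68; 13; 9; 2018; 92; 197; 104; 604; 1113]%num;
      [:: 178; 85; 224; 1631; 292; 276; 372; 100; 484; 976; 1488]%num;
      [:: 19; 16; 4; 70; 2; 2025; 28; 518; 256; 148; 1042]%num;
      [:: 517; 582; 512; 13; 593; 1466; 64; 197; 836; 4; 1537]%num;
      [:: 1026; 1089; 1104; 8; 1028; 1280; 64; 192; 1120; 576; 1088]%num].

Definition rho2VN : seq (seq N) :=
  [:: [:: 16; 19; 74; 8; 1; 57; 31; 139; 259; 538; 1042]%num;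
      [:: 74; 73; 16; 8; 4; 104; 64; 136; 264; 584; 1088]%num;
      [:: 24; 68; 66; 8; 9; 40; 64; 200; 320; 576; 1096]%num;
      [:: 2; 1; 7; 87; 19; 52; 31; 134; 274; 532; 1041]%num;
      [:: 74; 85; 24; 90; 30; 326; 28; 206; 1971; 576; 1042]%num;
      [:: 178; 85; 224; 1631; 292; 276; 372; 100; 484; 976; 1488]%num;
      [:: 19; 16; 4; 70; 2; 2025; 28; 518; 256; 148; 1042]%num;
      [:: 517; 582; 512; 13; 593; 1466; 64; 197; 836; 4; 1537]%num;
      [:: 1026; 1089; 1104; 8; 1028; 1280; 64; 192; 1120; 576; 1088]%num].

Definition idN : seq N := [:: 1; 2; 4; 8; 16; 32; 64; 128; 256; 512; 1024]%num.

Lemma all_iotaP (P : pred nat) n : all P (iota 0 n) -> forall i : 'I_n, P i.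
Proof. by move/allP=> H i; apply: H; rewrite mem_iota leq0n ltn_ord. Qed.

Lemma mxN_id : mxN idN = 1%:M%R.
Proof.
pose P r k := N.testbit (nth 0%num idN r) (N.of_nat k) == (r == k).
have H : all (fun r => all (P r) (iota 0 11)) (iota 0 11) by vm_compute.
apply/matrixP=> r k; rewrite !mxE /bitF.
by rewrite (eqP (all_iotaP (all_iotaP H r) k)).
Qed.

Definition letter (T TV : seq (seq N)) (s : nat) (b : bool) : seq N :=
  nth [::] (if b then TV else T) s.

Definition word_mx (T TV : seq (seq N)) (w : gword todd_gen) : seq N :=
  foldr (fun (l : todd_gen * bool) A => mmul (letter T TV l.1 l.2) A) idN w.

Definition table_ok (T TV : seq (seq N)) : bool :=
  all (fun s => [&& size (nth [::] T s) == 11, size (nth [::] TV s) == 11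
        & all2 N.eqb (mmul (nth [::] T s) (nth [::] TV s)) idN]) (iota 0 9) &&
  all (fun r => all2 N.eqb (word_mx T TV r) idN) (todd_relators (@wgen todd_gen)).

Lemma all2_Neqb (A B : seq N) : all2 N.eqb A B -> A = B.
Proof.
by elim: A B => [|a A IH] [|b B] //= /andP[/N.eqb_spec -> /IH ->].
Qed.

Lemma rho1_ok : table_ok rho1N rho1VN.
Proof. by vm_compute. Qed.

Lemma rho2_ok : table_ok rho2N rho2VN.
Proof. by vm_compute. Qed.

Section TableRepresentation.

Variables (T TV : seq (seq N)).
Hypothesis Tok : table_ok T TV.

Lemma table_size (s : todd_gen) b : size (letter T TV s b) = 11.
Proof.
have /andP[/all_iotaP/(_ s)/and3P[/eqP H /eqP HV _] _] := Tok.
by case: b.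
Qed.

Lemma table_mulV (s : todd_gen) :
  (mxN (nth [::] T s) *m mxN (nth [::] TV s) = 1%:M)%R.
Proof.
have /andP[/all_iotaP/(_ s)/and3P[/eqP H /eqP HV /all2_Neqb E] _] := Tok.
by rewrite -mxN_mmul // E mxN_id.
Qed.

Lemma table_unit (s : todd_gen) : mxN (nth [::] T s) \in unitmx.
Proof. by have [] := mulmx1_unit (table_mulV s). Qed.

Lemma table_invmx (s : todd_gen) : invmx (mxN (nth [::] T s)) = mxN (nth [::] TV s).
Proof. by rewrite -[RHS](mulKmx (table_unit s)) table_mulV mulmx1. Qed.

Lemma size_word_mx w : size (word_mx T TV w) = 11.
Proof. by case: w => [|l w] //=; rewrite size_mmul table_size. Qed.

(** The default of [insubd] is never taken, by [table_unit]. *)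
Definition table_GL (s : todd_gen) : {'GL_11['F_2]} :=
  insubd (1 : {'GL_11['F_2]}) (mxN (nth [::] T s)).

Lemma table_GLE s : GLval (table_GL s) = mxN (nth [::] T s).
Proof. by rewrite [GLval _]insubdK // ; apply: table_unit. Qed.

Lemma word_eval_GL w : GLval (word_eval table_GL w) = mxN (word_mx T TV w).
Proof.
elim: w => [|l w IH]; first by rewrite mxN_id -[[::]]/(1 : gword todd_gen) word_eval1.
rewrite word_eval_cons GL_MxE IH /= mxN_mmul ?size_word_mx ?table_size //.
congr (_ *m _)%R; rewrite /letter; case: l.2; last exact: table_GLE.
by rewrite GL_VxE table_GLE table_invmx.
Qed.

Lemma table_GL_relators r :
  r \in todd_relators (@wgen todd_gen) -> word_eval table_GL r = 1.
Proof.
move=> rR; apply/val_inj; rewrite /= word_eval_GL.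
have /andP[_ /allP/(_ r rR)/all2_Neqb ->] := Tok.
by rewrite mxN_id.
Qed.

Lemma table_repr (gT : finGroupType) (M : {group gT}) (x : todd_gen -> gT) :
  presents M x (todd_relators (@wgen todd_gen)) ->
  exists rho : mx_representation 'F_2 M 11,
    forall s, rho (x s) = mxN (nth [::] T s).
Proof.
move=> prM; have [f Df] := presents_hom prM table_GL_relators.
have fM : mx_repr M (fun g => GLval (f g)).
  by split=> [|g h Mg Mh]; rewrite ?morph1 ?morphM.
by exists (MxRepresentation fM) => s; rewrite /= Df table_GLE.
Qed.

End TableRepresentation.

Lemma rho1_mxE s : rho1_mx s = mxN (nth [::] rho1N s).
Proof.
pose P s r k := bit_at (nth String.EmptyString (nth [::] rho1_rows s) r) k
  == N.testbit (nth 0%num (nth [::] rho1N s) r) (N.of_nat k).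
have H : all (fun s => all (fun r => all (P s r) (iota 0 11)) (iota 0 11)) (iota 0 9).
  by vm_compute.
apply/matrixP=> r k; rewrite !mxE /bitF.
by rewrite (eqP (all_iotaP (all_iotaP (all_iotaP H s) r) k)).
Qed.

Lemma rho2_mxE s : rho2_mx s = mxN (nth [::] rho2N s).
Proof.
rewrite /rho2_mx rho1_mxE (table_invmx rho1_ok).
pose P s r k := N.testbit (nth 0%num (nth [::] rho1VN s) k) (N.of_nat r)
  == N.testbit (nth 0%num (nth [::] rho2N s) r) (N.of_nat k).
have H : all (fun s => all (fun r => all (P s r) (iota 0 11)) (iota 0 11)) (iota 0 9).
  by vm_compute.
apply/matrixP=> r k; rewrite !mxE /bitF.
by rewrite (eqP (all_iotaP (all_iotaP (all_iotaP H s) r) k)).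
Qed.

(** * The permutation representation of degree 23 *)

Definition perm23 : seq (seq nat) :=
  [:: [:: 9; 1; 18; 3; 15; 11; 16; 13; 8; 0; 10; 5; 19; 7; 14; 4; 6; 21; 2; 12; 20; 17; 22]%N;
      [:: 18; 1; 9; 3; 5; 4; 7; 6; 8; 2; 10; 15; 21; 16; 14; 11; 13; 19; 0; 17; 20; 12; 22]%N;
      [:: 12; 1; 17; 3; 7; 6; 5; 4; 8; 19; 10; 16; 0; 15; 14; 13; 11; 2; 21; 9; 20; 18; 22]%N;
      [:: 5; 1; 15; 3; 18; 0; 12; 21; 8; 11; 10; 9; 6; 17; 14; 2; 19; 13; 4; 16; 20; 7; 22]%N;
      [:: 5; 1; 16; 3; 21; 13; 19; 6; 14; 12; 8; 2; 18; 0; 10; 4; 11; 17; 9; 7; 20; 15; 22]%N;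
      [:: 0; 1; 2; 17; 15; 13; 7; 6; 9; 8; 12; 16; 10; 5; 18; 4; 11; 3; 14; 19; 20; 21; 22]%N;
      [:: 5; 3; 18; 1; 15; 0; 19; 7; 10; 11; 8; 9; 16; 13; 14; 4; 12; 17; 2; 6; 20; 21; 22]%N;
      [:: 16; 22; 5; 3; 4; 2; 6; 19; 10; 9; 8; 13; 18; 11; 14; 21; 0; 17; 12; 7; 20; 15; 1]%N;
      [:: 21; 1; 2; 3; 5; 4; 7; 6; 8; 9; 14; 16; 18; 15; 10; 13; 11; 17; 12; 19; 22; 0; 20]%N].

Definition perm23V : seq (seq nat) :=
  [:: [:: 9; 1; 18; 3; 15; 11; 16; 13; 8; 0; 10; 5; 19; 7; 14; 4; 6; 21; 2; 12; 20; 17; 22]%N;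
      [:: 18; 1; 9; 3; 5; 4; 7; 6; 8; 2; 10; 15; 21; 16; 14; 11; 13; 19; 0; 17; 20; 12; 22]%N;
      [:: 12; 1; 17; 3; 7; 6; 5; 4; 8; 19; 10; 16; 0; 15; 14; 13; 11; 2; 21; 9; 20; 18; 22]%N;
      [:: 5; 1; 15; 3; 18; 0; 12; 21; 8; 11; 10; 9; 6; 17; 14; 2; 19; 13; 4; 16; 20; 7; 22]%N;
      [:: 13; 1; 11; 3; 15; 0; 7; 19; 10; 18; 14; 16; 9; 5; 8; 21; 2; 17; 12; 6; 20; 4; 22]%N;
      [:: 0; 1; 2; 17; 15; 13; 7; 6; 9; 8; 12; 16; 10; 5; 18; 4; 11; 3; 14; 19; 20; 21; 22]%N;
      [:: 5; 3; 18; 1; 15; 0; 19; 7; 10; 11; 8; 9; 16; 13; 14; 4; 12; 17; 2; 6; 20; 21; 22]%N;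
      [:: 16; 22; 5; 3; 4; 2; 6; 19; 10; 9; 8; 13; 18; 11; 14; 21; 0; 17; 12; 7; 20; 15; 1]%N;
      [:: 21; 1; 2; 3; 5; 4; 7; 6; 8; 9; 14; 16; 18; 15; 10; 13; 11; 17; 12; 19; 22; 0; 20]%N].

Definition perm23_at (s : nat) (b : bool) (k : nat) : nat :=
  nth 0 (nth [::] (if b then perm23V else perm23) s) k.

(** Permutations act on the right, so the letters of a word are applied from left to right. *)
Definition perm23_word (w : gword todd_gen) (k : nat) : nat :=
  foldl (fun k (l : todd_gen * bool) => perm23_at l.1 l.2 k) k w.

Lemma perm23_ok :
  all (fun s => all (fun k => [&& perm23_at s false k < 23, perm23_at s true k < 23
        & (perm23_at s true (perm23_at s false k) == k)]) (iota 0 23)) (iota 0 9) &&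
  all (fun r => all (fun k => perm23_word r k == k) (iota 0 23))
    (todd_relators (@wgen todd_gen)).
Proof. by vm_compute. Qed.

Definition perm23_fun (s : todd_gen) (k : 'I_23) : 'I_23 := inord (perm23_at s false k).

Lemma perm23_lt (s : todd_gen) b (k : 'I_23) : perm23_at s b k < 23.
Proof.
have /andP[/all_iotaP/(_ s)/all_iotaP/(_ k)/and3P[]] := perm23_ok.
by case: b.
Qed.

Lemma perm23K (s : todd_gen) (k : 'I_23) :
  perm23_at s true (perm23_at s false k) = k.
Proof.
by have /andP[/all_iotaP/(_ s)/all_iotaP/(_ k)/and3P[_ _ /eqP]] := perm23_ok.
Qed.

Lemma perm23_inj s : injective (perm23_fun s).
Proof.
move=> k l /(congr1 (@nat_of_ord 23)); rewrite /perm23_fun !inordK ?perm23_lt // => E.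
by apply/val_inj; rewrite /= -[LHS](perm23K s) E perm23K.
Qed.

Definition perm23_gen (s : todd_gen) : 'S_23 := perm (@perm23_inj s).

Lemma perm23_eval (w : gword todd_gen) (k : 'I_23) :
  word_eval perm23_gen w k = perm23_word w k :> nat.
Proof.
elim: w k => [|[s b] w IH] k.
  by rewrite -[[::]]/(1 : gword todd_gen) word_eval1 perm1.
rewrite word_eval_cons permM IH; congr (perm23_word w _) => /=.
case: b; last by rewrite permE /perm23_fun inordK // (perm23_lt s false k).
have Dk : perm23_gen s ((perm23_gen s)^-1 k) = k by rewrite permKV.
move: ((perm23_gen s)^-1 k) Dk => m <-.
by rewrite permE /perm23_fun inordK ?perm23_lt // perm23K.
Qed.

Lemma simple_hom_inj (gT hT : finGroupType) (M : {group gT})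
    (f : {morphism M >-> hT}) g : simple M -> g \in M -> f g != 1 -> 'injm f.
Proof.
move=> /simpleP[_ simM] Mg fg; case: (simM _ (ker_normal f)) => kerf.
  by rewrite kerf.
by rewrite (mker (_ : g \in 'ker f)) ?eqxx ?kerf in fg.
Qed.

Lemma perm23_faithful (gT : finGroupType) (M : {group gT}) (x : todd_gen -> gT) :
  simple M -> presents M x (todd_relators (@wgen todd_gen)) ->
  exists f : {morphism M >-> 'S_23}, 'injm f.
Proof.
move=> simM prM; have [r rR|f Df] := presents_hom (y := perm23_gen) prM.
  apply/permP=> k; apply/val_inj; rewrite /= perm23_eval perm1.
  have /andP[_ /allP/(_ r rR)/all_iotaP/(_ k)] := perm23_ok.
  by move/eqP.
(* By simplicity one moved point suffices: the generator a does not fix 0. *)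
exists f; apply: (simple_hom_inj simM (presents_gen (@Ordinal 9 0 isT) prM)).
rewrite Df; apply/eqP=> /permP/(_ ord0)/(congr1 (@nat_of_ord 23)).
by rewrite permE perm1 /perm23_fun inordK.
Qed.

(** * Fixed vectors of elements of prime order *)

Section FixedVectors.

Local Open Scope ring_scope.

Variables (gT : finGroupType) (G : {group gT}) (n : nat).
Variables (rG : mx_representation 'F_2 G n) (p : nat) (g : gT).
Hypotheses (pr_p : prime p) (Gg : g \in G) (og : #[g]%g = p).

(** Orbits of <g> have length 1 or p, so the numbers of all vectors and of fixed vectors agree
    modulo p. Both are powers of 2, because the fixed vectors form a subspace. *)
Lemma pfix_count (A : 'M['F_2]_n) : (A *m rG g <= A)%MS ->
  exists B : 'M['F_2]_n, [/\ (B <= A)%MS, (B *m rG g = B)%R,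
    forall v : 'rV_n, (v <= A)%MS -> (v *m rG g = v)%R -> (v <= B)%MS
  & (2 ^ \rank A = 2 ^ \rank B %[mod p])%N].
Proof.
move=> Ag; pose B := (A :&: kermx (rG g - 1%:M)%R)%MS.
have inB (v : 'rV_n) : (v <= B)%MS = (v <= A)%MS && (v *m rG g == v)%R.
  by rewrite sub_capmx (sameP sub_kermxP eqP) mulmxBr mulmx1 subr_eq0.
have BB : (B *m rG g = B)%R.
  apply/row_matrixP=> i; rewrite row_mul; apply/eqP.
  by have := row_sub i B; rewrite inB => /andP[].
exists B; split=> //; first exact: capmxSl.
  by move=> v Av /eqP Bv; rewrite inB Av.
have sgG : <[g]>%g \subset G by rewrite cycle_subG.
have pg : p.-group <[g]>%g by rewrite /pgroup -orderE og pnat_id.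
have acts : [acts <[g]>%g, on rowg A | 'MR rG].
  rewrite cycle_subG !inE Gg /=; apply/subsetP=> v; rewrite !inE mx_repr_actE //.
  by move=> Av; apply: submx_trans Ag; apply: submxMr.
have := pgroup_fix_mod pg acts; rewrite card_rowg card_Fp // => ->.
have -> : (2 ^ \rank B)%N = #|rowg B| by rewrite card_rowg card_Fp.
congr (_ %% _)%N; apply: eq_card => v.
rewrite afix_cycle_in // [LHS]inE !mem_rowg inB; congr (_ && _).
by apply/afix1P/eqP; rewrite /= mx_repr_actE.
Qed.

End FixedVectors.

(** * Normal form of an irreducible module of dimension 11 *)

Section NormalForm.

Local Open Scope ring_scope.

(** The order of 2 modulo 23 is 11. Hence the fixed space of [g] has dimension 0 or 11, and 11 is
    excluded because [g] acts non-trivially; an invariant subspace without non-zero fixed vectors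
    then has dimension 0 or 11 as well. *)
Lemma order23_stable (gT : finGroupType) (G : {group gT})
    (rG : mx_representation 'F_2 G 11) g (A : 'M_11) :
  g \in G -> #[g]%g = 23%N -> rG g != 1%:M -> (A *m rG g <= A)%MS ->
  \rank A = 0%N \/ \rank A = 11%N.
Proof.
move=> Gg og ntg.
have pow23 k : (k <= 11)%N -> (2 ^ 0 = 2 ^ k %[mod 23])%N -> k = 0%N \/ k = 11%N.
  by move: k; do 12?[case=> //]; try by [left | right].
have [B0 [_ B0g B0max B0r]] := pfix_count (isT : prime 23) Gg og (submx1 (1%:M *m rG g)).
have {}B0r : (2 ^ 0 = 2 ^ \rank B0 %[mod 23])%N by rewrite -B0r mxrank1.
have [rB0|rB0] := pow23 _ (rank_leq_row B0) B0r; last first.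
  case/eqP: ntg; have uB : B0 \in unitmx by rewrite -row_full_unit /row_full rB0.
  by rewrite -(mulKmx uB (rG g)) B0g mulVmx.
move=> Ag; have [B [sBA Bg _ Ar]] := pfix_count (isT : prime 23) Gg og Ag.
have B_0 : B = 0.
  apply/eqP; rewrite -submx0; apply: submx_trans (_ : B <= B0)%MS _; last first.
    by rewrite submx0 -mxrank_eq0 rB0.
  apply/row_subP=> i; apply: B0max; first exact: submx1.
  by rewrite -row_mul Bg.
by apply: pow23 (rank_leq_row A) _; rewrite Ar B_0 mxrank0.
Qed.

(** As 2 ^ 11 is congruent to 2 and not to 1 modulo 11, the zero vector is not the only fixed
    one. *)
Lemma order11_fixed (gT : finGroupType) (G : {group gT})
    (rG : mx_representation 'F_2 G 11) g :
  g \in G -> #[g]%g = 11%N -> exists2 v : 'rV_11, v != 0 & v *m rG g = v.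
Proof.
move=> Gg og.
have [B [_ Bg _ rB]] := pfix_count (isT : prime 11) Gg og (submx1 (1%:M *m rG g)).
have [i Bi] : exists i, row i B != 0.
  apply/existsP; apply: contraLR isT; rewrite negb_exists => /forallP B0.
  have B_0 : B = 0 by apply/row_matrixP=> i; rewrite row0; apply/eqP/negPn/B0.
  by move: rB; rewrite B_0 mxrank1 mxrank0.
by exists (row i B); rewrite // -row_mul Bg.
Qed.

(** Equality of the vectors and not of the numbers: bits from 11 on are ignored. *)
Definition rveq (u v : N) : bool :=
  all (fun k => N.testbit u (N.of_nat k) == N.testbit v (N.of_nat k)) (iota 0 11).

Lemma rveqP u v : reflect (rvN u = rvN v) (rveq u v).
Proof.
apply: (iffP idP) => [/all_iotaP H | H].
  by apply/rowP=> k; rewrite !mxE /bitF (eqP (H k)).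
apply/allP=> k; rewrite mem_iota => /andP[_ lk].
have /rowP/(_ (Ordinal lk)) := H; rewrite !mxE /bitF /=.
by case: N.testbit; case: N.testbit.
Qed.

(** On [idN] this lists all 2 ^ 11 vectors, which turns a quantifier over vectors into a finite
    check. *)
Fixpoint nspan (s : seq N) : seq N :=
  if s is b :: s' then nspan s' ++ [seq N.lxor b v | v <- nspan s'] else [:: 0%num].

Lemma rvN_onto (v : 'rV['F_2]_11) : exists2 c, c \in nspan idN & rvN c = v.
Proof.
exists (encV v); last exact: encVK.
rewrite /encV /encb -[idN]/[seq N.shiftl 1 (N.of_nat k) | k <- iota 0 11].
elim: (iota 0 11) => [|k s IH] //=; rewrite mem_cat.
by case: ifP => _; rewrite ?IH // orbC map_f.
Qed.

Definition mpow (A : seq N) (k : nat) : seq N := iter k (fun X => mmul X A) idN.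

Local Arguments mpow : simpl never.
Local Arguments vmul : simpl never.

Definition companion (c : N) : seq N :=
  [:: 2; 4; 8; 16; 32; 64; 128; 256; 512; 1024; c]%num.

(** If z is multiplication by X on F_2[X]/(P) and f fixes the vector 1, then z f = f z^2 forces f to
    send X^i to X^(2i): it is the squaring map. *)
Definition frobenius (Z : seq N) : seq N :=
  [seq nth 0%num (mpow Z i.*2) 0 | i <- iota 0 11].

Definition conj_rows (F : seq N) (v : N) : seq N :=
  [seq vmul v (mpow F i) | i <- iota 0 11].

(** Since f^i u = u f^(3i), the vector n f^i is mapped by u to w f^(3i), where w = n u; [NV] is the
    inverse of the matrix with rows n f^i. *)
Definition u_matrix (F NV : seq N) (w : N) : seq N :=
  mmul NV (conj_rows (mpow F 3) w).

(** The relation is tested on one vector at a time, without products of matrices; two basis vectors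
    are enough to single out w among all candidates. *)
Definition u_relation (Z U : seq N) (e : N) : bool :=
  rveq (foldl vmul e [:: Z; U; U; mpow Z 15; U])
       (foldl vmul e [:: U; mpow Z 11; U; mpow Z 19]).

(* With respect to the basis v, vz, .., vz^10 for a vector v fixed by f, z is a
   companion matrix, f permutes the powers of z, and u is determined by the
   image w of a vector n whose f-conjugates form a basis. *)
Definition nf_ok (c n : N) (NV : seq N) (w0 : N) : bool :=
  let Z := companion c in let F := frobenius Z in
  [&& size NV == 11%N, all2 N.eqb (mmul NV (conj_rows F n)) idN,
    ~~ rveq (vmul n F) n
  & all (fun w => let U := u_matrix F NV w in
      if u_relation Z U 1%num then
        if u_relation Z U 2%num then
          if rveq (vmul w (mpow F 3)) w then true else N.eqb w w0
        else true else true) (nspan idN)].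

(** Each tuple consists of c, n, [NV] and w0. The numbers 739 and 1141 encode X^11 modulo
    X^11+X^9+X^7+X^6+X^5+X+1 and modulo X^11+X^10+X^6+X^5+X^4+X^2+1, the two generator polynomials
    of the binary Golay code. *)
Definition nf1 := (739%num, 3%num,
  [:: 2047; 2046; 2045; 1791; 2043; 1140; 1535; 285; 2039; 2015; 233]%num, 366%num).
Definition nf2 := (1141%num, 2%num,
  [:: 2047; 1; 2; 256; 4; 571; 512; 1678; 8; 32; 1142]%num, 1560%num).

Lemma nf1_ok : nf_ok nf1.1.1.1 nf1.1.1.2 nf1.1.2 nf1.2.
Proof. by vm_compute. Qed.

Lemma nf2_ok : nf_ok nf2.1.1.1 nf2.1.1.2 nf2.1.2 nf2.2.
Proof. by vm_compute. Qed.

(* Only these two companion matrices have multiplicative order 23: x^23 - 1 has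
   exactly two divisors of degree 11 over F_2. *)
Lemma companion23 :
  all (fun c => rveq (iter 23 (fun v => vmul v (companion c)) 1%num) 1%num ==>
    (N.eqb c 739 || N.eqb c 1141)) (nspan idN).
Proof. by vm_compute. Qed.

Definition nfZ (nf : N * N * seq N * N) : seq N := companion nf.1.1.1.
Definition nfF (nf : N * N * seq N * N) : seq N := frobenius (nfZ nf).
Definition nfU (nf : N * N * seq N * N) : seq N := u_matrix (nfF nf) nf.1.2 nf.2.

Definition has_nf (B Z F U : 'M['F_2]_11) nf : Prop :=
  [/\ B *m Z = mxN (nfZ nf) *m B, B *m F = mxN (nfF nf) *m B
    & B *m U = mxN (nfU nf) *m B].

Section Existence.

Variables (Z F U : 'M['F_2]_11) (v : 'rV['F_2]_11).
Hypothesis Zstable :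
  forall A : 'M_11, (A *m Z <= A)%MS -> \rank A = 0%N \/ \rank A = 11%N.
Hypotheses (Z23 : Z ^+ 23 = 1) (ZF : Z * F = F * Z ^+ 2) (FU : F * U = U * F ^+ 3).
Hypothesis ZU : Z * U * U * Z ^+ 15 * U = U * Z ^+ 11 * U * Z ^+ 19.
Hypotheses (nz_v : v != 0) (vF : v *m F = v) (uU : U \in unitmx).

Let r i : 'rV_11 := v *m Z ^+ i.
Let B : 'M_11 := \matrix_(i < 11) r i.

Let rS i : r i *m Z = r i.+1.
Proof. by rewrite /r -mulmxA -[Z ^+ i *m Z]exprSr. Qed.

(** If v Z^k lies in the span of its predecessors, this span is invariant under Z and has rank k <
    11. By [Zstable] then k = 0, which contradicts v being non-zero. *)
Lemma cyclic_basis_unit : B \in unitmx.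
Proof.
have H k : (k <= 11)%N -> \rank (\sum_(i < k) <<r i>>)%MS = k.
  elim: k => [|k IH] lek; first by rewrite big_ord0 mxrank0.
  pose A := (\sum_(i < k) <<r i>>)%MS.
  have rA : \rank A = k by apply/IH/ltnW.
  have nrA : ~~ (<<r k>> <= A)%MS.
    apply/negP=> rkA; have : (A *m Z <= A)%MS.
      rewrite sumsmxMr; apply/sumsmx_subP=> i _.
      rewrite (eqmxMr _ (genmxE _)) rS.
      have [lt_i|ge_i] := ltnP i.+1 k.
        by apply: (sumsmx_sup (Ordinal lt_i)); rewrite ?genmxE.
      have -> : i.+1 = k by apply/eqP; rewrite eqn_leq ge_i andbT ltn_ord.
      by rewrite -(genmxE (r k)).
    case/Zstable=> rA0; rewrite rA in rA0; last by rewrite rA0 in lek.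
    move: rkA; rewrite /A rA0 big_ord0 genmxE submx0 /r expr0 mulmx1.
    exact/negP.
  rewrite big_ord_recr /= -/A; have := mxrank_sum_cap A <<r k>>%MS.
  have -> : \rank <<r k>>%MS = 1%N.
    rewrite genmxE rank_rV; case: eqP => // rk0; case/negP: nrA.
    by rewrite genmxE rk0 sub0mx.
  suff -> : \rank (A :&: <<r k>>)%MS = 0%N by rewrite addn0 rA addn1.
  apply/eqP; rewrite -leqn0 -ltnS ltn_neqAle.
  have rk1 : (\rank (A :&: <<r k>>) <= 1)%N.
    by apply: leq_trans (mxrankS (capmxSr _ _)) _; rewrite genmxE rank_leq_row.
  rewrite rk1 andbT; apply: contra nrA => /eqP rk_1.
  apply: submx_trans (capmxSl A <<r k>>%MS).
  rewrite -(mxrank_leqif_sup (capmxSr A <<r k>>%MS)) rk_1 eqn_leq.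
  have := mxrankS (capmxSr A <<r k>>%MS); rewrite rk_1 => ->.
  by rewrite genmxE rank_leq_row.
rewrite -row_full_unit /row_full eqn_leq rank_leq_col /=.
apply: leq_trans (_ : \rank (\sum_(i < 11) <<r i>>)%MS <= _)%N.
  by rewrite (H 11).
apply: mxrankS; apply/sumsmx_subP=> i _.
by rewrite genmxE (eq_row_sub i) // rowK.
Qed.

Let uB := cyclic_basis_unit.

Let rvN_injB x y : rvN x *m B = rvN y *m B -> rvN x = rvN y.
Proof. by move/(congr1 (mulmx^~ (invmx B))); rewrite !mulmxK. Qed.

Let rvN_delta (i : 'I_11) : rvN (nth 0%num idN i) = delta_mx 0 i.
Proof. by rewrite -row_mxN mxN_id row1. Qed.

Let e0B : rvN 1 *m B = v.
Proof. by rewrite (rvN_delta ord0) -rowE rowK /r expr0 mulmx1. Qed.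

Lemma companion_conj : exists2 c, c \in nspan idN & B *m Z = mxN (companion c) *m B.
Proof.
have [c c_in Dc] := rvN_onto (r 11 *m invmx B).
exists c => //; apply/row_matrixP=> i; rewrite !row_mul row_mxN rowK rS.
have [lt_i|ge_i] := ltnP i.+1 11.
  have -> : nth 0%num (companion c) i = nth 0%num idN (Ordinal lt_i).
    by case: i lt_i => -[|[|[|[|[|[|[|[|[|[|[|i]]]]]]]]]]].
  by rewrite rvN_delta -rowE rowK.
have -> : i = ord_max by apply/val_inj => /=; have := ltn_ord i; lia.
by rewrite [nth _ _ _]/= Dc mulmxKV.
Qed.

Definition conjB (A : seq N) (Q : 'M['F_2]_11) : Prop :=
  size A = 11%N /\ B *m Q = mxN A *m B.

Lemma conjB_step A Q e : conjB A Q -> rvN (vmul e A) *m B = rvN e *m B *m Q.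
Proof. by case=> sA HA; rewrite rvN_vmul // -!mulmxA HA. Qed.

Lemma conjB_foldl As Qs e : List.Forall2 conjB As Qs ->
  rvN (foldl vmul e As) *m B = foldl (fun X Q => X *m Q) (rvN e *m B) Qs.
Proof.
move=> H; elim: H e => [|A Q As' Qs' HA _ IH] e //=.
by rewrite IH (conjB_step _ HA).
Qed.

Lemma conjBM A Q A' Q' : conjB A Q -> conjB A' Q' -> conjB (mmul A A') (Q * Q').
Proof.
move=> [sA HA] [sA' HA']; split; first by rewrite size_mmul.
by rewrite mxN_mmul // -[Q * Q']/(Q *m Q') mulmxA HA -!mulmxA HA'.
Qed.

Lemma conjBX A Q k : conjB A Q -> conjB (mpow A k) (Q ^+ k).
Proof.
move=> HA; elim: k => [|k IH]; first by split=> //; rewrite mxN_id mulmx1 mul1mx.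
by rewrite exprSr; apply: conjBM.
Qed.

Lemma normal_form : exists2 nf, nf \in [:: nf1; nf2] & has_nf B Z F U nf.
Proof.
have [c c_in Zc] := companion_conj.
have cZ : conjB (companion c) Z by [].
have ec i : rvN (nth 0%num (mpow (companion c) i) 0) *m B = v *m Z ^+ i.
  have [_] := conjBX i cZ; move/(congr1 (row 0)); rewrite !row_mul row_mxN => <-.
  by rewrite rowK /r expr0 mulmx1.
(* It suffices to follow the first basis vector, which represents v and is cyclic. *)
have c23 : rveq (iter 23 (fun v => vmul v (companion c)) 1%num) 1%num.
  apply/rveqP/rvN_injB; rewrite e0B -[RHS]mulmx1 -[1%:M]Z23.
  elim: 23%N => [|k IH]; first by rewrite e0B mulmx1.
  by rewrite iterS (conjB_step _ cZ) IH -mulmxA exprSr.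
have {}c23 : c = 739%num \/ c = 1141%num.
  by have /implyP/(_ c23)/orP[/N.eqb_spec|/N.eqb_spec] := allP companion23 c c_in; [left|right].
have ZiF i : Z ^+ i * F = F * Z ^+ i.*2.
  elim: i => [|i IH]; first by rewrite !expr0 mul1r mulr1.
  by rewrite exprSr -mulrA ZF mulrA IH -mulrA -exprD doubleS addn2.
pose F0 := frobenius (companion c).
have cF : conjB F0 F.
  split; first by rewrite size_map.
  apply/row_matrixP=> i; rewrite !row_mul row_mxN rowK (nth_map 0%N) ?size_iota //.
  rewrite nth_iota // add0n ec /r -mulmxA -[Z ^+ i *m F]/(Z ^+ i * F) ZiF.
  by rewrite -[F * _]/(F *m _) mulmxA vF.
have cF3 := conjBX 3 cF.
have main n NV w0 : nf_ok c n NV w0 ->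
    conjB (u_matrix F0 NV w0) U.
  case/and4P=> /eqP sNV /all2_Neqb NVN nF /allP Uw.
  have FiU i : F ^+ i * U = U * F ^+ (3 * i).
    elim: i => [|i IH]; first by rewrite muln0 !expr0 mul1r mulr1.
    by rewrite exprSr -mulrA FU mulrA IH -mulrA -exprD mulnS addnC.
  have [w w_in Dw] := rvN_onto (rvN n *m B *m U *m invmx B).
  have {}Dw : rvN w *m B = rvN n *m B *m U by rewrite Dw mulmxKV.
  have nw i : rvN (vmul n (mpow F0 i)) *m B *m U = rvN (vmul w (mpow (mpow F0 3) i)) *m B.
    rewrite (conjB_step _ (conjBX i cF)) (conjB_step _ (conjBX i cF3)) Dw -exprM.
    by rewrite -!mulmxA -[F ^+ i *m U]/(F ^+ i * U) FiU.
  have cU : conjB (u_matrix F0 NV w) U.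
    split; first by rewrite size_mmul.
    have sR x A : size (conj_rows A x) = 11%N by rewrite size_map.
    have E : mxN NV *m mxN (conj_rows F0 n) = 1%:M by rewrite -mxN_mmul // NVN mxN_id.
    rewrite mxN_mmul // -[LHS]mul1mx -E -!mulmxA; congr (_ *m _).
    rewrite mulmxA; apply/row_matrixP=> i; rewrite !row_mul !row_mxN.
    by rewrite !(nth_map 0%N) ?size_iota // nth_iota // nw.
  have rel e : u_relation (companion c) (u_matrix F0 NV w) e.
    apply/rveqP/rvN_injB.
    have c15 := conjBX 15 cZ; have c11 := conjBX 11 cZ; have c19 := conjBX 19 cZ.
    have F1 : List.Forall2 conjB
        [:: companion c; u_matrix F0 NV w; u_matrix F0 NV w; mpow (companion c) 15;
            u_matrix F0 NV w] [:: Z; U; U; Z ^+ 15; U]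
      by do !apply: List.Forall2_cons => //; apply: List.Forall2_nil.
    have F2 : List.Forall2 conjB
        [:: u_matrix F0 NV w; mpow (companion c) 11; u_matrix F0 NV w;
            mpow (companion c) 19] [:: U; Z ^+ 11; U; Z ^+ 19]
      by do !apply: List.Forall2_cons => //; apply: List.Forall2_nil.
    rewrite (conjB_foldl e F1) (conjB_foldl e F2).
    rewrite ![foldl _ _ _]/=; move: (rvN e *m B) => X.
    have E : Z *m U *m U *m Z ^+ 15 *m U = U *m Z ^+ 11 *m U *m Z ^+ 19 := ZU.
    move: (Z ^+ 15) (Z ^+ 11) (Z ^+ 19) E => Z15 Z11 Z19 E.
    by have := congr1 (mulmx X) E; rewrite !mulmxA.
  have := Uw w w_in; cbv zeta; rewrite -/F0 !rel; case: rveqP => [wF|_ /N.eqb_spec <- //].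
  (* The degenerate case: if w is fixed by f^3, then n f u = n u f^3 = n u, so n would be fixed by
     f. *)
  case/negP: nF; apply/rveqP/rvN_injB; rewrite (conjB_step _ cF).
  apply: (can_inj (mulmxK uU)); rewrite -[LHS]mulmxA -[F *m U]/(F * U) FU.
  rewrite -[U * _]/(U *m _) mulmxA -Dw -(conjB_step _ cF3).
  by rewrite wF.
have fin nf : c = nf.1.1.1 -> nf_ok nf.1.1.1 nf.1.1.2 nf.1.2 nf.2 -> has_nf B Z F U nf.
  move=> Dc; rewrite -Dc /has_nf /nfU /nfF /nfZ -Dc -/F0 => /main[_ HU].
  by case: cZ cF => [_ HZ] [_ HF].
case: c23 => Dc.
  by exists nf1; [exact: mem_head | exact: (fin nf1 Dc nf1_ok)].
by exists nf2; [rewrite inE mem_head orbT | exact: (fin nf2 Dc nf2_ok)].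
Qed.

End Existence.

End NormalForm.

(** * The elements z, f, u of M_23 and its irreducible modules of dimension 11 *)

Definition todd (k : nat) : todd_gen :=
  nth (@Ordinal 9 0 isT) [:: @Ordinal 9 0 isT; @Ordinal 9 1 isT; @Ordinal 9 2 isT;
    @Ordinal 9 3 isT; @Ordinal 9 4 isT; @Ordinal 9 5 isT; @Ordinal 9 6 isT;
    @Ordinal 9 7 isT; @Ordinal 9 8 isT] k.

Definition tword (s : seq nat) : gword todd_gen := [seq (todd k, false) | k <- s].

(* The words cjigh of order 23, ahbgchig of order 11 and itagdhgc of order 5. *)
Definition wz := tword [:: 2; 8; 7; 5; 6]%N.
Definition wf := tword [:: 0; 6; 1; 5; 2; 6; 7; 5]%N.
Definition wu := tword [:: 7; 4; 0; 5; 3; 6; 5; 2]%N.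

(* The generators as words in z, f, u, coded by 0, 1, 2. *)
Definition zfu_words : seq (seq nat) :=
  [:: [:: 0; 0; 0; 0; 0; 0; 1; 1; 1; 1; 1; 2; 2; 0; 2; 2; 0; 1; 1; 1; 1; 0; 0; 0; 0]%N;
      [:: 0; 0; 1; 1; 1; 1; 2; 2; 0; 0; 0; 0; 0; 0; 2; 2; 2; 0; 0; 0; 1; 1; 2; 0; 0; 0; 0]%N;
      [:: 0; 0; 1; 2; 2; 2; 0; 2; 2; 2; 2; 0; 0; 0; 1; 1; 1; 1; 1; 1; 1; 1; 1; 1;
        2; 2; 2; 0; 0; 0; 0; 0]%N;
      [:: 0; 0; 0; 0; 2; 0; 0; 0; 0; 0; 0; 0; 2; 2; 2; 0; 0; 1; 1; 1; 2; 2; 2; 2; 0; 0; 0; 0; 0]%N;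
      [:: 0; 0; 0; 0; 0; 0; 0; 0; 1; 1; 1; 2; 0; 0; 0; 0; 0; 0; 2; 0; 0; 1; 1; 1; 1; 1]%N;
      [:: 0; 0; 0; 0; 0; 2; 0; 0; 0; 0; 0; 0; 0; 2; 2; 2; 0; 0; 1; 1; 1; 2; 2; 2; 2; 0; 0; 0; 0]%N;
      [:: 1; 1; 1; 1; 1; 1; 1; 1; 2; 2; 0; 2; 0; 0; 1; 1; 2; 2; 2; 0; 0; 0]%N;
      [:: 0; 0; 0; 0; 0; 1; 1; 1; 1; 1; 1; 1; 2; 0; 0; 0; 2; 2; 2; 0; 2; 2; 0; 0; 0; 0; 0; 0; 0]%N;
      [:: 1; 1; 1; 1; 2; 2; 2; 0; 2; 0; 0; 0; 0; 0; 0; 0; 0; 2; 2; 0; 0]%N].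

Definition zfu_word (s : nat) : gword todd_gen :=
  flatten [seq nth [::] [:: wz; wf; wu] k | k <- nth [::] zfu_words s].

Definition rho1_word : gword todd_gen -> seq N := word_mx rho1N rho1VN.

Definition rho1_eq (v w : gword todd_gen) : bool :=
  all2 N.eqb (rho1_word v) (rho1_word w).

Lemma zfu_ok :
  [&& rho1_eq (wz ^+ 23) 1, rho1_eq (wf ^+ 11) 1,
      rho1_eq (wz * wf) (wf * wz ^+ 2), rho1_eq (wf * wu) (wu * wf ^+ 3),
      rho1_eq (wz * wu * wu * wz ^+ 15 * wu) (wu * wz ^+ 11 * wu * wz ^+ 19)
    & all (fun s => rho1_eq (wgen (todd s)) (zfu_word s)) (iota 0 9)].
Proof. by vm_compute. Qed.

Lemma rho1_neq :
  [&& ~~ rveq (nth 0%num (rho1_word (wgen (todd 0))) 0) 1%num,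
    ~~ rveq (nth 0%num (rho1_word wz) 0) 1%num
  & ~~ rveq (nth 0%num (rho1_word wf) 0) 1%num].
Proof. by vm_compute. Qed.

Definition trN (A : seq N) : bool :=
  \big[addb/false]_(0 <= i < 11) N.testbit (nth 0%num A i) (N.of_nat i).

Lemma mxtrace_mxN A : (\tr (mxN A) = (trN A)%:R)%R.
Proof.
rewrite /trN (big_morph (fun b : bool => b%:R%R : 'F_2) natF_addb (erefl _)).
by rewrite big_mkord; apply: eq_bigr => i _; rewrite mxE.
Qed.

(** This tells the two modules apart: of the two possible characteristic polynomials of z only one
    has a term of degree 10. *)
Lemma trace_z : trN (rho1_word wz) = false /\ trN (word_mx rho2N rho2VN wz) = true.
Proof. by rewrite /trN unlock; vm_compute. Qed.

Lemma mxN_word_neq1 (A : seq N) : ~~ rveq (nth 0%num A 0) 1%num -> mxN A != 1%:M%R.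
Proof.
apply: contra => /eqP A1; apply/rveqP; rewrite -(row_mxN A ord0) A1 -mxN_id.
by rewrite row_mxN.
Qed.

Section M23.

Variables (gT : finGroupType) (M : {group gT}) (x : todd_gen -> gT).
Hypotheses (M_simple : simple M)
           (M_pres : presents M x (todd_relators (@wgen todd_gen))).

Let xM s : x s \in M := presents_gen s M_pres.

Lemma table_repr_word T TV (rG : mx_representation 'F_2 M 11) w :
  table_ok T TV -> (forall s, rG (x s) = mxN (nth [::] T s)) ->
  rG (word_eval x w) = mxN (word_mx T TV w).
Proof.
move=> Tok rGx; elim: w => [|l w IH].
  by rewrite -[[::]]/(1 : gword todd_gen) word_eval1 repr_mx1 -mxN_id.
rewrite word_eval_cons repr_mxM ?word_eval_in //; last by case: l.2; rewrite ?groupV.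
rewrite IH /= mxN_mmul ?(size_word_mx Tok) ?(table_size Tok) //; congr (_ *m _)%R.
rewrite /letter; case: l.2; last exact: rGx.
by rewrite repr_mxV // rGx (table_invmx Tok).
Qed.

Lemma simple_rker n (rG : mx_representation 'F_2 M n) g :
  g \in M -> (rG g != 1%:M)%R -> rker rG = 1.
Proof.
move=> Mg ntg; have /simpleP[_ simM] := M_simple.
case: (simM _ (rker_normal rG)) => // kM; case/eqP: ntg.
by have /rkerP[] : g \in rker rG by rewrite kM.
Qed.

Lemma rho1_eq_eval v w : rho1_eq v w -> word_eval x v = word_eval x w.
Proof.
have [rG rGx] := table_repr rho1_ok M_pres; move/all2_Neqb => vw.
have Mx u : word_eval x u \in M by apply: word_eval_in.
have ker1 : rker rG = 1.
  apply: (simple_rker (Mx (wgen (todd 0)))); rewrite (table_repr_word _ rho1_ok) //.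
  by apply: mxN_word_neq1; have /and3P[] := rho1_neq.
apply/eqP; rewrite eq_mulgV1; apply/eqP/set1P; rewrite -[[set 1]]ker1.
apply/rkerP; split; first by rewrite groupM ?groupV.
rewrite repr_mxM ?groupV // repr_mxV // !(table_repr_word _ rho1_ok) //.
rewrite /rho1_word in vw; rewrite vw mulmxV // -(table_repr_word w rho1_ok rGx).
exact: repr_mx_unit.
Qed.

Let z := word_eval x wz.
Let f := word_eval x wf.
Let u := word_eval x wu.

Lemma zfu_rel :
  [/\ z ^+ 23 = 1, f ^+ 11 = 1, z * f = f * z ^+ 2, f * u = u * f ^+ 3
    & z * u * u * z ^+ 15 * u = u * z ^+ 11 * u * z ^+ 19].
Proof.
have /and5P[z23 f11 zf fu /andP[zu _]] := zfu_ok.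
by split; [move: z23 | move: f11 | move: zf | move: fu | move: zu];
  move/rho1_eq_eval; rewrite ?(word_evalM, word_evalX) ?word_eval1.
Qed.

Lemma zM : z \in M. Proof. exact: word_eval_in. Qed.
Lemma fM : f \in M. Proof. exact: word_eval_in. Qed.
Lemma uM : u \in M. Proof. exact: word_eval_in. Qed.

Lemma orders : #[z] = 23 /\ #[f] = 11.
Proof.
have [z23 f11 _ _ _] := zfu_rel; have [rG rGx] := table_repr rho1_ok M_pres.
have /and3P[_ ntz ntf] := rho1_neq.
split.
  apply: nt_prime_order (isT : prime 23) z23 _; apply: contraNneq (mxN_word_neq1 ntz) => z1.
  by rewrite -(table_repr_word _ rho1_ok rGx) -/z z1 repr_mx1.
apply: nt_prime_order (isT : prime 11) f11 _.
apply: contraNneq (mxN_word_neq1 ntf) => f1.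
by rewrite -(table_repr_word _ rho1_ok rGx) -/f f1 repr_mx1.
Qed.

(** The subgroup generated by [z] is already irreducible. *)
Lemma nontriv_irreducible (rG : mx_representation 'F_2 M 11) :
  (rG z != 1%:M)%R -> mx_irreducible rG.
Proof.
move=> ntz; apply/mx_irrP; split=> // U modU nzU; rewrite /row_full.
have [rU|->] := order23_stable zM orders.1 ntz (mxmoduleP modU z zM); last by [].
by rewrite -mxrank_eq0 rU in nzU.
Qed.

Lemma table_irreducible T TV (rG : mx_representation 'F_2 M 11) :
  table_ok T TV -> (forall s, rG (x s) = mxN (nth [::] T s)) ->
  ~~ rveq (nth 0%num (word_mx T TV wz) 0) 1%num -> mx_irreducible rG.
Proof.
move=> Tok rGx ntz; apply: nontriv_irreducible.
by rewrite (table_repr_word _ Tok rGx) mxN_word_neq1.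
Qed.

(** Were [z] in the kernel, the whole simple group would act trivially, and a space of rank 1 would
    be a proper submodule. *)
Lemma irreducible_nontriv (rG : mx_representation 'F_2 M 11) :
  mx_irreducible rG -> (rG z != 1%:M)%R.
Proof.
move=> irrG; apply/eqP=> z1.
have ntz : z != 1 by rewrite -order_eq1 orders.1.
have kM : rker rG = M.
  have /simpleP[_ simM] := M_simple.
  case: (simM _ (rker_normal rG)) => // k1; case/eqP: ntz.
  by apply/set1P; rewrite -[[set 1]]k1; apply/rkerP; split; first exact: zM.
pose A : 'M['F_2]_11 := (delta_mx ord0 ord0)%R.
have /mx_irrP[_ /(_ A)] := irrG; rewrite /row_full mxrank_delta.
have -> : mxmodule rG A.
  apply/mxmoduleP=> g Mg; have /rkerP[_ ->] : g \in rker rG by rewrite kM.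
  by rewrite mulmx1.
have nzA : A != 0%R by rewrite -mxrank_eq0 mxrank_delta.
by move/(_ isT nzA).
Qed.

Lemma normal_form_M23 (rG : mx_representation 'F_2 M 11) : mx_irreducible rG ->
  exists B, exists2 nf, B \in unitmx /\ nf \in [:: nf1; nf2] &
  has_nf B (rG z) (rG f) (rG u) nf.
Proof.
move=> irrG; have ntz := irreducible_nontriv irrG.
have [v nzv vf] := order11_fixed rG fM orders.2.
have [z23 _ zf fu zu] := zfu_rel; have Mz := zM; have Mf := fM; have Mu := uM.
have st (A : 'M_11) := order23_stable (A := A) Mz orders.1 ntz.
have Z23 : (rG z ^+ 23 = 1)%R by rewrite -repr_mxX // z23 repr_mx1.
(* Powers are treated as single elements [h], whose images are already powers of matrices. *)
have pw g k : g \in M -> exists2 h, h = g ^+ k & h \in M /\ rG h = (rG g ^+ k)%R.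
  by exists (g ^+ k); rewrite // groupX // repr_mxX.
have ZF : (rG z * rG f = rG f * rG z ^+ 2)%R.
  have [z2 Dz [Mz2 <-]] := pw z 2 Mz; move: zf; rewrite -Dz => /(congr1 rG).
  by rewrite !repr_mxM.
have FU : (rG f * rG u = rG u * rG f ^+ 3)%R.
  have [f3 Df [Mf3 <-]] := pw f 3 Mf; move: fu; rewrite -Df => /(congr1 rG).
  by rewrite !repr_mxM.
have ZU : (rG z * rG u * rG u * rG z ^+ 15 * rG u
           = rG u * rG z ^+ 11 * rG u * rG z ^+ 19)%R.
  have [z15 D15 [M15 <-]] := pw z 15 Mz; have [z11 D11 [M11 <-]] := pw z 11 Mz.
  have [z19 D19 [M19 <-]] := pw z 19 Mz.
  move: zu; rewrite -D15 -D11 -D19 => /(congr1 rG).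
  by rewrite !repr_mxM ?groupM.
have uU := repr_mx_unit rG Mu.
have [nf nf_in H] := normal_form st Z23 ZF FU ZU nzv vf uU.
eexists; exists nf; last exact: H.
by split; first exact: (cyclic_basis_unit st nzv).
Qed.

(** The elements whose two actions are intertwined by [B] form a subgroup. It contains z, f, u,
    hence all the generators, which are words in these by [zfu_words]. *)
Lemma rsim_of_zfu (rG1 rG2 : mx_representation 'F_2 M 11) (B : 'M_11) :
  B \in unitmx ->
  (forall g, g \in [:: z; f; u] -> rG1 g *m B = B *m rG2 g)%R -> mx_rsim rG1 rG2.
Proof.
move=> uB Bzfu; apply: (MxReprSim (erefl _)) (_ : row_free B) _.
  by rewrite row_free_unit.
pose H := [set g in M | rG1 g *m B == B *m rG2 g]%R.
have gH : group_set H.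
  apply/group_setP; split=> [|g h]; first by rewrite inE group1 !repr_mx1 mul1mx mulmx1 /=.
  rewrite !inE => /andP[Mg /eqP Bg] /andP[Mh /eqP Bh].
  by rewrite groupM //= !repr_mxM // -mulmxA Bh !mulmxA Bg.
have zfuH : {subset [:: z; f; u] <= H}.
  move=> g gzfu; rewrite inE Bzfu // eqxx andbT.
  by move: gzfu; rewrite !inE => /or3P[] /eqP->; [exact: zM | exact: fM | exact: uM].
have xH s : x s \in Group gH.
  have /and5P[_ _ _ _ /andP[_ /all_iotaP/(_ s)/rho1_eq_eval]] := zfu_ok.
  have -> : todd s = s :> todd_gen.
    apply/val_inj; rewrite /todd.
    by case: s => -[|[|[|[|[|[|[|[|[|s]]]]]]]]].
  rewrite word_eval_gen => ->; rewrite /zfu_word.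
  have zfu3 : all (fun l => all (fun k => k < 3)%N l) zfu_words by [].
  have : all (fun k => k < 3)%N (nth [::] zfu_words s).
    by apply: (allP zfu3); apply: mem_nth.
  elim: (nth _ _ _) => [|k l IH] /=; first by rewrite word_eval1 (group1 (Group gH)).
  case/andP=> k3 /IH lH; rewrite -[_ ++ _]/(mulg (_ : gword _) (_ : gword _)) word_evalM.
  apply: groupM lH; apply: zfuH.
  by case: k k3 => [|[|[|k]]]; rewrite // !inE eqxx ?orbT.
have MH : M \subset Group gH.
  by rewrite -M_pres.1 gen_subG; apply/subsetP=> _ /imsetP[s _ ->].
by move=> g /(subsetP MH); rewrite inE => /andP[_ /eqP].
Qed.

Lemma nf_rsim (rG1 rG2 : mx_representation 'F_2 M 11) nf B1 B2 :
  B1 \in unitmx -> B2 \in unitmx ->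
  has_nf B1 (rG1 z) (rG1 f) (rG1 u) nf -> has_nf B2 (rG2 z) (rG2 f) (rG2 u) nf ->
  mx_rsim rG1 rG2.
Proof.
move=> uB1 uB2; rewrite /has_nf; move: (mxN _) (mxN _) (mxN _) => Zn Fn Un.
move=> [z1 f1 u1] [z2 f2 u2].
apply: (rsim_of_zfu (B := (invmx B1 *m B2)%R)).
  by rewrite unitmx_mul unitmx_inv uB1.
have E Q Q1 Q2 : (B1 *m Q1 = Q *m B1 -> B2 *m Q2 = Q *m B2 ->
    Q1 *m (invmx B1 *m B2) = invmx B1 *m B2 *m Q2)%R.
  move=> D1 D2; rewrite -[in RHS]mulmxA D2 !mulmxA; congr (_ *m _)%R.
  by rewrite -[LHS](mulKmx uB1) (mulmxA B1) D1 mulmxK.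
by move=> g; rewrite !inE => /or3P[] /eqP->; apply: E; eassumption.
Qed.

Lemma rsim_trace (rG1 rG2 : mx_representation 'F_2 M 11) g :
  g \in M -> mx_rsim rG1 rG2 -> (\tr (rG1 g) = \tr (rG2 g))%R.
Proof.
move=> Mg [B _ fB HB].
have uB : B \in unitmx by rewrite -row_free_unit.
by rewrite -[rG1 g](mulmxK uB) HB // mxtrace_mulC mulKmx.
Qed.

(** Modules with the same normal form are similar. As [rho1] and [rho2] are not similar, they take
    up both normal forms, and no third irreducible module is left. *)
Lemma M23_irreducibles :
  exists rho1 rho2 : mx_representation 'F_2 M 11,
  [/\ (forall s, rho1 (x s) = rho1_mx s) /\ mx_irreducible rho1,
      (forall s, rho2 (x s) = rho2_mx s) /\ mx_irreducible rho2,
      ~ mx_rsim rho1 rho2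
    & forall W : mx_representation 'F_2 M 11,
        mx_irreducible W -> mx_rsim rho1 W \/ mx_rsim rho2 W].
Proof.
have [rho1 rho1x] := table_repr rho1_ok M_pres.
have [rho2 rho2x] := table_repr rho2_ok M_pres.
have nt1 : ~~ rveq (nth 0%num (word_mx rho1N rho1VN wz) 0) 1%num by vm_compute.
have nt2 : ~~ rveq (nth 0%num (word_mx rho2N rho2VN wz) 0) 1%num by vm_compute.
have irr1 := table_irreducible rho1_ok rho1x nt1.
have irr2 := table_irreducible rho2_ok rho2x nt2.
have ntr : ~ mx_rsim rho1 rho2.
  move/(rsim_trace zM); rewrite (table_repr_word _ rho1_ok rho1x).
  rewrite (table_repr_word _ rho2_ok rho2x) !mxtrace_mxN.
  by have [-> ->] := trace_z.
exists rho1, rho2; split=> //; first by split=> // s; rewrite rho1_mxE.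
  by split=> // s; rewrite rho2_mxE.
have [B1 [nf_1 [u1 in1] H1]] := normal_form_M23 irr1.
have [B2 [nf_2 [u2 in2] H2]] := normal_form_M23 irr2.
move=> W /normal_form_M23[B [nf [uB inB] HB]].
have [Dnf|ne1] := eqVneq nf nf_1.
  by left; apply: nf_rsim u1 uB H1 _; rewrite -Dnf.
right; suff Dnf : nf = nf_2 by apply: nf_rsim u2 uB H2 _; rewrite -Dnf.
have ne12 : nf_1 != nf_2.
  by apply: contra_not_neq ntr => E; apply: nf_rsim u1 u2 H1 _; rewrite E.
move: ne1 ne12; clear -in1 in2 inB; move: in1 in2 inB.
rewrite !inE => /orP[]/eqP-> /orP[]/eqP-> /orP[]/eqP->; by rewrite ?eqxx.
Qed.

End M23.

(** * Extensions and 2-cocycles *)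

Section CocycleExtensions.

Local Open Scope ring_scope.

Variables (F : finFieldType) (gT : finGroupType) (G : {group gT}) (n : nat).
Variable rG : mx_representation F G n.

Local Notation H := (subg_of G).
Local Notation V := 'rV[F]_n.
Local Notation act x := (rG (sgval x)).

Lemma act1 : act (1%g : H) = 1%:M.
Proof. exact: repr_mx1. Qed.

Lemma actM (x y : H) : act (x * y)%g = act x *m act y.
Proof. by rewrite /= repr_mxM ?subgP. Qed.

Lemma cocyclesP (f : {ffun H * H -> V}) :
  reflect (forall x y z, f (x, y) *m act z + f ((x * y)%g, z)
                         = f (x, (y * z)%g) + f (y, z))
          (f \in cocycles2 rG).
Proof.
rewrite memv_ker lfunE /=; apply: (iffP eqP) => [/ffunP Zf x y z | Zf].
  have := Zf (x, y, z); rewrite !ffunE /= => /eqP.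
  by rewrite -addrA -opprD subr_eq0 => /eqP.
by apply/ffunP=> -[[x y] z]; rewrite !ffunE Zf -addrA -opprD subrr.
Qed.

Lemma coboundariesP (f : {ffun H * H -> V}) :
  reflect (exists h : H -> V, forall x y,
             f (x, y) = h x *m act y - h (x * y)%g + h y)
          (f \in coboundaries2 rG).
Proof.
apply: (iffP memv_imgP) => [[h _ ->]|[h Df]].
  by exists h => x y; rewrite lfunE !ffunE.
exists [ffun x => h x]; first exact: memvf.
by apply/ffunP=> -[x y]; rewrite lfunE !ffunE Df.
Qed.

Lemma dim_H2_eq0 : (forall f, f \in cocycles2 rG -> f \in coboundaries2 rG) ->
  dim_H2 rG = 0%N.
Proof.
move=> ZB; rewrite /dim_H2.
have -> : cocycles2 rG = coboundaries2 rG; last by rewrite subnn.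
by apply: subv_anti; rewrite coboundaries2_sub andbT; apply/subvP.
Qed.

Lemma dim_H2_eq1 f0 : f0 \in cocycles2 rG -> f0 \notin coboundaries2 rG ->
  (forall f, f \in cocycles2 rG -> f \in coboundaries2 rG \/ f - f0 \in coboundaries2 rG) ->
  dim_H2 rG = 1%N.
Proof.
move=> Zf0 Bf0 ZB; rewrite /dim_H2.
have -> : cocycles2 rG = (coboundaries2 rG + <[f0]>)%VS.
  apply: subv_anti; rewrite subv_add coboundaries2_sub -memvE Zf0 !andbT.
  apply/subvP=> f /ZB[Bf|Bf]; first by apply: (subvP (addvSl _ _)).
  by rewrite -(subrK f0 f) memv_add // memv_line.
have nz0 : f0 != 0 by apply: contraNneq Bf0 => ->; apply: mem0v.
rewrite dimv_disjoint_sum ?dim_vline ?nz0 ?addKn //.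
apply/eqP; rewrite -subv0; apply/subvP=> f /memv_capP[Bf /vlineP[k Df]].
have [k0|nzk] := eqVneq k 0; first by rewrite Df k0 scale0r mem0v.
by case/negP: Bf0; rewrite -(scalerK nzk f0) -Df memvZ.
Qed.

(* The cocycle is a parameter of the type: it carries the group structure. *)
Record cext_of (f : {ffun H * H -> V}) (Zf : f \in cocycles2 rG) :=
  CExt { cext_val : H * V }.

Section Cext.

Variables (f : {ffun H * H -> V}) (Zf : f \in cocycles2 rG).

Let fZ := cocyclesP _ Zf.

Lemma cocycle1l x : f (1%g, x) = f (1%g, 1%g) *m act x.
Proof. by have := fZ 1%g 1%g x; rewrite !mul1g => /addIr. Qed.

Lemma cocycle1r x : f (x, 1%g) = f (1%g, 1%g).
Proof. by have := fZ x 1%g 1%g; rewrite !mulg1 act1 mulmx1 => /addrI. Qed.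

Local Notation cext := (cext_of Zf).
Local Notation CE := (@CExt f Zf).

HB.instance Definition _ := [isNew for @cext_val f Zf].
HB.instance Definition _ := [Finite of cext by <:].

(** The pair (x, a) stands for sigma x * a with a section sigma, so a is acted on by y when it is
    moved past sigma y. *)
Definition cext_mul (u v : cext) : cext :=
  let: (x, a) := cext_val u in let: (y, b) := cext_val v in
  CE ((x * y)%g, f (x, y) + a *m act y + b).

(** Cocycles are not assumed to be normalised, hence the correction by f (1, 1) here and in
    [cext_iota]. *)
Definition cext_one : cext := CE (1%g, - f (1%g, 1%g)).

Definition cext_inv (u : cext) : cext :=
  let: (x, a) := cext_val u in
  CE (x^-1%g, - (f (1%g, 1%g) + f (x^-1%g, x) + a) *m act x^-1%g).

Lemma cext_mulA : associative cext_mul.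
Proof.
case=> [[x a]] [[y b]] [[z c]]; rewrite /cext_mul /=; congr (CE (_, _)).
  exact: mulgA.
rewrite !mulmxDl -mulmxA -actM.
have -> : f ((x * y)%g, z) = f (x, (y * z)%g) + f (y, z) - f (x, y) *m act z.
  by rewrite -fZ addrAC subrr add0r.
move: (f _) (f _) (f _ *m _) (a *m _) (b *m _) => p q r s t.
by apply/rowP=> i; rewrite !mxE; ring.
Qed.

Lemma cext_mul1 : left_id cext_one cext_mul.
Proof.
case=> [[x a]]; rewrite /cext_mul /= mul1g cocycle1l mulNmx subrr add0r.
by [].
Qed.

Lemma cext_mulV : left_inverse cext_one cext_inv cext_mul.
Proof.
case=> [[x a]]; rewrite -[LHS]/(CE ((x^-1 * x)%g, f (x^-1%g, x)
  + (- (f (1%g, 1%g) + f (x^-1%g, x) + a) *m act x^-1%g) *m act x + a)).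
rewrite -mulmxA -actM mulVg act1 mulmx1.
by congr (CE (_, _)); apply/rowP=> i; rewrite !mxE; ring.
Qed.

HB.instance Definition _ := Finite_isGroup.Build cext cext_mulA cext_mul1 cext_mulV.

Lemma cextM x a y b :
  ((CE (x, a) : cext) * CE (y, b))%g = CE ((x * y)%g, f (x, y) + a *m act y + b).
Proof. by []. Qed.

Definition cext_iota (v : V) : cext := CE (1%g, v - f (1%g, 1%g)).
Definition cext_pi (u : cext) : gT := sgval (cext_val u).1.

Lemma cext_iotaM : {in [set: V] &, {morph cext_iota : v w / (v * w)%g >-> (v * w)%g}}.
Proof.
move=> v w _ _; rewrite [RHS]cextM mulg1 act1 mulmx1; congr (CE (_, _)).
by rewrite -[(v * w)%g]/(v + w); apply/rowP=> i; rewrite !mxE; ring.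
Qed.

Lemma cext_piM : {in [set: cext] &, {morph cext_pi : u v / (u * v)%g >-> (u * v)%g}}.
Proof. by case=> [[x a]] [[y b]] _ _. Qed.

Canonical cext_iota_morphism := Morphism cext_iotaM.
Canonical cext_pi_morphism := Morphism cext_piM.

Lemma cext_is_extension :
  is_extension rG cext_iota_morphism cext_pi_morphism.
Proof.
split.
- by apply/injmP=> v w _ _ [] /addIr.
- apply/setP=> [[[x a]]]; apply/morphimP/idP => [[v _ _ ->]|/kerP kx].
    by apply/kerP; rewrite ?inE.
  have /subg_inj x1 : sgval x = sgval (1%g : H) by apply: kx; rewrite inE.
  exists (a + f (1%g, 1%g)); rewrite ?inE //= /cext_iota x1.
  by rewrite addrK.
- apply/setP=> g; apply/morphimP/idP => [[[[x a]] _ _ ->]|Gg].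
    exact: subgP.
  by exists (CE (subg G g, 0)); rewrite ?inE //= /cext_pi /= subgK.
- move=> v [[x a]] _; apply: (mulgI (CE (x, a) : cext)).
  rewrite -conjgC /= /cext_iota !cextM mul1g mulg1.
  rewrite act1 mulmx1 cocycle1l cocycle1r /cext_pi /=.
  by congr (CE (_, _)); rewrite mulmxBl; apply/rowP=> i; rewrite !mxE; ring.
Qed.

(** A complement contains exactly one pair (x, h x) over each x; closure under products says that f
    is the coboundary of - h. *)
Lemma cext_splits :
  [splits [set: cext], over 'ker cext_pi_morphism] -> f \in coboundaries2 rG.
Proof.
case/splitsP=> K /complP[tiK eqK].
have [_ _ im _] := cext_is_extension.
have ex (x : H) : exists v, CE (x, v) \in K.
  have : (CE (x, 0) : cext) \in ('ker cext_pi_morphism * K)%g by rewrite eqK inE.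
  case/mulsgP=> [[[k w]] [[y b]] /kerP kk Ky Dx].
  have /subg_inj k1 : sgval k = sgval (1%g : H) by apply: kk; rewrite inE.
  by exists b; move: Dx; rewrite k1 cextM mul1g => -[-> _].
pose h x := xchoose (ex x); have hK x : CE (x, h x) \in K := xchooseP (ex x).
have hE x v : CE (x, v) \in K -> v = h x.
  move=> Kv; have : ((CE (x, h x) : cext)^-1 * CE (x, v))%g \in 'ker cext_pi_morphism :&: K.
    apply/setIP; split; last by rewrite groupM ?groupV.
    apply/kerP; first by rewrite inE.
    by rewrite morphM ?morphV ?inE //= mulVg.
  by rewrite tiK => /set1P/eqP; rewrite -eq_mulVg1 => /eqP[].
apply/coboundariesP; exists (fun x => - h x) => x y.
have := groupM (hK x) (hK y); rewrite cextM => /hE <-.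
by rewrite mulNmx; apply/rowP=> i; rewrite !mxE; ring.
Qed.

End Cext.

Section ExtensionCocycles.

Variables (eT : finGroupType) (E : {group eT}).
Variables (iota : {morphism [set: V] >-> eT}) (pi : {morphism E >-> gT}).
Hypothesis extE : is_extension rG iota pi.

Lemma ext_iota_ker v : iota v \in 'ker pi.
Proof. by case: extE => _ <- _ _; rewrite mem_morphim ?inE. Qed.

Lemma ext_iota_in v : iota v \in E.
Proof. by have := ext_iota_ker v; case/setIP. Qed.

Lemma ext_kerP e : e \in 'ker pi -> exists v, iota v = e.
Proof. by case: extE => _ <- _ _ => /morphimP[v _ _ ->]; exists v. Qed.

Lemma ext_iotaM v w : iota (v + w) = (iota v * iota w)%g.
Proof. by rewrite -morphM ?inE. Qed.

Lemma ext_iota_inj : injective iota.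
Proof. by case: extE => inj _ _ _ v w; apply: (injmP inj); rewrite inE. Qed.

Lemma ext_iotaJ v e : e \in E -> (iota v * e = e * iota (v *m rG (pi e)))%g.
Proof. by case: extE => _ _ _ J Ee; rewrite -J // -conjgC. Qed.

Definition is_section (s : H -> eT) (f : {ffun H * H -> V}) : Prop :=
  [/\ forall x, s x \in E, forall x, pi (s x) = sgval x
    & forall x y, (s x * s y = s (x * y) * iota (f (x, y)))%g].

Lemma section_cocycle s f : is_section s f -> f \in cocycles2 rG.
Proof.
case=> sE pis sM; apply/cocyclesP=> x y z; apply: ext_iota_inj.
apply: (mulgI (s (x * y * z)%g)).
have L : (s x * s y * s z = s (x * y * z) * (iota (f (x, y) *m act z + f ((x * y)%g, z))))%g.
  by rewrite addrC ext_iotaM mulgA -sM sM -pis -!mulgA ext_iotaJ.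
by rewrite -L -mulgA sM mulgA sM ext_iotaM -!mulgA.
Qed.

Lemma section_exists : exists s f, is_section s f.
Proof.
have [injI imI piE J] := extE.
have ex (x : H) : exists e, (e \in E) && (pi e == sgval x).
  have : sgval x \in pi @* E by rewrite piE subgP.
  by case/morphimP=> e Ee _ De; exists e; rewrite Ee De /=.
pose s x := xchoose (ex x).
have sE x : s x \in E by have /andP[] := xchooseP (ex x).
have pis x : pi (s x) = sgval x by have /andP[_ /eqP] := xchooseP (ex x).
have exf p : exists v, iota v == ((s (p.1 * p.2)%g)^-1 * (s p.1 * s p.2))%g.
  have [|v <-] := @ext_kerP ((s (p.1 * p.2)%g)^-1 * (s p.1 * s p.2))%g; last by exists v.
  apply/kerP; first by rewrite !groupM ?groupV.
  by rewrite !morphM ?groupM ?groupV // morphV // !pis /= mulVg.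
exists s, [ffun p => xchoose (exf p)]; split=> // x y.
by rewrite ffunE (eqP (xchooseP (exf (x, y)))) mulKVg.
Qed.

(** Correcting the section by - h makes it multiplicative, and its image is a complement. *)
Lemma coboundary_splits s f : is_section s f -> f \in coboundaries2 rG ->
  [splits E, over 'ker pi].
Proof.
case=> sE pis sM /coboundariesP[h Df].
pose k x := (s x * iota (- h x))%g.
have kM x y : (k x * k y = k (x * y))%g.
  rewrite /k -mulgA (mulgA (iota _)) ext_iotaJ // pis -!mulgA -ext_iotaM mulgA sM.
  rewrite -mulgA -ext_iotaM Df; congr (_ * iota _)%g.
  by rewrite mulNmx; apply/rowP=> i; rewrite !mxE; ring.
have kE x : k x \in E by rewrite groupM // ext_iota_in.
have pik x : pi (k x) = sgval x.
  by rewrite morphM ?ext_iota_in // pis (mker (ext_iota_ker _)) mulg1.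
have gK : group_set [set k x | x : H].
  apply/group_setP; split=> [|_ _ /imsetP[x _ ->] /imsetP[y _ ->]].
    apply/imsetP; exists 1%g => //; apply: (mulgI (k 1%g)).
    by rewrite mulg1 kM mulg1.
  by rewrite kM imset_f.
apply/splitsP; exists (Group gK); apply/complP; split.
  apply/trivgP/subsetP=> e /setIP[ke /imsetP[x _ De]]; apply/set1P.
  have x1 : x = 1%g by apply: subg_inj; rewrite -pik -De (mker ke).
  by rewrite De x1; apply: (mulgI (k 1%g)); rewrite mulg1 kM mulg1.
apply/eqP; rewrite eqEsubset; apply/andP; split.
  by apply/subsetP=> _ /mulsgP[a b /setIP[Ea _] /imsetP[x _ ->] ->]; rewrite groupM.
apply/subsetP=> e Ee; have Ge : pi e \in G.
  by case: extE => _ _ imE _; have := mem_morphim pi Ee Ee; rewrite imE.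
apply/mulsgP; exists (e * (k (subg G (pi e)))^-1)%g (k (subg G (pi e))).
- apply/kerP; first by rewrite groupM ?groupV.
  by rewrite morphM ?morphV ?groupV // pik subgK // mulgV.
- exact: imset_f.
- by rewrite mulgKV.
Qed.

End ExtensionCocycles.

(** The isomorphism sends s1 x * iota1 v to s2 x * iota2 (v + h x), where f1 - f2 is the coboundary
    of h. *)
Lemma cohomologous_equivalent (eT1 eT2 : finGroupType)
    (E1 : {group eT1}) (E2 : {group eT2})
    (iota1 : {morphism [set: V] >-> eT1}) (pi1 : {morphism E1 >-> gT})
    (iota2 : {morphism [set: V] >-> eT2}) (pi2 : {morphism E2 >-> gT}) s1 f1 s2 f2 :
  is_extension rG iota1 pi1 -> is_extension rG iota2 pi2 ->
  is_section iota1 pi1 s1 f1 -> is_section iota2 pi2 s2 f2 ->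
  f1 - f2 \in coboundaries2 rG ->
  equivalent_extensions iota1 pi1 iota2 pi2.
Proof.
move=> ext1 ext2 [s1E pis1 s1M] [s2E pis2 s2M] /coboundariesP[h Df].
have G1 e : e \in E1 -> pi1 e \in G.
  by move=> Ee; case: ext1 => _ _ imE _; have := mem_morphim pi1 Ee Ee; rewrite imE.
(* The implication makes the choice of v total, also outside [E1]. *)
have ex e : exists v, (e \in E1) ==> (e == s1 (subg G (pi1 e)) * iota1 v)%g.
  case Ee : (e \in E1); last by exists 0.
  have [|v Dv] := @ext_kerP _ _ _ _ ext1 ((s1 (subg G (pi1 e)))^-1 * e)%g.
    apply/kerP; first by rewrite groupM ?groupV.
    by rewrite morphM ?morphV ?groupV // pis1 subgK ?G1 // mulVg.
  by exists v; rewrite Dv mulKVg eqxx.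
pose c e := xchoose (ex e).
have cP e : e \in E1 -> (e = s1 (subg G (pi1 e)) * iota1 (c e))%g.
  by move=> Ee; apply/eqP; have /implyP := xchooseP (ex e); apply.
pose phi e := (s2 (subg G (pi1 e)) * iota2 (c e + h (subg G (pi1 e))))%g.
have phiE x v : phi (s1 x * iota1 v)%g = (s2 x * iota2 (v + h x))%g.
  have Ee : (s1 x * iota1 v)%g \in E1 by rewrite groupM // (ext_iota_in ext1).
  have Dx : subg G (pi1 (s1 x * iota1 v)%g) = x.
    rewrite morphM ?(ext_iota_in ext1) // (mker (ext_iota_ker ext1 v)) mulg1 pis1.
    exact: sgvalK.
  rewrite /phi Dx; congr (_ * iota2 (_ + _))%g.
  by have := cP _ Ee; rewrite Dx => /mulgI/(ext_iota_inj ext1).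
have phi2 x v y w : phi (s1 x * iota1 v * (s1 y * iota1 w))%g
    = (phi (s1 x * iota1 v) * phi (s1 y * iota1 w))%g.
  have -> : (s1 x * iota1 v * (s1 y * iota1 w)
      = s1 (x * y) * iota1 (f1 (x, y) + v *m act y + w))%g.
    rewrite -mulgA (mulgA (iota1 v)) (ext_iotaJ ext1) // pis1 !ext_iotaM.
    by rewrite !mulgA s1M.
  rewrite !phiE -mulgA (mulgA (iota2 _)) (ext_iotaJ ext2) // pis2 -!mulgA -ext_iotaM // mulgA.
  rewrite s2M -mulgA -ext_iotaM //; congr (_ * iota2 _)%g.
  have -> : f1 (x, y) = f2 (x, y) + (h x *m act y - h (x * y)%g + h y).
    by rewrite -Df !ffunE addrC subrK.
  by rewrite mulmxDl; apply/rowP=> i; rewrite !mxE; ring.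
have phiM : {in E1 &, {morph phi : a b / (a * b)%g}}.
  by move=> a b Ea Eb; rewrite {1}(cP a Ea) {1}(cP b Eb) phi2 -!cP.
have phiE2 e : e \in E1 -> phi e \in E2 by move=> _; rewrite groupM // (ext_iota_in ext2).
have pi2phi e : e \in E1 -> pi2 (phi e) = pi1 e.
  move=> Ee; rewrite morphM ?(ext_iota_in ext2) // (mker (ext_iota_ker ext2 _)) mulg1 pis2.
  by rewrite subgK ?G1.
(* The sections need not send 1 to 1: s 1 is iota (f (1, 1)), and h 1 is the difference of the two
   values f (1, 1). *)
have phi_iota v : phi (iota1 v) = iota2 v.
  have s11 : s1 1%g = iota1 (f1 (1%g, 1%g)).
    by apply: (mulgI (s1 1%g)); rewrite s1M mulg1.
  have s21 : s2 1%g = iota2 (f2 (1%g, 1%g)).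
    by apply: (mulgI (s2 1%g)); rewrite s2M mulg1.
  have -> : iota1 v = (s1 1%g * iota1 (v - f1 (1%g, 1%g)))%g.
    by rewrite s11 -ext_iotaM // addrC subrK.
  rewrite phiE s21 -ext_iotaM //; congr (iota2 _).
  have := Df 1%g 1%g; rewrite !ffunE mulg1 act1 mulmx1 subrr add0r => <-.
  by apply/rowP=> i; rewrite !mxE; ring.
exists (Morphism phiM); split=> //; apply/isomP; split.
  apply/subsetP=> e /setIP[Ee]; rewrite !inE /= => /eqP phie.
  have : e \in 'ker pi1 by apply/kerP; rewrite // -pi2phi // phie morph1.
  case/(ext_kerP ext1)=> v De; move: phie; rewrite -De phi_iota.
  rewrite -(morph1 iota2) => /(ext_iota_inj ext2) ->.
  by rewrite morph1.
apply/setP=> e; apply/morphimP/idP => [[a _ Ea ->]|Ee]; first exact: phiE2.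
have Ge : pi2 e \in G by case: ext2 => _ _ imE _; have := mem_morphim pi2 Ee Ee; rewrite imE.
pose x := subg G (pi2 e).
have [|v Dv] := @ext_kerP _ _ _ _ ext2 ((s2 x)^-1 * e)%g.
  apply/kerP; first by rewrite groupM ?groupV.
  by rewrite morphM ?morphV ?groupV // pis2 subgK // mulVg.
exists (s1 x * iota1 (v - h x))%g; rewrite ?groupM ?(ext_iota_in ext1) //.
by rewrite /= phiE subrK Dv mulKVg.
Qed.

End CocycleExtensions.

(** * Tails of a cocycle along a rewriting system *)

Section Tails.

Local Open Scope ring_scope.

Variables (gT : finGroupType) (M : {group gT}) (rG : mx_representation 'F_2 M 11).

Local Notation H := (subg_of M).
Local Notation V := 'rV['F_2]_11.
Local Notation act x := (rG (sgval x)).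
Local Notation cochain := {ffun H * H -> V}.

Variable m : nat -> H.

Definition wprod (w : seq nat) : H := (\prod_(k <- w) m k)%g.

Lemma wprod_cat u w : wprod (u ++ w) = (wprod u * wprod w)%g.
Proof. exact: big_cat. Qed.

Lemma wprod_cons k w : wprod (k :: w) = (m k * wprod w)%g.
Proof. exact: big_cons. Qed.

(* The V-component of (x, v) times the product of the lifts (m k, g k) in the
   extension defined by f; it makes sense for any cochain f and is linear. *)
Fixpoint phi (f : cochain) (g : nat -> V) (x : H) (v : V) (w : seq nat) : V :=
  if w is k :: w' then phi f g (x * m k)%g (f (x, m k) + v *m act (m k) + g k) w'
  else v.

(** The starting point is the unit of the extension. *)
Definition phi1 f g (w : seq nat) : V := phi f g 1%g (- f (1%g, 1%g)) w.

(** Joint linearity in the cochain and the lifts: a change of lifts can be studied separately, with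
    the cochain 0. *)
Lemma phiD f f' g g' x v v' w :
  phi (f + f') (fun k => g k + g' k) x (v + v') w = phi f g x v w + phi f' g' x v' w.
Proof.
elim: w x v v' => [|k w IH] x v v' //=; rewrite -IH; congr (phi _ _ _ _ w).
rewrite ffunE mulmxDl; move: (f _) (f' _) (v *m _) (v' *m _) => a b c d.
by apply/rowP=> i; rewrite !mxE; ring.
Qed.

Lemma phi1D f f' g g' w :
  phi1 (f + f') (fun k => g k + g' k) w = phi1 f g w + phi1 f' g' w.
Proof. by rewrite /phi1 -phiD ffunE opprD. Qed.

Lemma phi_eq f g g' x v w : g =1 g' -> phi f g x v w = phi f g' x v w.
Proof. by move=> gg'; elim: w x v => [|k w IH] x v //=; rewrite gg' IH. Qed.

Section Cocycle.

Variables (f : cochain) (Zf : f \in cocycles2 rG) (g : nat -> V).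

Local Notation E := (cext_of Zf).
Local Notation CE := (@CExt _ _ _ _ _ f Zf).
Local Notation iota := (@cext_iota _ _ _ _ _ f Zf).

Definition clift (k : nat) : E := CE (m k, g k).
Definition cprod (w : seq nat) : E := (\prod_(k <- w) clift k)%g.

Lemma cprod_cat u w : cprod (u ++ w) = (cprod u * cprod w)%g.
Proof. exact: big_cat. Qed.

Lemma cprod_phi x v w : (CE (x, v) * cprod w)%g = CE ((x * wprod w)%g, phi f g x v w).
Proof.
elim: w x v => [|k w IH] x v; first by rewrite /cprod /wprod !big_nil !mulg1.
by rewrite /cprod big_cons -/(cprod w) wprod_cons !mulgA cextM IH.
Qed.

Lemma cprodE w : cprod w = CE (wprod w, phi1 f g w).
Proof. by rewrite -[LHS]mul1g [LHS]cprod_phi mul1g. Qed.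

Lemma cprod_tail u w : wprod u = wprod w ->
  cprod u = (cprod w * iota (phi1 f g u - phi1 f g w))%g.
Proof.
move=> uw; rewrite !cprodE /cext_iota cextM mulg1 uw act1 mulmx1 (cocycle1r Zf).
by congr (CE (_, _)); apply/rowP=> i; rewrite !mxE; ring.
Qed.

End Cocycle.

Variable rules : seq (nat * nat * seq nat).
Let nr := size rules.

Definition rule (i : nat) : nat * nat * seq nat := nth (0%N, 0%N, [::]) rules i.

Hypothesis rules_ok : forall i, (i < nr)%N ->
  wprod [:: (rule i).1.1; (rule i).1.2] = wprod (rule i).2.

(** By [cprod_tail] the lifted left side of rule i is the lifted right side times the image of this
    vector under [cext_iota]. *)
Definition tail f g (i : nat) : V :=
  phi1 f g [:: (rule i).1.1; (rule i).1.2] - phi1 f g (rule i).2.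

Lemma tailD f f' g g' i :
  tail (f + f') (fun k => g k + g' k) i = tail f g i + tail f' g' i.
Proof.
rewrite /tail !phi1D; move: (phi1 _ _ _) (phi1 _ _ _) (phi1 _ _ _) (phi1 _ _ _).
by move=> a b c d; apply/rowP=> j; rewrite !mxE; ring.
Qed.

Definition find_rule (k l : nat) : nat :=
  find (fun r => (r.1.1 == k) && (r.1.2 == l)) rules.

(* The value is the rule applied, the suffix after the rewritten pair, and the new word. *)
Fixpoint reduce1 (w : seq nat) : option (nat * seq nat * seq nat) :=
  if w is k :: w' then
    if w' is l :: s then
      let i := find_rule k l in
      if (i < nr)%N then Some (i, s, (rule i).2 ++ s)
      else if reduce1 w' is Some (j, t, u) then Some (j, t, k :: u) else None
    else None
  else None.

Lemma reduce1_cons k l s : reduce1 [:: k, l & s] =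
  if (find_rule k l < nr)%N then Some (find_rule k l, s, (rule (find_rule k l)).2 ++ s)
  else if reduce1 (l :: s) is Some (j, t, u) then Some (j, t, k :: u) else None.
Proof. by []. Qed.

(** The steps are recorded with their suffixes. Running out of fuel is harmless: the recorded steps
    are valid even if the last word is still reducible. *)
Fixpoint reduce (fuel : nat) (w : seq nat) : seq (nat * seq nat) * seq nat :=
  if fuel is n.+1 then
    if reduce1 w is Some (i, s, w') then
      let: (st, u) := reduce n w' in ((i, s) :: st, u)
    else ([::], w)
  else ([::], w).

(** A tail appears in front of the suffix of its step and is acted on by that suffix while it is
    moved to the right end. *)
Definition step_sum f g (st : seq (nat * seq nat)) : V :=
  \sum_(p <- st) tail f g p.1 *m act (wprod p.2).

Lemma find_ruleP k l : (find_rule k l < nr)%N ->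
  (rule (find_rule k l)).1 = (k, l).
Proof.
rewrite -has_find => /(nth_find (0%N, 0%N, [::])).
rewrite -/(rule _) -/(find_rule k l); case: (rule _) => [[a b] r] /=.
by case/andP=> /eqP-> /eqP->.
Qed.

Section Reduction.

Variables (f : cochain) (Zf : f \in cocycles2 rG) (g : nat -> V).

Let ext := cext_is_extension Zf.

Lemma reduce1P w i s w' : reduce1 w = Some (i, s, w') ->
  [/\ (i < nr)%N, wprod w = wprod w' &
   cprod Zf g w = (cprod Zf g w' * cext_iota Zf (tail f g i *m act (wprod s)))%g].
Proof.
elim: w i s w' => [|k [|l w] IH] i s w' //; rewrite reduce1_cons.
case: ifP => [lt_i [<- <- <-]|_].
  have Dr := find_ruleP lt_i; have := rules_ok lt_i; rewrite Dr /= => Dkl; split=> //.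
    by rewrite -[k :: l :: w]/([:: k; l] ++ w) !wprod_cat Dkl.
  rewrite -[k :: l :: w]/([:: k; l] ++ w) !cprod_cat (cprod_tail Zf g Dkl).
  rewrite -!mulgA; congr (_ * _)%g.
  have := ext_iotaJ ext (tail f g (find_rule k l)) (in_setT (cprod Zf g w)).
  by rewrite {1}/tail Dr /= cprodE.
case Ew: (reduce1 (l :: w)) => [[[j t] u]|//] [<- <- <-].
have [lt_j Dw Dc] := IH _ _ _ Ew.
split; [by [] | by rewrite !(wprod_cons k) Dw |].
by rewrite -[_ :: l :: w]/([:: k] ++ (l :: w)) -[_ :: u]/([:: k] ++ u) !cprod_cat Dc mulgA.
Qed.

Lemma reduceP n w : let: (st, u) := reduce n w in
  [/\ wprod w = wprod u, all (fun p => p.1 < nr)%N st &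
    cprod Zf g w = (cprod Zf g u * cext_iota Zf (step_sum f g st))%g].
Proof.
have base u : cprod Zf g u = (cprod Zf g u * cext_iota Zf (step_sum f g [::]))%g.
  by rewrite /step_sum big_nil; have := morph1 (cext_iota_morphism Zf) => /= ->; rewrite mulg1.
elim: n w => [|n IH] w /=; first by [].
case Ew: (reduce1 w) => [[[i s] w']|]; last by [].
have [lt_i Dw Dc] := reduce1P Ew; have := IH w'.
case: (reduce n w') => st u [Dw' all_st Dc']; split; rewrite ?Dw //= ?lt_i //.
rewrite Dc Dc' -mulgA; congr (_ * _)%g; rewrite /step_sum big_cons addrC.
by have := cext_iotaM Zf => /(_ _ _ (in_setT _) (in_setT _)) <-.
Qed.

End Reduction.

Lemma step_sum_cat f g st st' :
  step_sum f g (st ++ st') = step_sum f g st + step_sum f g st'.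
Proof. exact: big_cat. Qed.

(* The two ways to rewrite the overlap k l p of two rules. *)
Definition overlap (k l p : nat) : seq (nat * seq nat) :=
  let: (st, u) := reduce 60 [:: k; l; p] in
  let i := find_rule l p in
  if (i < nr)%N then
    let: (st', u') := reduce 60 (k :: (rule i).2) in
    if u == u' then (i, [::]) :: st' ++ st else [::]
  else [::].

(** Both reductions evaluate the same product of lifts, by associativity in the extension. If they
    end in the same word, their sums of tails agree, so the sum over all steps is 0 in
    characteristic 2. When the reductions do not meet, the list is empty. *)
Lemma overlapP f (Zf : f \in cocycles2 rG) g k l p :
  all (fun q => q.1 < nr)%N (overlap k l p) /\ step_sum f g (overlap k l p) = 0.
Proof.
have triv : all (fun q : nat * seq nat => q.1 < nr)%N [::] /\ step_sum f g [::] = 0.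
  by rewrite /step_sum big_nil.
rewrite /overlap; have := reduceP Zf g 60 [:: k; l; p].
case: (reduce 60 _) => st u [_ lt_st Dst].
case: ifP => [lt_i|_]; last exact: triv.
have := reduceP Zf g 60 (k :: (rule (find_rule l p)).2).
case: (reduce 60 _) => st' u' [_ lt_st' Dst'].
case: eqP => [uu'|_]; last exact: triv.
have Dr := find_ruleP lt_i; have := rules_ok lt_i; rewrite Dr /= => Dlp.
split; first by rewrite /= lt_i all_cat lt_st' lt_st.
have : cprod Zf g [:: k; l; p] = (cprod Zf g (k :: (rule (find_rule l p)).2)
    * cext_iota Zf (tail f g (find_rule l p)))%g.
  rewrite -(cat1s k [:: l; p]) -(cat1s k (rule _).2) !cprod_cat.
  rewrite (cprod_tail Zf g Dlp) mulgA; congr (_ * _)%g.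
  by rewrite /tail Dr.
rewrite Dst Dst' uu' -mulgA => /mulgI.
rewrite -[(_ * _)%g]/(cext_iota_morphism Zf _ * cext_iota_morphism Zf _)%g.
rewrite -(ext_iotaM (cext_iota_morphism Zf)) => /(ext_iota_inj (cext_is_extension Zf)) E.
rewrite -cat1s !step_sum_cat E {1}/step_sum big_seq1 /wprod big_nil act1 mulmx1.
move: (tail _ _ _) (step_sum _ _ _) => a b.
by apply/rowP=> j; rewrite !mxE addrA [b _ _ + a _ _]addrC F2_sqr.
Qed.

(* A linear form on families of tails, as a list of blocks: rule, functional. *)
Definition pair (t : nat -> V) (row : seq (nat * N)) : 'F_2 :=
  \sum_(p <- row) (t p.1 *m (rvN p.2)^T) 0 0.

(** Blocks are sorted by rule, merged, and dropped when they cancel, so that [elim_ok] can recognise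
    a row by plain equality. *)
Fixpoint ins (i : nat) (v : N) (row : seq (nat * N)) : seq (nat * N) :=
  if row is (j, u) :: row' then
    if i == j then
      let w := N.lxor v u in if N.eqb w 0 then row' else (j, w) :: row'
    else if (i < j)%N then (i, v) :: row else (j, u) :: ins i v row'
  else [:: (i, v)].

Definition addrow (r s : seq (nat * N)) : seq (nat * N) :=
  foldr (fun p => ins p.1 p.2) s r.

Lemma pair_ins t i v row : pair t (ins i v row) = (t i *m (rvN v)^T) 0 0 + pair t row.
Proof.
have pc j u r : pair t ((j, u) :: r) = (t j *m (rvN u)^T) 0 0 + pair t r.
  by rewrite /pair big_cons.
elim: row => [|[j u] row IH] /=; first exact: pc.
case: eqP => [->|_]; last by case: ifP; rewrite !pc ?IH 1?addrCA.
have E : (t j *m (rvN (N.lxor v u))^T) 0 0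
    = (t j *m (rvN v)^T) 0 0 + (t j *m (rvN u)^T) 0 0.
  by rewrite rvN_xor linearD /= mulmxDr mxE.
case: N.eqb_spec => [vu0|_]; rewrite !pc addrA -E //.
have -> : rvN (N.lxor v u) = 0 by rewrite vu0; apply/rowP=> k; rewrite !mxE.
by rewrite trmx0 mulmx0 mxE add0r.
Qed.

Lemma pair_addrow t r s : pair t (addrow r s) = pair t r + pair t s.
Proof.
elim: r => [|p r IH] /=; first by rewrite /pair big_nil add0r.
by rewrite pair_ins IH addrA [in RHS]/pair big_cons.
Qed.

Variable Ls : seq (seq N).
Hypothesis Ls_ok : forall k, size (nth idN Ls k) = 11%N /\ act (m k) = mxN (nth idN Ls k).

(** Column c of the matrix of the word s, when [LT] lists the transposed letters: one vector is
    carried along instead of a matrix. *)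
Definition column (LT : seq (seq N)) (s : seq nat) (c : nat) : N :=
  foldr (fun k v => vmul v (nth idN LT k)) (N.shiftl 1 (N.of_nat c)) s.

Lemma columnP (t : V) s (c : 'I_11) :
  (t *m act (wprod s)) 0 c = (t *m (rvN (column (map trmxN Ls) s c))^T) 0 0.
Proof.
elim: s t => [|k s IH] t /=.
  by rewrite /wprod big_nil act1 mulmx1 rvN_bit trmx_delta -colE mxE.
rewrite wprod_cons actM mulmxA IH.
have [sk ->] := Ls_ok k.
have -> : nth idN (map trmxN Ls) k = trmxN (nth idN Ls k).
  have [lt_k|ge_k] := ltnP k (size Ls); first by rewrite (nth_map idN).
  by rewrite !nth_default ?size_map.
by rewrite rvN_vmul ?size_trmxN // mxN_tr trmx_mul trmxK mulmxA.
Qed.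

(** A bit r unset in mask i means that coordinate r of tail i has been made 0 by the choice of
    lifts. *)
Variable keep : seq N.

Definition overlap_row (LT : seq (seq N)) (k l p c : nat) : seq (nat * N) :=
  foldr (fun q row => let v := N.land (column LT q.2 c) (nth 0%num keep q.1) in
      if N.eqb v 0 then row else ins q.1 v row) [::] (overlap k l p).

Definition combine (facts : seq (seq (nat * N))) (refs : seq nat) (row : seq (nat * N)) :=
  foldl (fun row' r => addrow (nth [::] facts r) row') row refs.

(** New rows are put in front, so a reference counts back from the latest row, starting at 0. *)
Definition facts1 (LT : seq (seq N)) (prog : seq (nat * nat * nat * nat * seq nat)) :=
  foldl (fun facts q => let: (k, l, p, c, refs) := q in
    combine facts refs (overlap_row LT k l p c) :: facts) [::] prog.

Definition facts2 (facts : seq (seq (nat * N))) (prog : seq (seq nat)) :=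
  foldl (fun facts' refs => combine facts' refs [::] :: facts') facts prog.

(** A replayed Gaussian elimination: [prog1] reduces overlap rows, [prog2] substitutes back, and
    [prog3] exhibits every kept coordinate of the first [np] tails, except [exc], as a combination
    of rows that vanish. *)
Definition elim_ok (LT : seq (seq N)) prog1 prog2 prog3 (np : nat) (exc : nat * nat) : bool :=
  let facts := facts2 (facts1 LT prog1) prog2 in
  all (fun q => q.1.2 < 11)%N prog1 &&
  all2 (fun q refs => (q == exc) ||
      (combine facts refs [::] == [:: (q.1, N.shiftl 1 (N.of_nat q.2))]))
    [seq q <- [seq (i, r) | i <- iota 0 np, r <- iota 0 11]
      | N.testbit (nth 0%num keep q.1) (N.of_nat q.2)] prog3.

Section Elimination.

Variables (f : cochain) (Zf : f \in cocycles2 rG) (g : nat -> V).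
Hypothesis masked : forall i (r : 'I_11), (i < nr)%N ->
  ~~ N.testbit (nth 0%num keep i) (N.of_nat r) -> tail f g i 0 r = 0.

Let t := tail f g.

Lemma overlap_row0 k l p (c : 'I_11) : pair t (overlap_row (map trmxN Ls) k l p c) = 0.
Proof.
have [lt_o Do] := overlapP Zf g k l p; rewrite /overlap_row.
have <- : step_sum f g (overlap k l p) 0 c = 0 by rewrite Do mxE.
elim: (overlap k l p) lt_o => [|[i s] st IH] /=.
  by rewrite /pair /step_sum !big_nil mxE.
case/andP=> lt_i /IH E; rewrite /step_sum big_cons [RHS]mxE -/(step_sum _ _ _) -E.
have -> : (tail f g i *m act (wprod s)) 0 c =
    (t i *m (rvN (N.land (column (map trmxN Ls) s c) (nth 0%num keep i)))^T) 0 0.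
  by rewrite columnP rvN_land_eq // => r; apply: masked.
case: N.eqb_spec => [->|_]; last by rewrite pair_ins.
have -> : rvN 0 = 0 by apply/rowP=> k'; rewrite !mxE.
by rewrite trmx0 mulmx0 mxE add0r.
Qed.

Lemma combine0 facts refs row : (forall r, pair t (nth [::] facts r) = 0) ->
  pair t row = 0 -> pair t (combine facts refs row) = 0.
Proof.
move=> f0; rewrite /combine; elim: refs row => [|r refs IH] row r0 //=.
by apply: IH; rewrite pair_addrow f0 r0 addr0.
Qed.

Lemma pair_nil : pair t [::] = 0. Proof. by rewrite /pair big_nil. Qed.

Lemma elim_sound prog1 prog2 prog3 np exc :
  elim_ok (map trmxN Ls) prog1 prog2 prog3 np exc -> (np <= nr)%N ->
  forall i (r : 'I_11), (i < np)%N -> (i, nat_of_ord r) != exc -> t i 0 r = 0.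
Proof.
case/andP=> p1_ok H le_np i r lt_i ne_exc.
have [irk|irk] := boolP (N.testbit (nth 0%num keep i) (N.of_nat r)); last first.
  by apply: masked irk; apply: leq_trans le_np.
have zf1 facts : (forall r, pair t (nth [::] facts r) = 0) -> forall k,
    pair t (nth [::] (foldl (fun facts q => let: (k, l, p, c, refs) := q in
      combine facts refs (overlap_row (map trmxN Ls) k l p c) :: facts) facts prog1) k) = 0.
  elim: prog1 p1_ok facts {H} => [|[[[[k l] p] c] refs] prog IH] //= /andP[lt_c ok] facts f0.
  have o0 := overlap_row0 k l p (Ordinal lt_c).
  by apply: IH => // -[|k']; [exact: combine0 f0 o0 | exact: f0].
have zf2 facts : (forall r, pair t (nth [::] facts r) = 0) -> forall k,
    pair t (nth [::] (facts2 facts prog2) k) = 0.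
  rewrite /facts2; elim: prog2 facts {H} => [|refs prog IH] //= facts f0.
  by apply: IH => // -[|k']; [exact: combine0 f0 pair_nil | exact: f0].
have zf := zf2 _ (zf1 [::] _); rewrite -/(facts1 _ _) in zf.
have {}zf : forall k, pair t (nth [::] (facts2 (facts1 (map trmxN Ls) prog1) prog2) k) = 0.
  by apply: zf => k; rewrite nth_nil pair_nil.
move: H; set qs := [seq q <- _ | _].
have : (i, nat_of_ord r) \in qs.
  rewrite mem_filter; apply/andP; split=> //.
  by apply: (allpairs_f (fun a b : nat => (a, b))); rewrite mem_iota leq0n add0n ?lt_i ?ltn_ord.
elim: qs prog3 => [|q qs IH] [|refs prog] //=; rewrite in_cons.
case/orP=> [/eqP<-|/IH H] /andP[Hq Hqs]; last exact: H Hqs.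
move: Hq; rewrite (negPf ne_exc) /= => /eqP Dc.
have := combine0 refs zf pair_nil; rewrite Dc /pair big_seq1 /=.
by rewrite rvN_bit trmx_delta -colE mxE.
Qed.

End Elimination.

Definition gvec (gl : seq (nat * N)) (k : nat) : N :=
  foldr (fun p v => if p.1 == k then p.2 else v) 0%num gl.

(** From v = 0 this is the crossed homomorphism with value [G k] on the letter k, as in Fox
    calculus; it is [phi] for the zero cochain. *)
Fixpoint fox (G : nat -> N) (v : N) (w : seq nat) : N :=
  if w is k :: w' then fox G (N.lxor (vmul v (nth idN Ls k)) (G k)) w' else v.

Definition gtail (G : nat -> N) (j : nat) : N :=
  N.lxor (fox G 0 [:: (rule j).1.1; (rule j).1.2]) (fox G 0 (rule j).2).

(* For each bit that is not kept, a change of the lifts that flips this bit and no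
   other bit that is not kept. *)
Definition gauge_ok (gauge : seq (nat * nat * seq (nat * N))) : bool :=
  [&& map fst gauge == [seq q <- [seq (i, r) | i <- iota 0 nr, r <- iota 0 11]
        | ~~ N.testbit (nth 0%num keep q.1) (N.of_nat q.2)],
    uniq (map fst gauge)
  & all (fun e => all (fun j =>
      N.eqb (N.ldiff (gtail (gvec e.2) j) (nth 0%num keep j))
            (if j == e.1.1 then N.shiftl 1 (N.of_nat e.1.2) else 0%num)) (iota 0 nr)) gauge].

Lemma rvN0 : rvN 0 = 0. Proof. by apply/rowP=> k; rewrite !mxE. Qed.

Lemma phi_fox G x v w : phi 0 (fun k => rvN (G k)) x (rvN v) w = rvN (fox G v w).
Proof.
elim: w x v => [|k w IH] x v //=; rewrite -(IH (x * m k)%g); congr (phi _ _ _ _ w).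
by have [sk ->] := Ls_ok k; rewrite ffunE add0r rvN_xor rvN_vmul.
Qed.

Lemma tail_gtail G j : tail 0 (fun k => rvN (G k)) j = rvN (gtail G j).
Proof.
have E w : phi1 0 (fun k => rvN (G k)) w = rvN (fox G 0 w).
  by rewrite /phi1 ffunE oppr0 -(phi_fox _ 1%g) rvN0.
rewrite /tail /gtail !E rvN_xor; congr (_ + _); apply/rowP=> k; rewrite !mxE.
by rewrite -[LHS]addr0 -(F2_sqr (bitF (fox G 0 (rule j).2) k)) addKr.
Qed.

Lemma tail_eq f g g' j : g =1 g' -> tail f g j = tail f g' j.
Proof. by move=> gg'; rewrite /tail /phi1 !(phi_eq _ _ _ _ gg'). Qed.

Lemma tail0 j : tail 0 (fun=> 0) j = 0.
Proof.
rewrite (@tail_eq 0 _ (fun k => rvN ((fun=> 0%num) k))) ?tail_gtail; last first.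
  by move=> k; rewrite rvN0.
have f0 w : fox (fun=> 0%num) 0 w = 0%num.
  elim: w => [|k w IH] //=; have -> : vmul 0 (nth idN Ls k) = 0%num; last exact: IH.
  by elim: (nth _ _ _).
by rewrite /gtail !f0 rvN0.
Qed.

(** Start from zero lifts and add, for every bit that is not kept and equals 1, its own correction.
    The corrections do not disturb each other on the bits that are not kept. *)
Lemma gauge_sound f gauge : gauge_ok gauge -> exists g, forall i (r : 'I_11),
  (i < nr)%N -> ~~ N.testbit (nth 0%num keep i) (N.of_nat r) -> tail f g i 0 r = 0.
Proof.
case/and3P=> /eqP Dg ug gok.
pose a (e : nat * nat * seq (nat * N)) := tail f (fun=> 0) e.1.1 0 (inord e.1.2).
pose gs s k := \sum_(e <- s) a e *: rvN (gvec e.2 k).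
have tgs s j : tail 0 (gs s) j = \sum_(e <- s) a e *: rvN (gtail (gvec e.2) j).
  elim: s => [|e s IH].
    by rewrite big_nil -[RHS](tail0 j); apply: tail_eq => k; rewrite /gs big_nil.
  rewrite big_cons -IH.
  have [a0|a1] := F2_01 (a e).
    rewrite a0 scale0r add0r; apply: tail_eq => k.
    by rewrite /gs big_cons a0 scale0r add0r.
  rewrite a1 scale1r -tail_gtail -tailD addr0; apply: tail_eq => k.
  by rewrite /gs big_cons a1 scale1r.
exists (gs gauge) => i r lt_i nk.
rewrite (@tail_eq f _ (fun k => (fun=> 0) k + gs gauge k)); last by move=> k; rewrite add0r.
rewrite -[f]addr0 tailD mxE tgs summxE.
have eg : (i, nat_of_ord r) \in map fst gauge.
  rewrite Dg mem_filter; apply/andP; split=> //.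
  by apply: (allpairs_f (fun a b : nat => (a, b))); rewrite mem_iota leq0n add0n ?lt_i ?ltn_ord.
have -> : \sum_(e <- gauge) (a e *: rvN (gtail (gvec e.2) i)) 0 r
    = \sum_(q <- map fst gauge) if q == (i, nat_of_ord r) then tail f (fun=> 0) i 0 r else 0.
  rewrite big_map; apply: eq_big_seq => e e_in; rewrite mxE [X in _ * X]mxE.
  have /allP/(_ i) := allP gok e e_in; rewrite mem_iota lt_i => /(_ isT)/N.eqb_spec E.
  have -> : bitF (gtail (gvec e.2) i) r = bitF (N.ldiff (gtail (gvec e.2) i) (nth 0%num keep i)) r.
    by rewrite /bitF N.ldiff_spec (negPf nk) andbT.
  rewrite E; case: e e_in E => [[j c] gl] e_in E /=.
  have lt_c : (c < 11)%N.
    have : (j, c) \in map fst gauge by apply/mapP; exists (j, c, gl).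
    by rewrite Dg mem_filter => /andP[_ /allpairsP[[j' c'] [_ c'_in [_ ->]]]];
      move: c'_in; rewrite mem_iota => /andP[_].
  rewrite xpair_eqE eq_sym; case: eqP => [->|_] /=; last by rewrite bitF0 mulr0.
  have -> : bitF (N.shiftl 1 (N.of_nat c)) r = (r == Ordinal lt_c)%:R.
    by have /rowP/(_ r) := rvN_bit (Ordinal lt_c); rewrite !mxE.
  rewrite -val_eqE /= [in RHS]eq_sym; case: eqP => [cr|_]; last by rewrite mulr0.
  by rewrite mulr1 /a -cr inord_val.
(* Only the correction of the bit (i, r) itself contributes, and it equals the bit to be cleared. *)
rewrite (bigD1_seq _ eg ug) /= eqxx big1 ?addr0 ?F2_sqr //.
by move=> q /negPf->.
Qed.

End Tails.

(** * The rewriting system in M_23 and the elimination tables *)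

Definition letters : seq (seq nat) :=
  [:: [:: 4; 8; 6]%N; [:: 7]%N; [:: 6; 8; 7; 6; 8; 7]%N; [:: 0]%N; [:: 2]%N; [:: 1]%N; [:: 0; 1; 3]%N;
      [:: 7; 8]%N; [:: 5; 0; 8; 0; 7; 6; 5; 2; 6; 7; 5; 6]%N; [:: 5; 4]%N].

(** The last 13 rules move a letter of the Sylow 2-subgroup past one of the letters 7, 8, 9. They
    record conjugations of its elements back into it. *)
Definition rules : seq (nat * nat * seq nat) :=
  [:: (0, 0, [::])%N;
      (1, 0, [:: 0; 1; 2])%N;
      (1, 1, [::])%N;
      (2, 0, [:: 0; 2])%N;
      (2, 1, [:: 1; 2])%N;
      (2, 2, [::])%N;
      (3, 0, [:: 0; 3; 5; 6])%N;
      (3, 1, [:: 1; 3; 4; 5; 6])%N;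
      (3, 2, [:: 2; 3; 5])%N;
      (3, 3, [::])%N;
      (4, 0, [:: 0; 4; 5])%N;
      (4, 1, [:: 1; 4; 6])%N;
      (4, 2, [:: 2; 4; 6])%N;
      (4, 3, [:: 3; 4])%N;
      (4, 4, [::])%N;
      (5, 0, [:: 0; 5])%N;
      (5, 1, [:: 1; 5; 6])%N;
      (5, 2, [:: 2; 5])%N;
      (5, 3, [:: 3; 5])%N;
      (5, 4, [:: 4; 5])%N;
      (5, 5, [::])%N;
      (6, 0, [:: 0; 6])%N;
      (6, 1, [:: 1; 6])%N;
      (6, 2, [:: 2; 6])%N;
      (6, 3, [:: 3; 6])%N;
      (6, 4, [:: 4; 6])%N;
      (6, 5, [:: 5; 6])%N;
      (6, 6, [::])%N;
      (0, 7, [:: 7; 2])%N;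
      (1, 8, [:: 8; 2])%N;
      (1, 9, [:: 9; 1])%N;
      (2, 7, [:: 7; 0; 2])%N;
      (2, 8, [:: 8; 1; 2])%N;
      (3, 7, [:: 7; 3; 5; 6])%N;
      (3, 8, [:: 8; 3; 5])%N;
      (4, 7, [:: 7; 4; 5; 6])%N;
      (4, 8, [:: 8; 4; 5])%N;
      (5, 7, [:: 7; 6])%N;
      (5, 8, [:: 8; 4; 6])%N;
      (6, 7, [:: 7; 5; 6])%N;
      (6, 8, [:: 8; 6])%N].

Definition keep1 : seq N :=
  [::1531;1995;2015;1531;987;2043;1789;2013;977;2047;2045;2013;729;2046;2047;1529;1497;505;1982;
   2046;1531;1531;1531;1019;2030;2029;505;1531;1659;1899;1985;2043;2011;2011;2043;2045;2045;2027;
   1916;2031;2043]%num.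

Definition gauge_step (e : N * N * seq (N * N)) : nat * nat * seq (nat * N) :=
  (nat_of_bin e.1.1, nat_of_bin e.1.2, [seq (nat_of_bin p.1, p.2) | p <- e.2]).

(* The first entry lists the letters of the overlap as decimal digits, the second is the
   column and the others are the earlier rows to add. *)
Definition elim_step (q : seq nat) : nat * nat * nat * nat * seq nat :=
  let n := head 0%N q in
  (n %/ 100, n %/ 10 %% 10, n %% 10, nth 0%N q 1, drop 2 q)%N.

Definition gauge1 : seq (nat * nat * seq (nat * N)) := [seq gauge_step e | e <-
  [::(0,2,[::(0,1280);(7,512)]);(0,9,[::(0,384);(7,1024)]);(1,2,[::(0,1435);(1,1847);(2,32);
   (3,535);(4,384);(5,1152);(6,1152);(7,3);(8,128)]);(1,4,[::(0,1435);(3,535);(4,384);(5,1152);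
   (6,1152);(7,3)]);(1,5,[::(0,288)]);(2,5,[::(0,288);(1,663);(2,32);(8,384);(9,68)]);
   (3,2,[::(0,672);(2,384);(7,1152);(8,128)]);(3,9,[::(0,32);(2,384);(7,1024);(8,128)]);
   (4,2,[::(0,256);(1,1175);(2,288);(9,68)]);(4,5,[::(0,256);(2,288);(8,256)]);(4,10,[::(1,384);
   (9,69)]);(5,2,[::(1,1303);(2,640);(7,1024);(8,384);(9,1)]);(6,1,[::(0,1208);(1,32);(3,1975);
   (4,1184);(5,1152);(7,1669);(8,399);(9,69)]);(6,8,[::(0,1208);(1,32);(3,160);(4,1184);(5,1152);
   (7,524);(8,399);(9,69)]);(7,1,[::(0,1467);(1,1701);(2,291);(3,672);(4,160);(5,1408);(6,1824);
   (7,3);(8,334);(9,69)]);(7,5,[::(3,288)]);(8,1,[::(0,1211);(1,1669);(2,259);(3,2015);(4,1193);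
   (5,1152);(6,1792);(7,1602);(8,132)]);(8,2,[::(0,32);(3,1352);(4,1065);(5,288);(6,32);(7,1601);
   (8,258)]);(8,3,[::(0,1432);(2,32);(3,1982);(4,1152);(5,1184);(7,1669);(8,327)]);(8,5,[::(0,288);
   (1,32);(2,32);(3,919);(4,32);(5,32);(8,200);(9,69)]);(8,10,[::(3,535)]);(10,1,[::(0,32);(1,32);
   (3,288);(4,1184);(7,712);(8,399);(9,69)]);(11,1,[::(0,833);(1,512);(2,968);(3,1719);(4,1920);
   (5,160);(6,416);(7,1601);(8,140);(9,68)]);(11,5,[::(3,288);(4,288)]);(12,1,[::(0,1432);(2,32);
   (3,128);(4,872);(5,1408);(6,32);(7,524);(8,68)]);(12,2,[::(0,2041);(1,512);(2,968);(3,1152);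
   (4,1640);(5,1056);(6,160);(7,1101);(8,399);(9,68)]);(12,5,[::(0,1432);(1,32);(2,32);(3,416);
   (4,1440);(5,1408);(6,32);(7,524);(8,459);(9,69)]);(12,8,[::(0,1208);(3,791);(4,1184);(5,1152);
   (6,256);(7,524);(8,259)]);(12,10,[::(1,32);(3,288);(4,416);(8,399);(9,69)]);(13,0,[::(0,1464);
   (2,32);(3,535);(4,169);(5,1408);(6,32);(7,196);(8,69)]);(15,1,[::(0,258);(1,32);(3,1440);
   (4,1312);(6,1152);(7,646);(8,399);(9,69)]);(15,2,[::(0,1331);(3,919);(4,384);(6,1152);(7,199)]);
   (15,9,[::(0,1041);(1,32);(3,1975);(4,1184);(5,1152);(7,1669);(8,399);(9,69)]);(16,1,[::(0,1432);
   (1,1209);(2,32);(3,567);(4,1440);(5,1408);(7,524);(8,334);(9,71)]);(16,2,[::(0,256);(1,1965);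
   (2,291);(3,183);(4,288);(5,256);(6,928);(8,334);(9,69)]);(16,5,[::(0,1432);(2,32);(3,384);
   (4,1152);(5,1408);(7,524);(8,327)]);(16,9,[::(0,256);(1,1932);(2,291);(3,407);(4,288);(5,256);
   (6,928);(8,462);(9,71)]);(17,1,[::(0,1875);(1,18);(2,258);(3,823);(4,1024);(5,1440);(6,1952);
   (7,1739);(8,394)]);(17,2,[::(0,643);(1,1815);(2,775);(3,288);(4,1408);(5,256);(6,1184);(7,1039);
   (8,205);(9,69)]);(17,9,[::(0,1651);(1,50);(2,426);(3,695);(4,1056);(5,1408);(6,1952);(7,715);
   (8,450);(9,69)]);(17,10,[::(0,169);(3,1815);(5,384);(7,1161)]);(18,0,[::(3,920)]);
   (18,6,[::(0,1593);(1,1410);(2,685);(3,246);(4,952);(5,1514);(6,1062);(7,135);(8,323);(9,69)]);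
   (19,0,[::(0,35);(1,1701);(2,259);(3,183);(4,49);(6,1792);(7,527);(8,267);(9,69)]);
   (20,2,[::(0,1937);(1,807);(2,942);(3,494);(4,1673);(5,122);(6,1958);(7,711);(8,73)]);
   (20,9,[::(0,521);(1,775);(2,910);(3,1384);(4,553);(5,66);(6,1958);(7,1733);(8,129);(9,69)]);
   (21,2,[::(0,712);(1,1815);(2,32);(3,695);(4,1312);(6,1152);(7,527);(8,271);(9,69)]);
   (21,9,[::(0,744);(1,1815);(2,32);(3,288);(4,1184);(7,1736);(8,271);(9,69)]);(22,2,[::(0,866);
   (1,328);(2,747);(3,1568);(4,928);(5,160);(6,1664);(7,1102);(8,268);(9,68)]);(22,9,[::(0,2041);
   (1,481);(2,1000);(3,1847);(4,768);(5,1312);(6,416);(7,1101);(8,203);(9,3)]);(23,2,[::(0,1435);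
   (1,1797);(2,32);(3,416);(4,416);(5,1152);(6,1536);(7,3);(8,390);(9,69)]);(23,10,[::(0,744);
   (1,1815);(2,32);(3,951);(4,1152);(6,128);(7,1736);(8,12);(9,69)]);(24,0,[::(0,1464);(2,32);
   (3,82);(4,169);(5,1408);(6,32);(7,196);(8,69)]);(24,4,[::(3,1361)]);(25,1,[::(0,1435);(1,1701);
   (2,291);(3,672);(4,563);(5,1408);(6,1824);(7,715);(8,334);(9,69)]);(25,4,[::(0,35);(1,1701);
   (2,259);(3,407);(4,281);(6,1792);(7,527);(8,267);(9,69)]);(26,1,[::(0,288);(1,1208);(2,32);
   (3,916);(4,656);(6,950);(7,3);(8,64)]);(26,2,[::(0,1875);(1,402);(2,259);(3,1539);(4,1168);
   (5,1408);(6,944);(7,579);(8,205);(9,69)]);(26,9,[::(0,1003);(1,434);(2,259);(3,359);(4,1848);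
   (5,3);(6,6);(7,715);(8,322)]);(26,10,[::(0,898);(1,775);(2,910);(3,601);(4,1833);(5,107);
   (6,806);(7,515);(8,128);(9,69)]);(27,2,[::(0,1112);(1,699);(2,70);(3,62);(4,121);(5,1352);
   (6,962);(7,1036);(8,197);(9,3)]);(27,9,[::(0,929);(1,154);(2,910);(3,317);(4,1458);(5,360);
   (6,502);(7,1227);(8,201);(9,69)]);(28,2,[::(0,32);(7,512)]);(28,7,[::(7,1024)]);
   (28,8,[::(0,32)]);(29,2,[::(1,32);(3,951);(8,9);(9,69)]);(29,4,[::(3,951);(8,265)]);
   (29,7,[::(8,384)]);(30,1,[::(0,288);(1,951);(2,32);(8,128);(9,4)]);(30,2,[::(9,69)]);
   (30,3,[::(0,288);(1,951);(2,32);(8,128);(9,69)]);(30,4,[::(0,288);(1,951);(2,32);(8,128);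
   (9,68)]);(30,5,[::(9,2)]);(31,2,[::(7,1152)]);(32,2,[::(0,288);(2,32)]);(32,5,[::(8,256)]);
   (33,2,[::(7,1161)]);(33,5,[::(3,919)]);(34,2,[::(3,951)]);(35,1,[::(0,32);(7,712)]);
   (36,1,[::(3,288);(4,32)]);(37,2,[::(3,919);(7,644)]);(37,4,[::(0,32);(7,1600)]);
   (38,0,[::(3,951);(8,1)]);(38,1,[::(0,288);(1,32);(2,32);(3,663);(4,32);(8,201);(9,69)]);
   (38,7,[::(1,32);(3,288);(4,32);(8,399);(9,69)]);(39,4,[::(0,32);(3,919);(7,1223)]);
   (40,2,[::(1,32);(3,951);(8,140);(9,69)])]%num].

Definition elim1 : seq (nat * nat * nat * nat * seq nat) := [seq elim_step q | q <-
  [::[::0;3];[::222;0];[::444;5];[::444;8];[::500;3];[::521;6];[::522;8];[::540;3];[::542;6];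
   [::550;3];[::552;8];[::555;2];[::555;7];[::628;6];[::661;0];[::662;0];[::665;2];[::666;0];
   [::666;7];[::7;6;18];[::100;6;0];[::110;6;1];[::118;6;2];[::220;0;16];[::221;0;22];[::411;6;11];
   [::441;6;0];[::522;10;7];[::552;2;18];[::553;10;17];[::554;8;20];[::642;1;25];[::651;0;17];
   [::652;2;24];[::655;2;4];[::650;2;0];[::665;8;27];[::665;7;0];[::220;2;17;14];[::522;2;0];
   [::652;8;0];[::620;0;0];[::222;7;22;18];[::420;6;34;3];[::422;3;7;3];[::520;2;40;16];[::200;2;
   45;0];[::200;0;0];[::220;10;28;1];[::551;0;30;11];[::552;0;39;10];[::641;2;37;19];[::642;9;36;
   20];[::661;7;34;27];[::651;2;40;0];[::651;8;22;1];[::511;9;33;0];[::662;5;51;31];[::664;1;40;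
   32];[::518;6;53;6;3];[::551;9;51;10;4];[::551;2;5;0];[::650;10;57;53;18];[::520;0;52;42;21;15];
   [::641;7;49;37;31;12];[::0;0];[::0;2;0];[::0;7];[::111;0];[::111;3];[::119;1];[::333;0];[::333;
   5;0];[::533;8;0];[::533;7;1;0];[::553;8;45;0];[::655;7;0];[::653;10;42;3];[::632;2;20;0];[::433;
   0;7;6];[::433;5;7;0];[::543;8;0];[::551;10;73;44;21;6];[::660;0;46;0];[::511;10;61;28;1];[::610;
   0;30;27;0];[::660;10;60;42;2];[::660;7;50;0];[::511;7;32;31;0];[::668;7;72;70;1];[::510;0;39;32;
   28;4;3];[::333;8];[::433;8];[::511;2];[::540;10];[::611;0];[::411;2;73;0];[::411;9;74;0];[::621;
   0];[::622;0];[::633;0;8];[::533;4;29;0];[::532;3;27;0];[::533;10;29;1];[::633;5;3;0];[::633;7;4;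
   0];[::633;6;28;1;0];[::643;10;29;14;3;2];[::543;10;33;26;0];[::554;2;99;79;0];[::532;8;99;59;35;
   7];[::532;2;60;9;0];[::322;3;101;99;0];[::332;6;103;1;0];[::432;2;69;33;32;1];[::531;4;59;54;41;
   37;13;8;5;4];[::100;9;114];[::210;0;92];[::400;2;117];[::400;9;118];[::422;9;100];[::441;2;23];
   [::443;8;14];[::444;0;120];[::444;1;120;2;1];[::644;5;121;3;0];[::643;6;99;67;0];[::643;0;34;23;
   22;0];[::631;0;114;90;74;50;49;1];[::511;8;72];[::521;0;72;31];[::550;2;119];[::550;7;119;37];
   [::552;10;93;0];[::557;2;122;0];[::557;9;125;0];[::600;2;100];[::600;0;0];[::650;7;75;61;0];
   [::600;7;1];[::622;7;134];[::640;10;3];[::7;2;76;75];[::100;3;136;95];[::221;7;124;122];[::322;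
   9;138;106;45];[::420;2;125;100];[::521;2;125;91];[::522;0;141;128;48];[::221;3;127;18;0];[::100;
   2;32;0];[::521;8;20;3;1];[::422;8;132;99;31;0];[::442;8;126;94;31;0];[::530;10;91;80;22;20];
   [::542;9;102;73];[::542;5;127;103;0];[::542;8;149;75;1];[::557;7;82;70;25];[::600;10;158;115];
   [::640;2;73;22];[::657;7;26;25];[::667;9;153;136;0];[::657;9;27;4;0];[::657;0;155;29;0];[::668;
   9;146;105];[::110;0;141;109;18;17;16];[::118;3;160;97;73];[::210;9;147;50;23;19];[::100;0;105;
   51;25;20;19;18;9;0];[::227;2;149;146;131];[::332;1;141;96;57];[::411;3;135;117;74];[::431;1;114;
   93;91;80;69;68;58;45;0];[::521;10;134;83;75;26;24];[::532;7;124;100;72];[::537;1;73;41;17];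
   [::542;2;169;137;95;21];[::637;6;16;15;14;13];[::110;3;172;157;156;48;35;19;9];[::218;0;158;81;
   35;32;31;30];[::322;5;174;142;35;32];[::322;10;143;82;69;48;36];[::330;1;165;153;110;108];
   [::332;5;109;80;12];[::332;8;110;71;13];[::420;5;122;44;39;29;4];[::537;9;178;109;108;84];
   [::541;1;180;132;129;78;32];[::630;1;105;102;84;83];[::647;4;80;63;29;27];[::100;8;190;73;47;41;
   40;31;21];[::110;8;169;167;135;25;23;11];[::518;3;152;148;143;140;132;15];[::637;10;116;115;88;
   32;29;17];[::211;5;172;126;96;64;50;46;45;14];[::218;1;174;97;65;51;47;46;15];[::218;9;175;49;
   47;1;0];[::441;7;194;139;110;76;73;71;9];[::510;8;159;143;137;108;47;19];[::637;9;125;121;93;89;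
   35;12;5];[::637;4;98;95;39;37;36;11;0];[::630;9;193;166;123;97;47;0];[::638;7;124;113;98;64;37;
   0];[::437;4;124;101;98;94;16;3];[::631;7;191;190;178;167;150;76;66;6];[::631;4;197;192;168;152;
   129;127;99;90;32;0];[::331;2;180;132;129;114;103;99;98;91;85;81;80;35;0];[::119;9];[::119;10;
   139;0];[::119;3;187;141;116;114;43;0];[::118;9;209;141;14;0];[::211;10;187;143;64;62;45;1];
   [::118;7;170;144;143;119;16;2];[::228;9;212;192;145;65;16;3];[::111;5;158;121;119;48;2];[::7;5;
   215;150;73;56;46;1];[::110;5;195;194;192;160;131;100;99;67;66;50;2];[::500;2;151;86;84];[::500;
   7;124];[::7;1;219;154;120;77];[::7;7;178;153;61;51;0];[::540;5;217];[::647;10;215;196;191;58;0];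
   [::540;7;219;68];[::542;7;217;196;86;2;0];[::400;8;225;107;56;0];[::420;9;181;163;106;80;1];
   [::640;9;196;90;29;2];[::547;10;221;220;191;102;73;68;6;5;3;0];[::547;9;222;221;203;198;120;103;
   71;4;0];[::527;1;215;191;147;95;5];[::527;2;203;188;0];[::547;1;225;123;98;74;10;7;2;0];[::440;
   7;231;203;101;26;9;0];[::448;7;204;111;102;27;10;9;1;0];[::540;2;173;141;13;7;2];[::530;2;174;
   162;135;60;35;11];[::530;8;163;136;106;104;80;61;12];[::440;1;236;231;209;208;13;2];[::557;5;
   230;164;106;104;81;14];[::337;2;169;163;140;139;136;57;46;15];[::320;1;226;221;194;130;87;40;3;
   0];[::330;8;234;170;168;139;90;85;59;57;5;1];[::332;10;130;110;67;60;18;2];[::437;6;237;218;167;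
   54;21;16;15;14;11];[::558;7;234;187;170;158;119;47;11];[::638;1;168;157;140;57;45;44;21;3];
   [::638;9;170;169;158;143;54;0];[::337;6;240;239;223;171;61;54;48;23;7];[::410;2;224;194;185;153;
   81;72;24;21];[::421;7;229;198;186;162;153;110;102;101;0];[::300;9;247;243;185;82;14;13;9];
   [::327;2;243;227;209;141;15;10;3];[::410;5;245;228;216;201;198;157;156;135;134;112;84;74;72;67;
   28;20;17;3];[::119;5;185];[::322;8;156;110;107;15];[::422;5;250;212;136];[::628;9;244;200;198;
   60;0];[::421;5;214;206;194;162;109;81;31;1];[::411;5;208;203;195;162;87;9;8;0];[::7;3;254;101;
   91;40];[::207;0;241;220;215];[::207;2;242;217;216;1;0];[::207;5;217;200;72;71;68;1;0];[::227;3;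
   244;219;116;44];[::638;6;257;206;176;100;72];[::658;7;232;229;208;140;101;68;0];[::558;9;241;
   236;209;192;60;0];[::440;5;266;265;261;238;43;29;0];[::658;9;243;238;232;211;113;104;2];[::528;
   9;257;245;220;173;150;89;12;2;0];[::321;2;227;219;163;158;126;122;66;65;0];[::400;5;154;103;52;
   4;1];[::321;10;266;234;229;223;183;160;128;126;124;68;51;48;40;2;1];[::528;7;261;249;246;224;
   210;192;190;47;24;16;4];[::310;2;264;262;258;246;238;199;163;160;134;132;116;106;69;42;4;3];
   [::338;9;202;176;166;105;73];[::418;9;225;213;157;6];[::448;9;271;248;154;123;7];[::518;9;227;
   219;159;83];[::527;7;253;237;230;144;140;132;111;49];[::527;5;242;238;231;146;95;56;50;25;24;18;
   13;10;0];[::300;1;265;253;216;199;123;113;62;45;44;0];[::300;2;283;129;114;63;58;46;45;1;0];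
   [::7;8;284;218;217;142;125;92;89;68;2];[::507;1;281;270;67;65;60;3];[::338;7;215;212;154;111;
   110;83;61;45;42;2];[::438;7;257;213;208;173;112;111;63;54;46;39;3];[::507;8;284;226;194;157;155;
   137;69;68;63;62;48;15;6;2];[::440;8;287;286;259;64;56;50;49;18;0];[::538;6;283;282;213;183;44;
   23;20;19;1];[::442;5;288;265;233;170;165;114;20;2];[::548;7;184;183;167;154;137;94;68;59;22;21;
   3];[::618;9;240;234;97;34;13;4];[::648;9;268;263;169;168;101;59;23;2];[::648;7;264;236;170;169;
   157;97;24;0];[::438;6;289;61;3;1;0];[::518;8;248;245;242;236;207;146;123;101;27;8];[::427;2;269;
   255;157;152;134;121;75;73;69;65;62;35;16];[::441;5;297;273;241;177;176;173;111;65;60;10;7];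
   [::338;10;228;209;197;167;129;124;97;75;59;23;16];[::338;2;230;229;210;201;200;198;130;118;98;
   24;17;0];[::338;5;230;228;211;202;199;119;118;58;18;15;13;1;0];[::338;6;294;100;55;32;16;1;0];
   [::438;9;297;274;230;194;190;149;33;9;8;7;2;1];[::438;2;226;225;213;204;202;198;197;191;102;101;
   82;72;17;16;10;3;0];[::337;5;298;269;232;229;206;203;201;150;123;122;106;65;59;29;19;17;4;3];
   [::310;5;303;299;295;294;289;282;281;273;270;263;255;252;249;247;245;232;222;192;181;153;151;
   121;106;101;82;71;69;66;65;55;50;48;39;36;35;34;31;25;24;18;15;4];[::518;7;264;259;248;168;160;
   141;81;38;33;19;5];[::618;3;277;269;256;250;142;116;43;20;15;6];[::518;0;266;255;253;221;220;
   143;136;114;0];[::518;5;267;259;256;250;221;144;115;54;22;8;1;0];[::218;5;214;163;145;132;115;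
   101;99;18;9;2];[::318;9;304;283;201;168;158;146;117;108;106;78;46;43;42;35;24;19;11];[::407;5;
   306;277;275;264;262;196;173;158;145;137;133;91;86;81;60;57;46;43;32;11];[::427;8;307;286;271;
   195;174;169;164;158;138;116;92;89;88;75;61;59;52;33;26;16;12];[::528;5;306;303;291;277;252;220;
   219;135;70;60;58;57;49;48;46;41;27;25;6];[::218;3;296;170;168;150;121;120;14];[::228;3;312;297;
   280;262;188;170;0];[::428;9;311;294;275;267;264;255;199;147;131;39;24;16;9;0];[::328;9;312;311;
   295;265;207;200;175;115;114;72;62;49;33;17;10;2;1;0];[::618;7;289;268;262;181;173;18;12;1;0];
   [::328;1;314;305;293;211;177;140;116;97;64;51;50;33;19;4;1];[::328;8;212;211;178;171;166;141;
   118;117;98;83;75;52;51;36;12;6;5;4;3;2;0];[::218;7;303;300;194;177;175;128;127;111;3];[::228;5;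
   324;319;306;304;302;301;226;133;128;67;36;7;4;0];[::418;7;299;262;230;188;138;130;99;91;30;17;6;
   5];[::428;5;319;302;290;272;231;207;155;146;139;59;49;47;38;34;31;30;17;15;8;0];[::328;7;319;
   303;291;273;246;238;215;195;183;146;131;125;122;101;80;70;52;41;39;24;10;8;7];[::318;7;322;320;
   317;302;242;214;162;147;133;124;105;104;96;95;94;81;62;58;57;35;32;27;26;20;19;9;0];[::318;5;
   323;318;218;202;163;157;149;134;124;63;62;61;60;58;54;51;28;27;18;16;9;6];[::328;5;323;322;306;
   294;276;220;219;186;175;134;125;83;73;63;60;59;29;17;12;8;2];[::227;9;331;313;312;70;69;67;50];
   [::507;7;271;198;193;185;114;113;102;51;30];[::527;9;295;291;199;109;71;52;48;31;0];[::307;4;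
   325;318;302;296;285;201;110;86;52;0];[::607;1;321;293;200;172;167;111];[::627;1;333;332;322;254;
   175;173;112;72;55;34];[::407;2;294;286;220;169;109;102;77;35;3];[::427;9;335;331;330;310;296;
   219;198;116;114;76;57;2;0];[::407;8;332;301;296;221;199;189;183;163;111;107;104;86;84;79;58;32;
   1];[::427;5;337;333;332;304;298;279;266;195;185;155;116;108;84;73;70;68;59;52;42;33];[::327;8;
   231;230;229;197;185;160;155;143;142;117;116;104;100;89;86;58;53;39;1];[::607;10;304;300;293;257;
   207;174;8;6;5;0];[::327;9;340;336;335;319;301;232;199;144;106;103;63;58;8;1];[::307;8;329;327;
   306;234;232;194;193;191;187;108;107;103;96;93;89;63;61;56;29;22;10;9;4]]%N].

Definition back1 : seq (seq nat) :=
  [::[::5;3];[::8;4];[::11;5];[::14;6];[::16;0];[::24;21];[::33;31];[::35;32;33];[::37;33];[::40;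
   7];[::42;35];[::44;36];[::46;37];[::49;38];[::51;40];[::60;54];[::62;59];[::65;3];[::67;61];
   [::70;62];[::72;6];[::78;64];[::80;72];[::82;1];[::84;27];[::89;68];[::91;69];[::93;70;13];
   [::95;71;9];[::97;54;1];[::99;8;74];[::101;74];[::103;58];[::105;1];[::107;8];[::110;78];[::112;
   14];[::115;1];[::118;2;16];[::120;13];[::122;14];[::124;84;15];[::126;16];[::128;86];[::130;87];
   [::132;23];[::134;24];[::136;90;25];[::138;91;26];[::141;27];[::143;23];[::145;113];[::148;95];
   [::150;115];[::152;18];[::154;31];[::156;20];[::158;21];[::160;42];[::164;121];[::166;38];
   [::168;25];[::170;2];[::172;3];[::174;28];[::183;29];[::185;109];[::187;6];[::190;181;32];
   [::192;182];[::194;183;191];[::196;114];[::198;115;46];[::200;0;194];[::202;1;195];[::204;118];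
   [::206;3];[::208;120];[::214;121];[::217;0;213];[::219;44];[::221;45];[::223;46];[::225;13];
   [::227;62];[::230;206];[::232;26];[::234;38];[::236;52];[::239;132];[::241;133];[::243;212];
   [::245;56];[::247;2];[::249;0];[::251;29];[::253;10];[::255;61];[::257;38];[::259;61];[::261;
   39];[::263;63];[::265;164];[::267;224];[::269;66];[::271;14];[::273;149];[::275;228];[::277;72];
   [::279;49];[::281;0];[::283;154];[::286;14];[::288;54];[::292;157];[::294;25];[::296;159];
   [::298;95];[::300;239];[::303;0];[::305;1];[::307;55];[::309;299];[::311;244];[::315;88];[::317;
   246];[::321;169];[::323;12];[::326;171];[::328;326];[::330;251];[::332;174];[::334;3];[::336;
   10];[::338;108];[::340;256];[::342;7];[::344;14];[::348;315];[::350;260];[::352;261];[::354;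
   262];[::356;263];[::358;1];[::360;187];[::362;339];[::368;65];[::370;0];[::372;1];[::374;68];
   [::376;193];[::378;20];[::380;329];[::382;350];[::384;20];[::401;41];[::403;199];[::405;200];
   [::409;79];[::411;280];[::413;81];[::415;404];[::417;6];[::438;7];[::440;84];[::442;86];[::444;
   87];[::446;94];[::448;95];[::450;96]]%N.

(** After the back substitution each kept coordinate is a single row. The entry at the exceptional
    coordinate is a placeholder. *)
Definition final1 : seq (seq nat) := [seq [:: i] | i <-
  [::47;347;97;1;231;516;2;93;0;63;431;36;55;15;94;16;42;4;11;91;460;9;494;304;92;3;53;453;475;469;
   471;129;496;468;75;470;40;12;367;25;495;37;64;492;41;13;510;478;302;497;474;76;515;493;232;84;
   107;106;0;44;118;274;233;87;388;88;401;343;136;192;244;138;403;405;404;66;193;38;14;7;56;444;6;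
   139;413;154;209;111;67;34;104;283;105;208;291;18;120;39;17;452;465;57;72;419;265;125;420;117;
   472;134;61;464;103;19;8;389;436;437;211;409;147;210;402;86;23;21;20;514;22;141;513;282;153;89;
   108;454;10;26;135;512;96;102;95;456;455;467;461;58;205;426;466;506;488;65;477;489;121;443;414;
   442;415;68;59;69;406;60;435;407;486;408;247;509;101;226;45;99;441;487;504;505;132;507;27;109;28;
   430;433;379;481;70;473;32;82;31;463;502;462;484;124;503;428;24;432;459;501;476;483;122;511;33;
   43;213;411;410;412;114;439;314;273;438;73;390;458;391;224;490;81;363;485;48;479;440;482;360;508;
   378;359;498;499;480;500;148;491;429;364;434]%N].

Definition keep2 : seq N :=
  [::2047;2039;2031;1919;2047;2047;1908;1012;964;2030;2039;2039;478;2044;2031;2022;998;998;2040;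
   2028;2045;2037;2038;2030;2036;2034;2020;2030;1527;2039;1976;2047;2039;2020;2020;2039;2030;1522;
   2023;2039;2039]%num.

Definition gauge2 : seq (nat * nat * seq (nat * N)) := [seq gauge_step e | e <-
  [::(1,3,[::(0,95);(1,95);(2,95);(8,672);(9,43)]);(2,4,[::(1,992);(9,43)]);(3,7,[::(0,928);(1,95);
   (2,95);(7,1825);(8,672);(9,43)]);(6,0,[::(0,1408)]);(6,1,[::(0,768);(7,1825)]);(6,3,[::(0,1728);
   (7,1825)]);(6,7,[::(3,832)]);(7,0,[::(1,1439);(8,672)]);(7,1,[::(1,768);(9,42)]);
   (7,3,[::(1,1759);(8,672)]);(7,10,[::(4,1728);(8,6)]);(8,0,[::(0,928);(1,95);(2,1503);(7,1825);
   (9,43)]);(8,1,[::(0,928);(1,95);(2,863);(8,672);(9,43)]);(8,3,[::(2,1312);(8,672)]);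
   (8,4,[::(2,992);(7,1825)]);(8,5,[::(0,456);(1,606);(2,1243);(3,865);(4,416);(5,552);(6,1156);
   (7,1091);(8,37);(9,1)]);(8,10,[::(1,64);(3,1312);(4,1728);(7,64);(8,70);(9,42)]);
   (9,0,[::(3,1664);(8,64)]);(9,4,[::(3,1728);(8,64)]);(10,3,[::(0,3)]);(11,3,[::(1,67);(9,1)]);
   (12,0,[::(2,3)]);(12,5,[::(0,832);(1,1426);(2,1312);(3,1216);(6,160);(7,676);(8,64);(9,35)]);
   (12,9,[::(0,1408);(1,1439);(2,1376);(3,1577);(4,768);(5,1664);(6,768);(7,513);(8,1733)]);
   (12,10,[::(0,1408);(1,1500);(2,1376);(3,1577);(4,224);(5,1664);(6,768);(7,514);(8,1733);(9,1)]);
   (13,0,[::(4,768)]);(13,1,[::(4,832)]);(14,4,[::(1,1695);(4,3);(8,1828);(9,42)]);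
   (15,0,[::(0,1153)]);(15,3,[::(0,32);(1,95);(2,95);(8,672);(9,43)]);(15,4,[::(0,1188);(1,95);
   (2,95);(8,672);(9,43)]);(16,0,[::(1,1949);(8,672);(9,1)]);(16,3,[::(1,582)]);(16,4,[::(0,95);
   (1,1501);(2,95);(8,672);(9,42)]);(16,10,[::(1,28);(2,1664);(3,1281);(4,224);(5,1664);(6,1664);
   (7,674);(8,488);(9,42)]);(17,0,[::(0,928);(1,95);(2,1917);(9,43)]);(17,3,[::(2,672);(7,1825);
   (8,672)]);(17,4,[::(0,928);(1,95);(2,1499);(7,1825);(9,43)]);(17,10,[::(0,456);(1,516);(2,516);
   (3,832);(4,320);(5,392);(6,516);(7,1775);(8,392);(9,42)]);(18,0,[::(0,1664);(1,1503);(2,1664);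
   (3,417);(4,768);(5,1408);(7,64);(8,773);(9,42)]);(18,1,[::(1,64);(3,1632);(5,1408);(7,64);
   (8,69);(9,42)]);(18,2,[::(1,1439);(2,1728);(3,1924);(4,832);(7,1376);(8,64)]);(19,0,[::(0,516);
   (1,1503);(2,64);(3,1573);(4,514);(5,1156);(7,1312);(8,1124);(9,42)]);(19,1,[::(0,516);(1,64);
   (2,64);(3,1573);(4,64);(5,1156);(7,1312);(8,832);(9,42)]);(19,4,[::(1,1759);(4,516);(7,3);
   (8,672)]);(20,1,[::(0,676);(1,863);(2,799);(3,69);(4,64);(5,6);(7,865);(8,677);(9,1)]);
   (21,1,[::(0,547);(1,95);(2,95);(8,672);(9,43)]);(21,3,[::(0,619)]);(22,0,[::(1,130);(9,35)]);
   (22,3,[::(1,143)]);(23,0,[::(0,928);(1,95);(2,1279);(7,1825);(9,43)]);(23,4,[::(0,928);(1,95);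
   (2,1195);(7,1825);(9,43)]);(24,0,[::(0,1472);(1,64);(2,1312);(3,96);(4,1728);(7,64);(8,678);
   (9,42)]);(24,1,[::(0,832);(1,1439);(2,1312);(3,1920);(7,673);(8,64)]);(24,3,[::(0,1728);
   (2,1728);(3,2024);(4,1728);(7,513);(8,1894)]);(25,0,[::(1,1756);(2,3);(4,608);(7,3);(8,672);
   (9,43)]);(25,2,[::(0,1408);(2,1376);(3,1577);(4,576);(5,1664);(6,768);(7,513);(8,1125)]);
   (25,3,[::(0,1408);(2,1376);(3,1577);(4,40);(5,1664);(6,768);(7,513);(8,2017)]);(26,0,[::(0,744);
   (1,603);(2,1243);(3,1985);(4,576);(5,264);(6,516);(7,879);(8,1229);(9,1)]);(26,1,[::(0,800);
   (1,799);(2,95);(3,1632);(5,1920);(7,1121);(8,1248);(9,43)]);(26,3,[::(0,1259);(1,1408);(3,2016);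
   (4,1728);(6,256);(7,737);(8,747);(9,1)]);(26,4,[::(1,1439);(2,1664);(3,1601);(4,1152);(5,1664);
   (6,772);(7,769);(8,835)]);(27,0,[::(0,832);(1,130);(2,928);(3,641);(4,1768);(5,1664);(6,640);
   (8,135);(9,35)]);(27,4,[::(0,1663);(1,1157);(2,1803);(3,641);(4,1768);(5,1664);(6,648);(7,396);
   (8,1058);(9,42)]);(28,3,[::(0,95)]);(28,9,[::(7,1825)]);(29,3,[::(1,95);(8,672);(9,43)]);
   (30,0,[::(9,9)]);(30,1,[::(9,32)]);(30,2,[::(9,1)]);(30,6,[::(9,3)]);(32,3,[::(8,672)]);
   (33,0,[::(7,1408)]);(33,1,[::(7,768)]);(33,3,[::(7,577)]);(33,4,[::(7,1153)]);
   (34,0,[::(8,1408)]);(34,1,[::(8,768)]);(34,3,[::(8,1920)]);(34,4,[::(8,320)]);(35,3,[::(7,3)]);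
   (36,0,[::(8,1412)]);(36,4,[::(8,1410)]);(37,0,[::(7,544)]);(37,2,[::(7,416)]);(37,3,[::(0,95);
   (7,974)]);(37,9,[::(0,1664);(1,1503);(2,1664);(3,417);(4,768);(5,1664);(7,64);(8,773);(9,42)]);
   (38,3,[::(8,1541)]);(38,4,[::(8,1536)]);(39,3,[::(7,5)]);(40,3,[::(1,95);(8,13);(9,43)])]%num].

Definition elim2 : seq (nat * nat * nat * nat * seq nat) := [seq elim_step q | q <-
  [::[::111;1];[::207;5];[::210;1];[::211;1];[::221;1];[::444;0];[::521;5];[::522;7];[::530;5];
   [::530;8];[::544;4];[::550;0];[::552;0];[::554;1];[::555;0];[::611;7];[::641;7];[::652;4];
   [::661;7];[::664;4];[::665;4];[::666;3];[::668;8];[::211;3;19];[::444;1;13];[::544;2;14];[::554;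
   0;11];[::638;8;17];[::644;4;8];[::647;7;12];[::540;7;0];[::648;8;21];[::642;7;0];[::651;3;24];
   [::654;4;14];[::657;3;26];[::660;4;15];[::640;4;0];[::440;1;0];[::661;3;20];[::662;3;18];[::662;
   7;18];[::660;7;0];[::441;7;10;1];[::641;3;27;24];[::650;10;36;35];[::650;4;9;0];[::655;4;20;1];
   [::552;4;21;0];[::667;3;30;1];[::668;4;29;27];[::638;4;23;0];[::441;3;32;30;8];[::442;3;33;31;
   24];[::442;4;25;0];[::422;7;13;0];[::622;7;0];[::642;3;16;3];[::0;2];[::500;2;0];[::540;0;21;0];
   [::440;0;46;0];[::0;7];[::7;8];[::218;1];[::222;3];[::222;7];[::322;5];[::322;8];[::322;10];
   [::332;5;2];[::332;8;2];[::338;8;3;0];[::333;2];[::400;5;6];[::400;8;6];[::411;0];[::420;3];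
   [::421;8];[::422;4];[::422;8];[::411;8;4;2;0];[::411;7;40;5;0];[::411;10;60;6;1];[::440;5;16];
   [::440;8;16];[::438;8;14;0];[::448;8;18;1];[::448;1;0];[::442;7;56;47;1];[::448;0;84;75;61;2];
   [::442;8;10];[::500;0];[::500;7];[::507;8;19];[::527;8;0];[::420;8;86;0];[::432;8;87;11;0];
   [::637;5;27;0];[::610;8;4;0];[::431;5;91;15;1];[::637;7;0];[::532;7;0];[::521;7;47;4];[::518;5;
   97;0];[::541;3;85;20;6];[::541;7;73;21;7];[::650;7;0];[::652;7;1];[::530;7;7;2];[::542;7;80;3];
   [::321;10;54;0];[::551;3;90;44;13];[::557;7;71;45;14];[::550;7;0];[::552;7;1];[::632;7;88;9];
   [::630;7;10;0];[::640;7;85;11];[::652;0;111;20];[::332;7;47;18;6];[::431;7;91;14;4];[::440;7;92;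
   32;8];[::530;10;52;51;26;24;14];[::553;2;110;0];[::532;1;117;28;26];[::542;4;118;68;27];[::607;
   3;91;86;27];[::610;4;94;91;28];[::660;10;110;108;48;34;30];[::338;5;62;59;57;9];[::333;3;57;10;
   0];[::432;7;102;45;25;15];[::437;5;116;62;48;32];[::522;9;121;85;37;35];[::542;0;105;100;50;36;
   24];[::542;3;81;0];[::321;8;51;42;38;0];[::518;8;43;39;1;0];[::558;8;70;58;47;42;23];[::628;4;
   122;89;83;35];[::640;10;124;121;49;46;42;32];[::410;8;61;47;46;45;43;5;4];[::407;8;133;48;46;44;
   6;0];[::410;3;90;89;8;7;1];[::542;6;132;119;115;96;59;48;34;9];[::558;0;140;129;126;114;113;98;
   30];[::447;3;125;117;116;112;103;99;62;61;50;48];[::520;0;70];[::522;0;69];[::522;4];[::533;2];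
   [::600;7];[::632;4];[::7;5;149];[::111;0;131];[::118;0;132;76];[::118;1;7;0];[::511;0;76;0];
   [::511;4;119;0];[::118;4;3;0];[::518;4;110;107;48;0];[::111;6;6;4];[::118;8;99;0];[::7;0;84;7;
   0];[::100;1;87;15;8;1];[::110;8;102;2];[::218;5;163;102];[::221;3;163];[::332;1;99;53];[::332;4;
   143;0];[::400;4;144;78;6];[::443;2;161];[::520;4;124];[::532;4;48];[::200;4;3;1];[::7;3;110;19;
   12;0];[::507;3;136;102;78;0];[::220;4;27;12];[::210;0;13;0];[::100;4;23;16;1];[::220;7;1];
   [::338;4;155;109];[::421;2;165;149];[::421;7;128;101];[::520;7;177;50];[::650;0;111;87;0];
   [::521;3;146;88];[::547;3;153;103;89];[::648;4;157;138];[::660;0;153;90];[::620;7;135;0];[::227;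
   3;187;16;13];[::333;4;120;119;62;61];[::333;0;120;73;63;0];[::433;2;1];[::421;4;156;142;138;27;
   8];[::433;0;75;64;63;1];[::543;2;172;0];[::433;4;112;77;3;1];[::438;4;174;113;2];[::432;3;143;
   103;100;84;83;64;3];[::527;3;165;161;103];[::527;10;146;104;68];[::532;6;102;101;78;29];[::322;
   9;90;70;0];[::327;8;196;137;130;110;62;0];[::632;1;200;151;112;108;53;2;1];[::630;10;110;107;99;
   0];[::633;3;108;92;91;38;3;1];[::663;3;191;189;168;167;1];[::632;6;183;94;65;57;6;5];[::537;3;
   141;113;37;4;0];[::337;3;191;165;142;141;116;114;111;103;82;38;5;1];[::437;3;184;183;179;143;
   142;129;128;112;104;92;39;6;2];[::600;0;51;43;39];[::200;7;0];[::320;10;160;108;31;11;5];[::322;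
   6;148;102;93;92;67;61;6];[::322;1;206;155;152;68;62;55;37;0];[::100;7;56;0];[::510;0;213;146;40;
   34;0];[::610;1;122;102;77;41;1;0];[::228;1;156;65;39;3];[::407;5;217;215;125;81];[::418;8;215;
   128;88;86];[::428;8;145;131;129;127;88;87;0];[::528;8;148;146;130;90;1];[::548;0;198;143;129;86;
   81];[::551;4;161;130;125;91;70];[::511;9;187;117;92;0];[::611;9;197;191;152;147;136;132;0];
   [::618;7;176;148;1];[::658;4;187;128;124;0];[::607;0;226;135;134;106];[::407;3;194;108;107;92;
   0];[::507;1;116;108;50;1;0];[::668;6;214;186;132;98;4];[::119;1;214;156;82;78;75];[::119;3;157;
   83;79;0];[::119;7;1;0];[::320;0;239;233;142;75;67;36;35;1];[::511;6;241;160;138;84;83;31;12;2;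
   1];[::631;3;209;164;160;159;148;144;142;12;11;0];[::110;1;94;87;60;20;4];[::118;7;25;5;4];
   [::618;0;162;85;0];[::211;6;246;223;91;87;80;79;78;63;59;7;6;2;0];[::110;0;168;119;91;51;24;8;
   0];[::210;7;246;184;69;2;0];[::100;6;121;95;86;85;78;69;31;28;10;8;1];[::7;7;87;31;0];[::507;0;
   240;177;153;75;0];[::218;7;7;6;3];[::227;10;249;187;72;38;3];[::307;8;174;158;111;49];[::311;10;
   224;172;168;145;140];[::327;5;248;189;182;157;51];[::307;5;251;239;159;51;0];[::427;4;223;204;
   197;123;122];[::510;7;252;204;185;161;74];[::630;3;163;160;144;143;53];[::640;0;224;215;120;119;
   75];[::420;7;255;208;156;0];[::507;7;208;189;165;60;0];[::557;0;197;166;87;61;7;1;0];[::557;2;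
   245;239;198;167;122;8;1;0];[::607;10;210;167;114;3];[::300;7;226;161;154;4;2];[::648;3;237;130;
   36;35;31];[::528;7;247;215;186;135;42];[::518;7;216;215;10;7;0];[::558;4;258;156;125;44;1];
   [::528;0;228;220;196;191;88;2];[::321;1;225;220;219;216;177;162;154;139;90;50;44;30;26;17;13;10;
   1];[::110;6;274;271;251;130;112;107;94;87;56;54;53;35;34;30;28;27;26;25;0];[::438;1;189;75;49;
   3];[::530;0;265;217;205;180;174;167;102;91;65;11];[::647;3;261;248;247;243;193;192;181;179];
   [::648;0;247;137;52;45;9;6];[::418;7;272;225;173;8;7;0];[::411;9;238;236;228;175;55;50;0];
   [::428;3;229;205;200;97;56;55;9;1;0];[::548;4;257;248;172;56;10;3];[::548;1;258;253;249;198;187;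
   57;11;7;0];[::7;6;226;222;157;113;109;66;45;33;32];[::300;10;263;177;170;100;95;79;22;20];
   [::530;2;241;212;193;188;163;112;75;9;0];[::330;0;279;273;260;190;181;179;170;80;70;22;1;0];
   [::330;2;280;279;275;268;182;181;165;20;0];[::400;7;176;24;2];[::627;10;284;234;99;27;25;3];
   [::637;2;191;168;83;33;24;0];[::647;2;276;273;257;243;34;25;14];[::327;10;271;252;187;180;90;89;
   82;28;6];[::300;3;273;247;236;232;131;123;88;55;26;9];[::531;2;268;224;199;195;194;192;186;179;
   158;121;87;84];[::337;0;288;282;269;199;190;188;179;166;103;89;83;7;2];[::331;4;281;272;271;270;
   265;206;203;200;199;180;179;167;156;90];[::431;3;279;264;212;193;177;165;114;99;73;26;18;17];
   [::432;0;270;265;245;215;213;201;189;173;166;164;163;100;98];[::643;2;179;168;167;101;93;0];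
   [::310;7;279;269;247;246;232;218;193;188;84;38;14];[::430;2;283;268;257;181;170;169;160;128;105;
   103;91;12;2];[::307;0;296;283;282;281;261;223;209;176;160;127;100;99;98;69;52;40;16;10];[::207;
   10;302;88;9];[::207;6;303;113;70;69;53;51;10;0];[::527;0;294;208;120;104;1;0];[::338;1;235;125;
   18];[::407;10;252;200;166;105;45;18;6];[::307;10;287;253;106;46;41;15];[::637;1;275;261;210;55;
   43;23;18;17;16;13;0];[::637;6;241;213;211;209;202;160;22;19;0];[::637;4;212;57;54;25;21;20;15;1;
   0];[::307;3;293;273;102;78;77;61;26;18;9;6;2;1;0];[::437;0;287;283;223;220;217;216;197;196;193;
   167;126;107;100;48;36;3;2;1;0];[::328;8;306;247;235;221;219;217;179;178];[::318;8;236;231;222;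
   218;178;177;111;40;0];[::527;1;310;198;125;63;58];[::638;6;268;267;218;201;173;10];[::638;1;292;
   269;268;215;181;48;11;0];[::338;0;306;248;150;138;115;31;12;1;0];[::438;0;235;233;231;121;45;42;
   37;4;1];[::638;0;295;271;184;133;90;89;85;53;51;1];[::328;7;301;269;254;215;119;112;2;0];[::318;
   7;317;295;283;255;235;209;53;7;3;1;0];[::538;4;291;223;204;193;192;126;118;4;3;2];[::311;9;296;
   212;208;204;96;83;66;63;46;1];[::310;3;313;308;306;288;287;282;270;266;260;259;258;231;229;216;
   214;213;212;199;183;147;71;55;52;41;40;20;2;0];[::318;9;298;286;206;194;124;117;91;72;57;56;44;
   20;9;8];[::518;9;183;171;138;102;101;92;59;58;57;46;13;5;0];[::311;2;320;317;310;297;286;227;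
   193;172;171;101;87;74;58;5;0];[::118;6;113;86;85;0];[::418;4;282;227;206;172;171;60;0];[::618;1;
   250;214;172;102;1;0];[::318;0;329;320;309;308;188;174;173;107;101;89;88;64;62;1;0];[::318;4;321;
   309;285;175;174;124;89;15;8;5;1;0];[::647;1;320;189;148;70;27;22;21;11];[::437;2;216;214;140;
   123;43;40;28;26;25;12;0];[::427;10;282;230;225;223;75;73;51;36;28;26;13;0];[::647;0;323;308;248;
   245;241;221;198;84;81;72;61;52;48;1;0];[::119;6;317;259;185;181;178;9];[::119;0;341;260;182;179;
   10;0];[::518;2;325;289;288;239;207;206;184;73;10;8;6];[::327;4;322;296;274;228;166;139;138;132;
   36;32;31;30];[::327;3;323;318;308;138;90;76;47;38;0];[::228;6;342;279;178;158;126;99;98;96;92;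
   71;63;14];[::628;1;290;242;115;73;64;0];[::528;1;335;295;242;218;212;122;120;116;100;94;75;74;
   67;1;0];[::328;4;327;301;291;279;233;137;66;27;25;21;18;1;0];[::218;6;346;285;182;162;104;103;
   102;100;96;17;16;15;2;1];[::327;1;341;305;291;281;275;257;254;243;242;235;165;133;85;84;64;56;
   53;44;43;37;5];[::119;2;351;270;192;189;112;111]]%N].

Definition back2 : seq (seq nat) :=
  [::[::6;4];[::9;2];[::11;4];[::13;3];[::16;2];[::18;3];[::21;4;0];[::24;9];[::28;24;10];[::34;
   31];[::43;41;39];[::45;12;18];[::48;34];[::50;7];[::52;12];[::54;13];[::57;14];[::59;57;15];
   [::61;45;12];[::63;50];[::67;65];[::69;6];[::71;67];[::73;50];[::76;54];[::78;0];[::80;16];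
   [::82;25];[::84;18];[::86;74];[::88;28];[::90;16];[::92;4];[::94;15];[::96;10];[::101;80];
   [::103;6];[::106;34];[::111;73];[::113;24];[::115;105];[::117;76];[::124;70];[::126;40];[::128;
   109];[::130;27];[::133;111];[::135;0];[::138;24];[::140;13];[::142;139];[::144;52];[::147;117];
   [::149;133];[::151;119];[::153;34];[::155;61];[::158;27];[::162;135];[::166;61];[::168;165];
   [::175;82];[::177;143];[::181;33];[::184;145];[::188;14];[::190;63];[::192;147];[::194;148];
   [::196;149];[::198;17];[::200;176];[::204;149];[::207;186];[::209;27];[::212;177];[::224;217];
   [::226;166];[::228;79];[::234;54];[::236;8];[::238;56];[::241;145];[::243;4];[::246;173];[::248;
   82];[::250;172];[::252;15];[::255;41];[::257;169];[::259;18];[::261;154];[::263;225];[::267;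
   206];[::271;207];[::273;236];[::275;2];[::277;72];[::279;211];[::281;246];[::283;247];[::285;
   13];[::287;208];[::289;42];[::291;217];[::293;218];[::296;219];[::303;220];[::305;221];[::307;
   298];[::309;255];[::311;200];[::313;175];[::315;5];[::317;6];[::319;10];[::374;370];[::376;70];
   [::378;12];[::380;2];[::387;376];[::389;375];[::394;5];[::396;15];[::398;7];[::400;20];[::402;
   397];[::404;383];[::406;382];[::408;192];[::411;386];[::413;385];[::415;369];[::417;389];[::419;
   388];[::421;268];[::423;28];[::425;243];[::427;327];[::429;241];[::434;41]]%N.

Definition final2 : seq (seq nat) := [seq [:: i] | i <-
  [::22;35;0;46;42;330;104;243;31;1;65;271;349;313;365;80;165;82;272;68;218;412;336;334;470;493;
   162;32;34;253;254;25;15;44;36;47;491;252;492;277;314;60;50;69;53;39;490;219;38;37;244;3;17;26;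
   27;4;33;489;67;274;2;48;5;186;105;206;205;287;96;66;131;250;87;114;382;163;168;282;40;8;288;64;
   58;204;41;363;11;373;299;362;421;433;455;432;456;351;118;117;70;106;92;441;212;388;449;14;115;
   51;71;213;221;358;367;440;436;292;439;357;116;171;61;372;59;361;360;294;407;488;469;483;465;450;
   43;404;354;371;406;482;434;12;100;94;13;23;52;75;381;335;112;390;356;90;481;445;395;368;486;397;
   359;45;370;9;28;392;10;384;391;468;459;19;295;464;20;463;383;479;480;446;467;6;369;380;7;379;
   378;307;447;457;394;91;230;398;29;56;262;460;454;478;251;411;16;263;410;374;476;453;487;30;438;
   24;302;437;286;285;393;284;377;396;376;466;352;474;477;192;461;21;375;462;448;485;348;387;484;
   386;385;364;473;472;475;283;452;18;451;471]%N].

Definition letter_tables (T TV : seq (seq N)) : seq (seq N) :=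
  [seq word_mx T TV (tword w) | w <- letters].

Definition pc_rules := take 28 rules.

Definition letter_word (w : seq nat) : gword todd_gen :=
  tword (flatten [seq nth [::] letters k | k <- w]).

Fixpoint subwords (s : seq nat) : seq (seq nat) :=
  if s is k :: s' then subwords s' ++ [seq k :: w | w <- subwords s'] else [:: [::]].

(** The collected words of the power-conjugate presentation: increasing and without repetition, 2 ^
    7 in number. *)
Definition normal_words := subwords (iota 0 7).

Lemma rules_true :
  all (fun r => rho1_eq (letter_word [:: r.1.1; r.1.2]) (letter_word r.2)) rules.
Proof. by vm_compute. Qed.

(* The first seven letters generate a Sylow 2-subgroup; pc_rules is a power-conjugate
   presentation of it. *)
Lemma pc_closed :
  all (fun w => all (fun k => (reduce pc_rules 60 (rcons w k)).2 \in normal_words)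
    (iota 0 7)) normal_words.
Proof. by vm_compute. Qed.

Definition letters_mx (Ls : seq (seq N)) (w : seq nat) : seq N :=
  foldr (fun k A => mmul (nth idN Ls k) A) idN w.

(** Exactly the bits read by [mxN], so that distinct lists certify distinct matrices. *)
Definition mx_bits (A : seq N) : seq (seq bool) :=
  [seq [seq N.testbit (nth 0%num A i) (N.of_nat k) | k <- iota 0 11] | i <- iota 0 11].

Definition normal_words_uniq T TV : bool :=
  uniq [seq mx_bits (letters_mx (letter_tables T TV) w) | w <- normal_words].

Definition cohomology_ok T TV keep gauge elim back final exc : bool :=
  let Ls := letter_tables T TV in
  [&& normal_words_uniq T TV, gauge_ok rules Ls keep gauge
    & elim_ok rules keep [seq trmxN A | A <- Ls] elim back final 28 exc].

(** Coordinate 5 of tail 6 is the one left free; it accounts for the one-dimensional H^2 of V_1. *)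
Lemma cohomology1_ok :
  cohomology_ok rho1N rho1VN keep1 gauge1 elim1 back1 final1 (6, 5)%N.
Proof. by vm_compute. Qed.

(** Rule 28 lies beyond the power-conjugate rules 0 to 27, so here no coordinate is exempted. *)
Lemma cohomology2_ok :
  cohomology_ok rho2N rho2VN keep2 gauge2 elim2 back2 final2 (28, 0)%N.
Proof. by vm_compute. Qed.

(** * Second cohomology of M_23 *)

Section SecondCohomologyM23.

Local Open Scope ring_scope.

Variables (gT : finGroupType) (M : {group gT}) (x : todd_gen -> gT).
Hypotheses (M_simple : simple M)
           (M_pres : presents M x (todd_relators (@wgen todd_gen))).
Hypothesis M_order : #|M| = (2 ^ 7 * 3 ^ 2 * 5 * 7 * 11 * 23)%N.
Variables (T TV : seq (seq N)) (rG : mx_representation 'F_2 M 11).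
Hypotheses (Tok : table_ok T TV) (rGx : forall s, rG (x s) = mxN (nth [::] T s)).

Local Notation H := (subg_of M).
Local Notation V := 'rV['F_2]_11.

Definition mlet (k : nat) : H := subg M (word_eval x (tword (nth [::] letters k))).

Lemma wprod_mlet w : wprod mlet w = subg M (word_eval x (letter_word w)).
Proof.
have Mx u : word_eval x u \in M by apply: word_eval_in => s; apply: presents_gen M_pres.
elim: w => [|k w IH]; apply: subg_inj.
  by rewrite /wprod big_nil subgK ?Mx // word_eval1.
rewrite wprod_cons IH /= !subgK ?Mx // -word_evalM; congr (word_eval x _).
by rewrite /letter_word /tword /= map_cat.
Qed.

Lemma rules_ok i : (i < size rules)%N ->
  wprod mlet [:: (rule rules i).1.1; (rule rules i).1.2] = wprod mlet (rule rules i).2.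
Proof.
move=> lt_i; rewrite !wprod_mlet; congr subg.
by apply: (rho1_eq_eval M_simple M_pres); apply: (allP rules_true); apply: mem_nth.
Qed.

Lemma pc_rule i : (i < 28)%N -> rule pc_rules i = rule rules i.
Proof. by move=> lt_i; rewrite /rule nth_take. Qed.

Lemma pc_rules_ok i : (i < size pc_rules)%N ->
  wprod mlet [:: (rule pc_rules i).1.1; (rule pc_rules i).1.2]
  = wprod mlet (rule pc_rules i).2.
Proof. by move=> lt_i; rewrite pc_rule //; apply: rules_ok; apply: leq_trans lt_i _. Qed.

Let Ls := letter_tables T TV.

Lemma Ls_ok k : size (nth idN Ls k) = 11%N /\ rG (sgval (mlet k)) = mxN (nth idN Ls k).
Proof.
have -> : nth idN Ls k = word_mx T TV (tword (nth [::] letters k)).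
  have [lt_k|ge_k] := ltnP k (size letters); first by rewrite (nth_map [::]).
  by rewrite !nth_default ?size_map.
split; first exact: size_word_mx Tok _.
rewrite subgK ?(table_repr_word M_pres _ Tok) //.
by apply: word_eval_in => s; apply: presents_gen M_pres.
Qed.

Lemma letters_mxP w : size (letters_mx Ls w) = 11%N /\
  rG (sgval (wprod mlet w)) = mxN (letters_mx Ls w).
Proof.
elim: w => [|k w [sw IH]] /=; first by rewrite /wprod big_nil mxN_id repr_mx1.
have [sk Dk] := Ls_ok k; rewrite size_mmul; split=> //.
by rewrite wprod_cons [LHS]actM Dk IH mxN_mmul.
Qed.

Lemma uniq_map_factor (A : Type) (B C : eqType) (F : A -> B) (D : A -> C) s :
  (forall a b, F a = F b -> D a = D b) -> uniq (map D s) -> uniq (map F s).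
Proof.
move=> FD; elim: s => [|a s IH] //= /andP[Da /IH->]; rewrite andbT.
apply: contra Da; elim: s {IH} => [|b s IH] //=; rewrite !in_cons.
by case/orP=> [/eqP/FD/eqP->|/IH->]; rewrite ?orbT.
Qed.

Lemma mx_bits_inj A B : mxN A = mxN B -> mx_bits A = mx_bits B.
Proof.
move=> AB; apply/eq_in_map => i; rewrite mem_iota => /andP[_ lt_i].
apply/eq_in_map => k; rewrite mem_iota => /andP[_ lt_k].
have /matrixP/(_ (Ordinal lt_i) (Ordinal lt_k)) := AB; rewrite !mxE /bitF /=.
by case: N.testbit; case: N.testbit.
Qed.

Variables (keep : seq N) (gauge : seq (nat * nat * seq (nat * N))).
Variables (elim : seq (nat * nat * nat * nat * seq nat)) (back final : seq (seq nat)).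
Variable exc : nat * nat.
Hypothesis cert : cohomology_ok T TV keep gauge elim back final exc.

(** With zero tails the lifts of the seven letters satisfy the power-conjugate relations, so they
    generate a complement [Y] to [K] in the preimage of a Sylow 2-subgroup. This preimage has odd
    index and [K] is an abelian 2-group, so Gaschutz's theorem yields a complement in the whole
    extension. *)
Lemma pc_tails_coboundary f (Zf : f \in cocycles2 rG) g :
  (forall i, (i < 28)%N -> tail rG mlet rules f g i = 0) -> f \in coboundaries2 rG.
Proof.
move=> t0; apply: (@cext_splits _ _ _ _ rG f Zf).
set K := 'ker _; have ext := cext_is_extension Zf.
pose y (k : 'I_7) := clift mlet Zf g k.
pose Y := <<[set y k | k : 'I_7]>>%G.
(* Every tail that this reduction can pick up is 0, so it preserves the product of lifts exactly. *)
have red w : cprod mlet Zf g w = cprod mlet Zf g (reduce pc_rules 60 w).2.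
  have := reduceP pc_rules_ok Zf g 60 w; case: (reduce _ _ _) => st u [_ /allP lt_st ->].
  rewrite /step_sum big_seq big1 => [|p p_st].
    by rewrite [X in (_ * X)%g](morph1 (cext_iota_morphism Zf)) mulg1.
  have lt28 := lt_st p p_st; have := t0 p.1 lt28.
  by rewrite /tail (pc_rule lt28) => ->; rewrite mul0mx.
pose NW := [seq cprod mlet Zf g w | w <- normal_words].
have sYN : {subset Y <= NW}.
  move=> e /gen_prodgP[n [c cY ->]]; elim: n c cY => [|n IH] c cY.
    by rewrite big_ord0; apply/mapP; exists [::]; rewrite // /cprod big_nil.
  rewrite big_ord_recr /=; have /mapP[w w_in ->] := IH _ (fun i => cY (widen_ord (leqnSn n) i)).
  have /imsetP[k _ ->] := cY ord_max.
  have -> : (cprod mlet Zf g w * y k)%g = cprod mlet Zf g (rcons w k).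
    by rewrite -cats1 cprod_cat /cprod big_seq1.
  rewrite red; apply: (map_f (cprod mlet Zf g)).
  exact: (all_iotaP (allP pc_closed w w_in) k).
(* By [pc_closed] the products along collected words are closed under right multiplication by the
   generators, so they exhaust [Y]. *)
have leY : (#|Y| <= 128)%N.
  have -> : 128%N = size NW by rewrite size_map.
  move: NW sYN => NW' sYN; apply: leq_trans (card_size NW').
  by apply/subset_leq_card/subsetP; exact: sYN.
pose pi := cext_pi_morphism Zf.
have yY k : y k \in Y by apply: mem_gen; apply: imset_f.
have yw w : w \in normal_words -> cprod mlet Zf g w \in Y.
  have lt7 : all (all (fun k => k < 7)%N) normal_words by [].
  move=> /(allP lt7); elim: w => [|k w IH] /=; first by rewrite /cprod big_nil group1.
  case/andP=> lt_k /IH Yw; rewrite /cprod big_cons groupM //.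
  exact: (yY (Ordinal lt_k)).
(* The images of the collected words in M_23 are distinct because their matrices are. *)
have piY : (128 <= #|pi @* Y|)%N.
  pose ws := [seq pi (cprod mlet Zf g w) | w <- normal_words].
  have <- : #|ws| = 128%N.
    rewrite (card_uniqP _) ?size_map //; have /and3P[uniq_normal _ _] := cert.
    apply: uniq_map_factor uniq_normal => v w.
    rewrite !cprodE => E; apply: mx_bits_inj.
    by rewrite -(letters_mxP v).2 -(letters_mxP w).2; congr (rG _).
  apply/subset_leq_card/subsetP=> _ /mapP[w w_in ->].
  by apply: mem_morphim; rewrite ?inE ?yw.
have cpi (A : {group cext_of Zf}) : #|pi @* A| = #|A : K|.
  by rewrite card_morphim setTI.
(* The two bounds 128 meet in Lagrange's formula. *)
have cardYK : #|Y :&: K| = 1%N.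
  have := LagrangeI Y K; rewrite -cpi => cY.
  have Y0 : (0 < #|pi @* Y|)%N := leq_trans (isT : 0 < 128)%N piY.
  apply/eqP; rewrite eqn_leq cardG_gt0 andbT -(leq_pmul2r Y0) cY mul1n.
  exact: leq_trans leY piY.
have tiKY : K :&: Y = 1%g by have := cardYK; rewrite setIC => /card1_trivg.
have cY : #|Y| = 128%N.
  have := LagrangeI Y K; rewrite cardYK mul1n -cpi => cY.
  by apply/eqP; rewrite eqn_leq leY -cY.
have [injI imI piM _] := ext.
have nKT : K <| [set: cext_of Zf] := ker_normal _.
have nKY : Y \subset 'N(K) := subset_trans (subsetT _) (normal_norm nKT).
pose P := (K <*> Y)%G.
have DP : P = (K * Y)%g :> {set _} by rewrite /= norm_joinEr.
have abK : abelian K.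
  rewrite /K -imI morphim_abelian //; apply/centsP=> u _ v _.
  exact: addrC.
have cK : #|K| = (2 ^ 11)%N.
  by rewrite /K -imI card_injm // cardsT card_mx card_Fp.
have cP : #|P| = (#|K| * 128)%N by rewrite DP TI_cardMg // cY.
have cT : #|[set: cext_of Zf]| = (#|K| * #|M|)%N.
  by rewrite -piM (cpi [group of setT]) Lagrange ?subsetT.
have idx : #|[set: cext_of Zf] : P| = (3 ^ 2 * 5 * 7 * 11 * 23)%N.
  have e7 : (2 ^ 7 = 128)%N by [].
  have K128 : (0 < #|K| * 128)%N by rewrite muln_gt0 cardG_gt0.
  apply/eqP; rewrite -(eqn_pmul2l K128) -cP Lagrange ?subsetT // cT M_order.
  by rewrite cP -e7 !mulnA.
have co : coprime #|K| #|[set: cext_of Zf] : P|.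
  by rewrite cK idx coprimeXl // coprime2n !oddM !oddX.
rewrite (@Gaschutz_split _ [set: cext_of Zf]%G [group of K] P) ?subsetT ?joing_subl //.
by apply/splitsP; exists Y; apply/complP; split; last exact/esym.
Qed.

Lemma normalised_tails f : f \in cocycles2 rG -> exists g, forall i (r : 'I_11),
  (i < 28)%N -> (i, nat_of_ord r) != exc -> tail rG mlet rules f g i 0 r = 0.
Proof.
move=> Zf; have /and3P[_ gok eok] := cert.
have [g masked] := gauge_sound Ls_ok f gok.
by exists g; apply: (elim_sound rules_ok Ls_ok Zf masked eok).
Qed.

(* All the normalised tails vanish except possibly the bit exc, so the difference of
   two cocycles for which this bit is 1 has zero tails. *)
Lemma cocycle_dichotomy f f0 : f \in cocycles2 rG -> f0 \in cocycles2 rG ->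
  [\/ f \in coboundaries2 rG, f0 \in coboundaries2 rG | f - f0 \in coboundaries2 rG].
Proof.
move=> Zf Zf0.
have [g tg] := normalised_tails Zf; have [g0 tg0] := normalised_tails Zf0.
pose e := tail rG mlet rules f g exc.1 0 (inord exc.2).
pose e0 := tail rG mlet rules f0 g0 exc.1 0 (inord exc.2).
have zero h gh : (forall i (r : 'I_11), (i < 28)%N -> (i, nat_of_ord r) != exc ->
      tail rG mlet rules h gh i 0 r = 0) -> tail rG mlet rules h gh exc.1 0 (inord exc.2) = 0 ->
    forall i, (i < 28)%N -> tail rG mlet rules h gh i = 0.
  move=> th eh i lt_i; apply/rowP=> r; rewrite [RHS]mxE.
  have [Dexc|/th] := eqVneq (i, nat_of_ord r) exc; last exact.
  by move: eh; rewrite -Dexc /= inord_val.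
have [e_0|e_1] := F2_01 e.
  by constructor 1; apply: (pc_tails_coboundary Zf); apply: zero e_0.
have [e0_0|e0_1] := F2_01 e0.
  by constructor 2; apply: (pc_tails_coboundary Zf0); apply: zero e0_0.
constructor 3; have Zd : f - f0 \in cocycles2 rG by rewrite memvB.
have td i : tail rG mlet rules (f - f0) (fun k => g k - g0 k) i
    = tail rG mlet rules f g i - tail rG mlet rules f0 g0 i.
  apply/(addIr (tail rG mlet rules f0 g0 i)); rewrite subrK -tailD subrK.
  by apply: tail_eq => k; rewrite subrK.
apply: (pc_tails_coboundary Zd (g := fun k => g k - g0 k)); apply: zero => [i r lt_i ne|].
  by rewrite td mxE [X in _ + X]mxE tg // tg0 // subrr.
by rewrite td mxE [X in _ + X]mxE -/e -/e0 e_1 e0_1 subrr.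
Qed.

(** The exceptional coordinate is not in a power-conjugate tail, so all these tails vanish. *)
Lemma no_cohomology f : (28 <= exc.1)%N -> f \in cocycles2 rG -> f \in coboundaries2 rG.
Proof.
move=> ge28 Zf; have [g tg] := normalised_tails Zf.
apply: (pc_tails_coboundary Zf) => i lt_i; apply/rowP=> r; rewrite [RHS]mxE.
apply: tg => //; apply: contraTneq lt_i => Dexc.
by rewrite -leqNgt -[i]/(i, nat_of_ord r).1 Dexc.
Qed.

End SecondCohomologyM23.

(** * Quadratic forms on the second module *)

Definition rho2Q : seq (seq N) :=
  [:: [:: 0; 0; 0; 0; 0; 0; 0; 0; 0; 512; 0]%num;
      [:: 0; 0; 0; 0; 0; 512; 0; 512; 512; 512; 0]%num;
      [:: 0; 0; 0; 0; 0; 672; 0; 1024; 512; 0; 1024]%num;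
      [:: 1312; 1312; 1312; 0; 1312; 1312; 0; 1024; 1792; 512; 1024]%num;
      [:: 1623; 1888; 452; 1568; 720; 0; 1024; 1536; 1024; 0; 0]%num;
      [:: 320; 444; 1908; 1592; 272; 256; 320; 384; 256; 0; 0]%num;
      [:: 1312; 1312; 4; 8; 1312; 832; 1280; 0; 1536; 1536; 0]%num;
      [:: 580; 1092; 1396; 1568; 608; 1728; 1792; 0; 1024; 512; 1024]%num;
      [:: 160; 160; 36; 0; 48; 1952; 0; 256; 1536; 0; 0]%num].

(** Each entry consists of a word trivial in M_23, a functional, and the vector t to which the word
    evaluates on the chosen lifts. Every such word gives a linear equation, with constant t, for the
    corrections that would turn the lifts into generators of a complement. Summed with these
    functionals, the unknowns cancel and the constants add up to 1. *)
Definition nonsplit_form : seq (seq nat * N * N) :=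
  [:: ([:: 8; 5; 8; 5]%N, 16%num, 1925%num);
      ([:: 5; 0; 5; 0; 5; 0]%N, 529%num, 1536%num);
      ([:: 5; 4; 5; 4]%N, 32%num, 1669%num);
      ([:: 7; 3; 7; 3; 2; 1]%N, 914%num, 0%num);
      ([:: 8; 0; 8; 2; 1; 0]%N, 896%num, 0%num);
      ([:: 8; 4; 8; 4]%N, 8%num, 0%num)].

Section QuadraticPermutations.

Local Open Scope ring_scope.

Local Notation V := 'rV['F_2]_11.
Local Notation D := ('F_2 * 'rV['F_2]_11)%type.

Definition is_quad (p : {perm D}) (q : V -> 'F_2) (A : 'M['F_2]_11) : Prop :=
  forall d, p d = (d.1 + q d.2, d.2 *m A).

Lemma is_quad1 : is_quad 1%g (fun=> 0) 1%:M.
Proof. by case=> b w; rewrite perm1 addr0 mulmx1. Qed.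

Lemma is_quadM p q A p' q' A' : is_quad p q A -> is_quad p' q' A' ->
  is_quad (p * p')%g (fun w => q w + q' (w *m A)) (A *m A').
Proof. by move=> Hp Hp' d; rewrite permM Hp Hp' /= mulmxA addrA. Qed.

Lemma is_quadV p q A : A \in unitmx -> is_quad p q A ->
  is_quad p^-1%g (fun w => q (w *m invmx A)) (invmx A).
Proof.
move=> uA Hp [b w]; apply: (@perm_inj _ p); rewrite permKV Hp /=.
by rewrite -addrA F2_sqr addr0 mulmxKV.
Qed.

Lemma is_quad_eq p q A p' q' : is_quad p q A -> is_quad p' q' A -> q =1 q' -> p = p'.
Proof. by move=> Hp Hp' qq'; apply/permP=> d; rewrite Hp Hp' qq'. Qed.

Lemma qperm_inj (q : V -> 'F_2) (A : 'M['F_2]_11) : A \in unitmx ->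
  injective (fun d : D => (d.1 + q d.2, d.2 *m A)).
Proof.
move=> uA [b w] [b' w'] /= E.
have /(can_inj (mulmxK uA)) Dw : w *m A = w' *m A := congr1 snd E.
have Db : b + q w = b' + q w' := congr1 fst E.
by move: Db; rewrite Dw => /addIr ->.
Qed.

Definition qperm q A (uA : A \in unitmx) : {perm D} := perm (qperm_inj (q := q) uA).

Lemma is_quad_qperm q A (uA : A \in unitmx) : is_quad (qperm q uA) q A.
Proof. by move=> d; rewrite permE. Qed.

Definition dotp (v w : V) : 'F_2 := (w *m v^T) 0 0.

Definition tau (v : V) : {perm D} := qperm (dotp v) (unitmx1 _ _).

Lemma is_quad_tau v : is_quad (tau v) (dotp v) 1%:M.
Proof. exact: is_quad_qperm. Qed.

Lemma dotpDl u v w : dotp (u + v) w = dotp u w + dotp v w.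
Proof. by rewrite /dotp linearD /= mulmxDr mxE. Qed.

Lemma tauM u v : tau (u + v) = (tau u * tau v)%g.
Proof.
have H := is_quadM (is_quad_tau u) (is_quad_tau v); rewrite mulmx1 in H.
by apply: is_quad_eq (is_quad_tau _) H _ => w; rewrite dotpDl mulmx1.
Qed.

Lemma tau_inj : injective tau.
Proof.
move=> u v uv; apply/rowP=> i; have /permP/(_ (0, delta_mx 0 i)) := uv.
rewrite !is_quad_tau /= !add0r => -[]; rewrite /dotp.
by rewrite -!rowE !mxE.
Qed.

(** The tables in [rho2Q] are upper triangular: entry (i, j) is the coefficient of w_i w_j. Matrices
    of composed forms need not stay triangular. *)
Definition quad (Q : seq N) (w : V) : 'F_2 := (w *m mxN Q *m w^T) 0 0.

Definition mxxor (A B : seq N) : seq N := [seq N.lxor p.1 p.2 | p <- zip A B].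

Lemma mxN_xor A B : size A = 11%N -> size B = 11%N ->
  mxN (mxxor A B) = mxN A + mxN B.
Proof.
move=> sA sB; apply/matrixP=> i j; rewrite !mxE.
by rewrite (nth_map (0%num, 0%num)) ?size_zip ?sA ?sB // nth_zip ?sA ?sB //= bitF_xor.
Qed.

Lemma size_mxxor A B : size A = 11%N -> size B = 11%N -> size (mxxor A B) = 11%N.
Proof. by move=> sA sB; rewrite size_map size_zip sA sB. Qed.

Definition qsubst (A Q : seq N) : seq N := mmul A (mmul Q (trmxN A)).

Lemma quad_subst A Q w : size A = 11%N -> size Q = 11%N ->
  quad Q (w *m mxN A) = quad (qsubst A Q) w.
Proof.
move=> sA sQ; rewrite /quad mxN_mmul ?size_mmul // mxN_mmul ?size_trmxN // mxN_tr.
by rewrite trmx_mul !mulmxA.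
Qed.

Definition qletter (s : nat) (b : bool) : seq N :=
  if b then qsubst (nth [::] rho2VN s) (nth [::] rho2Q s) else nth [::] rho2Q s.

(** The quadratic part obeys the rule of [is_quadM]: the form of the remaining word is evaluated
    after the linear part of the first letter. *)
Definition qword (w : gword todd_gen) : seq N * seq N :=
  foldr (fun (l : todd_gen * bool) QA =>
    let A := letter rho2N rho2VN l.1 l.2 in
    (mxxor (qletter l.1 l.2) (qsubst A QA.1), mmul A QA.2)) (nseq 11 0%num, idN) w.

Lemma size_rho2Q (s : todd_gen) : size (nth [::] rho2Q s) = 11%N.
Proof.
have H : all (fun s => size (nth [::] rho2Q s) == 11%N) (iota 0 9) by [].
by apply/eqP; apply: (all_iotaP H s).
Qed.

Definition pgen (s : todd_gen) : {perm D} :=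
  qperm (quad (nth [::] rho2Q s)) (table_unit rho2_ok s).

Lemma is_quad_pgen (s : todd_gen) b :
  is_quad (if b then (pgen s)^-1%g else pgen s) (quad (qletter s b))
    (mxN (letter rho2N rho2VN s b)).
Proof.
have H := is_quad_qperm (quad (nth [::] rho2Q s)) (table_unit rho2_ok s).
rewrite /letter /qletter; case: b => //.
have := is_quadV (table_unit rho2_ok s) H; rewrite (table_invmx rho2_ok) => HV d.
rewrite HV; congr (_ + _, _); apply: quad_subst (size_rho2Q s).
exact: (table_size rho2_ok s true).
Qed.

Lemma qwordP w : [/\ size (qword w).1 = 11%N, size (qword w).2 = 11%N
  & is_quad (word_eval pgen w) (quad (qword w).1) (mxN (qword w).2)].
Proof.
elim: w => [|[s b] w [s1 s2 IH]].
  split=> //; rewrite word_eval1 mxN_id => d; rewrite is_quad1; congr (_ + _, _).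
  rewrite /quad (_ : mxN _ = 0) ?mulmx0 ?mul0mx ?mxE //.
  by apply/matrixP=> i j; rewrite !mxE nth_nseq; case: ifP; rewrite bitF0.
have sA : size (letter rho2N rho2VN s b) = 11%N := table_size rho2_ok s b.
have sq : size (qletter s b) = 11%N.
  rewrite /qletter; case: (b); last exact: size_rho2Q.
  by rewrite size_mmul; apply: (table_size rho2_ok s true).
have sS : size (qsubst (letter rho2N rho2VN s b) (qword w).1) = 11%N by rewrite size_mmul.
split; [exact: size_mxxor | by rewrite size_mmul |].
rewrite word_eval_cons => d.
rewrite (is_quadM (is_quad_pgen s b) IH) -mxN_mmul //; congr (_ + _, _).
rewrite quad_subst // -[(qword ((s, b) :: w)).1]/(mxxor (qletter s b)
  (qsubst (letter rho2N rho2VN s b) (qword w).1)).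
by rewrite /quad mxN_xor // mulmxDr mulmxDl [RHS]mxE.
Qed.

(** For a matrix that is not normalised, symmetry is the test that its form is linear; the diagonal
    then gives the linear form. *)
Definition sym_diag (Q : seq N) (t : N) : bool :=
  all (fun i => all (fun j => N.testbit (nth 0%num Q i) (N.of_nat j) ==
      (if i == j then N.testbit t (N.of_nat i) else N.testbit (nth 0%num Q j) (N.of_nat i)))
    (iota 0 11)) (iota 0 11).

Definition qrel_ok (w : gword todd_gen) (t : N) : bool :=
  all2 N.eqb (qword w).2 idN && sym_diag (qword w).1 t.

(* A quadratic form with symmetric matrix is the square of a linear form, hence equal
   to it over F_2. *)
Lemma quad_sym (Q : 'M['F_2]_11) (t w : V) :
  (forall i j, Q i j = if i == j then t 0 i else Q j i) ->
  (w *m Q *m w^T) 0 0 = dotp t w.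
Proof.
move=> symQ; pose U : 'M['F_2]_11 := \matrix_(i, j) if (i < j)%N then Q i j else 0.
have DQ : Q = diag_mx t + U + U^T.
  apply/matrixP=> i j; rewrite !mxE.
  case: (ltngtP i j) => [ij|ji|/val_inj ij].
  - by rewrite -val_eqE (ltn_eqF ij) mulr0n add0r addr0.
  - by rewrite -val_eqE (gtn_eqF ji) mulr0n !add0r symQ -val_eqE (gtn_eqF ji).
  - by rewrite ij eqxx mulr1n !addr0 symQ eqxx.
rewrite DQ !mulmxDr !mulmxDl [LHS]mxE [X in X + _]mxE.
have -> : (w *m U^T *m w^T) 0 0 = (w *m U *m w^T) 0 0.
  have -> : w *m U^T *m w^T = (w *m U *m w^T)^T by rewrite !trmx_mul trmxK mulmxA.
  by rewrite mxE.
rewrite -addrA [X in _ + X]F2_sqr addr0 /dotp mul_mx_diag !mxE.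
apply: eq_bigr => i _; rewrite !mxE.
by have [->|->] := F2_01 (w 0 i); rewrite ?mul0r ?mulr0 ?mul1r ?mulr1.
Qed.

Lemma qrelP w t : qrel_ok w t -> word_eval pgen w = tau (rvN t).
Proof.
have [_ _ Hw] := qwordP w; case/andP=> /all2_Neqb DA symQ; rewrite DA mxN_id in Hw.
apply: is_quad_eq Hw (is_quad_tau _) _ => v; apply: quad_sym => i j; rewrite !mxE /bitF.
rewrite (eqP (all_iotaP (all_iotaP symQ i) j)) -val_eqE.
by case: (val i == val j).
Qed.

End QuadraticPermutations.

(** * Relators of the non-split extension and their tails *)

Section ModuleRelators.

Variables (eT : finGroupType) (rho : todd_gen -> 'M['F_2]_11).
Variables (y : ext_gen -> eT) (iota : {morphism [set: 'rV['F_2]_11] >-> eT}).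
Hypothesis y_v : forall r, y (inr r) = iota (delta_mx 0%R r).

Lemma iotaD u v : iota (u + v)%R = iota u * iota v.
Proof. by apply: morphM; rewrite in_setT. Qed.

Lemma iota_sqr v : iota v * iota v = 1.
Proof.
rewrite -iotaD (_ : (v + v)%R = 1) ?morph1 //.
by apply/rowP=> k; rewrite mxE F2_sqr mxE.
Qed.

Lemma module_relators_hold r :
  (forall s v, iota v * y (inl s) = y (inl s) * iota (v *m rho s)%R) ->
  r \in module_relators rho -> word_eval y r = 1.
Proof.
move=> yJ; rewrite !mem_cat => /or3P[/imageP[k _ ->]|/allpairsP[[k l] [_ _ ->]]|].
- by rewrite word_evalX word_eval_gen y_v expgS expg1 iota_sqr.
- rewrite word_evalR !word_eval_gen !y_v; apply/eqP/commgP.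
  by rewrite /commute -!iotaD addrC.
case/allpairsP=> -[s k] [_ _ ->] /=.
have -> : \prod_(l < 11) vgen l ^+ nat_of_ord (rho s k l) = vw (row k (rho s)).
  by apply: eq_bigr => l _; rewrite mxE.
rewrite !word_evalM !word_evalV (word_eval_vw y_v) !word_eval_gen y_v.
by rewrite -(mulgA _ (iota _)) yJ mulKg -rowE mulgV.
Qed.

Lemma word_eval_lift w : word_eval y (wlift w) = word_eval (fun s => y (inl s)) w.
Proof. by rewrite /word_eval big_map. Qed.

End ModuleRelators.

(* The relators of nonsplit_relators other than the module relators, as a word in the
   lifted generators and the index list of its tail. *)
Definition twisted_relators : seq (gword todd_gen * seq nat) :=
  let a := wgen (@Ordinal 9 0 isT) in let b := wgen (@Ordinal 9 1 isT) in
  let c := wgen (@Ordinal 9 2 isT) in let d := wgen (@Ordinal 9 3 isT) in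
  let t := wgen (@Ordinal 9 4 isT) in let g := wgen (@Ordinal 9 5 isT) in
  let h := wgen (@Ordinal 9 6 isT) in let i := wgen (@Ordinal 9 7 isT) in
  let j := wgen (@Ordinal 9 8 isT) in
  [seq (r, [::]) | r <- [:: a ^+ 2; b ^+ 2; c ^+ 2; d ^+ 2; t ^+ 3; g ^+ 4; h ^+ 4;
      i ^+ 2; j ^+ 2; [~ b, a]; [~ c, a]; [~ d, a]; [~ h, a]; [~ c, b]; [~ d, b];
      [~ d, c]; [~ j, b]; [~ j, c]; [~ j, g]]] ++
  [:: (t^-1 * a * t * d^-1 * c^-1, [:: 6; 9]%N);
      (t^-1 * b * t * d^-1 * a^-1, [:: 6; 9]%N);
      (t^-1 * c * t * d^-1 * b^-1, [:: 6; 9]%N);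
      (t^-1 * d * t * c^-1 * b^-1 * a^-1, [:: 1; 2; 3; 5; 9]%N);
      (g ^+ 2, [:: 1; 3; 8; 9; 10; 11]%N);
      ((g * a) ^+ 3, [:: 10; 11]%N);
      ((g * b) ^+ 3, [:: 1; 2; 3; 5; 6; 9]%N);
      ((g * c) ^+ 3, [::]);
      ((i * j) ^+ 3, [::]);
      ((g * t) ^+ 2, [:: 1; 3; 8; 10; 11]%N);
      (h ^+ 2, [:: 6]%N);
      (h^-1 * b * h * d^-1 * b^-1 * a^-1, [:: 1; 2; 3; 5]%N);
      (h^-1 * c * h * c^-1 * a^-1, [:: 1; 2; 3; 5; 6; 9]%N);
      (h^-1 * d * h * d^-1, [:: 6]%N);
      (h^-1 * t * h * t, [:: 9]%N);
      ((g * h) ^+ 3, [:: 3; 7; 9; 10; 11]%N);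
      (i^-1 * a * i * d^-1 * c^-1, [:: 1; 2; 3; 5; 6; 9; 10; 11]%N);
      (i^-1 * b * i * d^-1 * a^-1, [:: 1; 2; 3; 5; 6; 9; 10; 11]%N);
      (i^-1 * c * i * d^-1 * c^-1 * b^-1 * a^-1, [:: 1; 2; 3; 5; 6; 9; 10; 11]%N);
      (i^-1 * d * i * d^-1 * c^-1 * b^-1, [::]);
      (i^-1 * t * i * t, [::]);
      (i^-1 * g * i * g^-1 * t^-1, [:: 5; 6; 7; 9; 10; 11]%N);
      ((h * i) ^+ 3, [:: 1; 2; 3; 5; 6; 8; 10]%N);
      (j^-1 * a * j * c^-1 * b^-1 * a^-1, [::]);
      (j^-1 * d * j * d^-1 * c^-1, [:: 1; 2; 3; 5; 6; 9]%N);
      (j^-1 * t * j * t, [::]);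
      (j^-1 * h * j * h^-1 * t^-1, [::])].

(** An empty tail is omitted and not multiplied as a trivial word, in agreement with
    [nonsplit_relators]. *)
Definition twist (p : gword todd_gen * seq nat) : gword ext_gen :=
  if p.2 is [::] then wlift p.1 else wlift p.1 * vtail p.2.

Lemma nonsplit_relatorsE rho : nonsplit_relators rho =
  map twist (take 19 twisted_relators) ++ module_relators rho ++
  map twist (drop 19 twisted_relators).
Proof. by []. Qed.

Definition tailN (ks : seq nat) : N :=
  foldr (fun k t => N.lxor (N.shiftl 1 (N.of_nat k.-1)) t) 0%num ks.

Lemma twisted_ok : all (fun p => [&& all (fun k => k.-1 < 11) p.2,
  qrel_ok p.1 (tailN p.2) & rho1_eq p.1 1]) twisted_relators.
Proof. by vm_compute. Qed.

(** The squares of g and h are present here, with non-trivial tails, besides the fourth powers. *)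
Lemma todd_twisted :
  all (fun r => r \in map fst twisted_relators) (todd_relators (@wgen todd_gen)).
Proof. by vm_compute. Qed.

Lemma mem_nonsplit rho r : r \in nonsplit_relators rho ->
  r \in module_relators rho \/ exists2 p, p \in twisted_relators & r = twist p.
Proof.
rewrite nonsplit_relatorsE mem_cat [X in _ || X]mem_cat => /or3P[/mapP[p Tp ->]|?|/mapP[p Tp ->]].
- by right; exists p; rewrite // (mem_take Tp).
- by left.
- by right; exists p; rewrite // (mem_drop Tp).
Qed.

Lemma twist_nonsplit rho p : p \in twisted_relators -> twist p \in nonsplit_relators rho.
Proof.
move=> Tp; rewrite nonsplit_relatorsE mem_cat [X in _ || X]mem_cat orbCA.
rewrite -[X in _ || X]mem_cat -map_cat cat_take_drop.
by rewrite map_f ?orbT.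
Qed.

Lemma module_nonsplit rho : {subset module_relators rho <= nonsplit_relators rho}.
Proof. by move=> r mr; rewrite nonsplit_relatorsE mem_cat [X in _ || X]mem_cat mr orbT. Qed.

(** A lifted relator of M_23 equals the inverse of its tail. This is the hypothesis [toddR] for the
    non-split presentation. *)
Lemma weq_todd_nonsplit rho r : r \in todd_relators (@wgen todd_gen) ->
  exists e, weq (nonsplit_relators rho) (wlift r) (vw e).
Proof.
set R := nonsplit_relators rho; have modR := @module_nonsplit rho.
move=> /(allP todd_twisted)/mapP[[w ks] Tp ->] /=.
have {Tp} := twist_nonsplit rho Tp; rewrite /twist /=.
have Dtail : exists e, weq R (vtail ks)^-1 (vw e).
  have [e He] : exists e, weq R (vtail ks) (vw e).
    rewrite /vtail; elim: (ks) => [|k s [e He]]; first by exists 0%R; rewrite big_nil vw0.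
    exists (delta_mx 0%R (inord k.-1) + e)%R.
    rewrite big_cons He -(vwD modR) vw_delta; apply: weqM; last by [].
    rewrite -[X in weq _ X]mulg1 -(vgen_sqr modR (inord k.-1)) mulgA weq_mulVg.
    by rewrite mul1g.
  exists (- e)%R; rewrite (weqV He).
  by rewrite -[X in weq _ X]mulg1 -vw0 -(subrr e) -(vwD modR) mulgA weq_mulVg mul1g.
case: ks Dtail => [|k s] [e He] Tp.
  by exists 0%R; rewrite vw0; apply/closure_weq/NcRel.
by exists e; rewrite -He; apply: weq_rel.
Qed.

(** * The linear system for a complement *)

Lemma rho1_mx_unit s : rho1_mx s \in unitmx.
Proof. by rewrite rho1_mxE; apply: (table_unit rho1_ok). Qed.

(* The adjoint of the map taking values v on the generators to the component of the word
   with letters y s * iota (v s) along iota: the coefficient vector of each v s. *)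
Definition adjoint_row (w : seq nat) (c : N) (row : seq (nat * N)) : seq (nat * N) * N :=
  foldr (fun s rc => (ins s rc.2 rc.1, vmul rc.2 (trmxN (nth [::] rho1N s)))) (row, c) w.

Fixpoint lift_shift (v : nat -> 'rV['F_2]_11) (w : seq nat) : 'rV['F_2]_11 :=
  (if w is s :: w' then v s *m mxN (rho1_word (tword w')) + lift_shift v w' else 0)%R.

Lemma todd_val s : s < 9 -> todd s = s :> nat.
Proof. by do 9![case: s => [|s] //]. Qed.

Lemma adjoint_rowP v w c row : all (fun s => s < 9) w ->
  (forall u : 'rV['F_2]_11, (u *m mxN (rho1_word (tword w)) *m (rvN c)^T) 0 0 =
     (u *m (rvN (adjoint_row w c row).2)^T) 0 0)%R /\
  (pair v (adjoint_row w c row).1 = (lift_shift v w *m (rvN c)^T) 0 0 + pair v row)%R.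
Proof.
elim: w => [|s w IH].
  by rewrite mxN_id mul0mx mxE add0r; split=> // u; rewrite mulmx1.
case/andP=> lt_s /IH[IH2 IH1].
have -> : adjoint_row (s :: w) c row =
  (ins s (adjoint_row w c row).2 (adjoint_row w c row).1,
   vmul (adjoint_row w c row).2 (trmxN (nth [::] rho1N s))) by [].
have -> : rho1_word (tword (s :: w)) =
  mmul (letter rho1N rho1VN (todd s) false) (rho1_word (tword w)) by [].
have -> : lift_shift v (s :: w) =
  (v s *m mxN (rho1_word (tword w)) + lift_shift v w)%R by [].
split=> [u|]; last by rewrite [(_, _).1]/fst pair_ins IH1 -IH2 addrA mulmxDl [in RHS]mxE.
rewrite [(_, _).2]/snd mxN_mmul ?(table_size rho1_ok) ?(size_word_mx rho1_ok) // mulmxA IH2.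
rewrite rvN_vmul ?size_trmxN // trmx_mul mxN_tr trmxK mulmxA.
by rewrite /letter todd_val.
Qed.

(** The transposed matrix has c as column 0, so the scalar product is bit 0 of a product computed by
    [vmul]. *)
Lemma dotNP t c :
  ((rvN t *m (rvN c)^T) 0 0)%R = (N.odd (vmul t (trmxN (c :: nseq 10 0%num))))%:R%R :> 'F_2.
Proof.
set B := c :: _; have -> : rvN c = row 0%R (mxN B) by rewrite row_mxN.
rewrite -bitF_odd tr_row colE mulmxA -colE -mxN_tr -rvN_vmul ?size_trmxN //.
by rewrite !mxE.
Qed.

Definition nonsplit_ok : bool :=
  [&& all (fun p => [&& all (fun s => s < 9) p.1.1, qrel_ok (tword p.1.1) p.2
        & rho1_eq (tword p.1.1) 1]) nonsplit_form,
      foldr (fun p row => (adjoint_row p.1.1 p.1.2 row).1) [::] nonsplit_form == [::]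
    & foldr (fun p b => N.odd (vmul p.2 (trmxN (p.1.2 :: nseq 10 0%num))) (+) b) false
        nonsplit_form].

Lemma nonsplit_okT : nonsplit_ok.
Proof. by vm_compute. Qed.

(** * Construction of the non-split extension *)

Section NonsplitExtension.

Variables (gT : finGroupType) (M : {group gT}) (x : todd_gen -> gT).
Hypotheses (M_simple : simple M)
           (M_pres : presents M x (todd_relators (@wgen todd_gen))).
Variable rG : mx_representation 'F_2 M 11.
Hypothesis rGx : forall s, rG (x s) = rho1_mx s.

Local Notation V := 'rV['F_2]_11.
Local Notation D := ({perm ('F_2 * V)} * gT)%type.

(** The second component carries the image in M_23, so that the projection onto [M] is a restriction
    of [snd]. *)
Definition nsgen (k : ext_gen) : D :=
  match k with
  | inl s => (pgen s, x s)
  | inr r => (tau (delta_mx 0%R r), 1)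
  end.

Definition ns_group : {group D} := <<[set nsgen k | k : ext_gen]>>%G.

Definition ns_iota (v : V) : D := (tau v, 1).

Lemma ns_iotaM : {in [set: V] &, {morph ns_iota : u v / u * v}}.
Proof. by move=> u v _ _; rewrite /ns_iota; congr (_, _); rewrite ?mulg1 // -tauM. Qed.

Canonical ns_iota_morphism := Morphism ns_iotaM.

Definition ns_pi := restrm (subsetT ns_group) (@snd _ gT : D -> gT).
Canonical ns_pi_morphism := [morphism of ns_pi].

Lemma nsgen_in k : nsgen k \in ns_group.
Proof. by apply: mem_gen; apply: imset_f. Qed.

Lemma nsgen_v r : nsgen (inr r) = ns_iota (delta_mx 0%R r). Proof. by []. Qed.

(** The linear part of the lift of s is the inverse transpose of [rho1_mx s], so on the coefficients
    of a linear form it acts by [rho1_mx s] itself. *)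
Lemma ns_iotaJ_gen s v :
  ns_iota v * nsgen (inl s) = nsgen (inl s) * ns_iota (v *m rho1_mx s)%R.
Proof.
rewrite /ns_iota; congr (_, _); last by rewrite /= mulg1 mul1g.
have H := is_quad_qperm (quad (nth [::] rho2Q s)) (table_unit rho2_ok s).
have L := is_quadM (is_quad_tau v) H; rewrite mul1mx in L.
have R := is_quadM H (is_quad_tau (v *m rho1_mx s)%R); rewrite mulmx1 in R.
apply: is_quad_eq L R _ => w.
rewrite mulmx1 addrC /dotp trmx_mul mulmxA -(mulmxA w) -rho2_mxE /rho2_mx.
by rewrite -trmx_mul mulmxV ?trmx1 ?mulmx1 // rho1_mxE (table_unit rho1_ok).
Qed.

Lemma word_eval_nsgen w :
  word_eval nsgen (wlift w) = (word_eval pgen w, word_eval x w).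
Proof.
rewrite word_eval_lift; elim: w => [|[s b] w IH].
  by rewrite -[[::]]/(1 : gword todd_gen) !word_eval1.
by rewrite !word_eval_cons IH; case: b.
Qed.

Lemma ns_iota_tail ks : all (fun k => k.-1 < 11) ks ->
  word_eval nsgen (vtail ks) = ns_iota (rvN (tailN ks)).
Proof.
rewrite /vtail word_eval_prod; elim: ks => [|k s IH] /=.
  by rewrite big_nil => _; rewrite (_ : rvN 0 = 1) ?(morph1 ns_iota_morphism) // rvN0.
case/andP=> lt_k ok_s; rewrite big_cons IH // rvN_xor (iotaD ns_iota_morphism) /=.
congr (_ * _); rewrite word_evalV word_eval_gen nsgen_v.
have := rvN_bit (inord k.-1 : 'I_11); rewrite inordK // => ->; apply/eqP; rewrite eq_invg_mul.
by rewrite (iota_sqr ns_iota_morphism).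
Qed.

Lemma ns_relators r : r \in nonsplit_relators rho1_mx -> word_eval nsgen r = 1.
Proof.
case/mem_nonsplit=> [|[[w ks] Tp ->]].
  exact: (module_relators_hold (iota := ns_iota_morphism) nsgen_v ns_iotaJ_gen).
have /and3P[/= lt_ks /qrelP Dw /(rho1_eq_eval M_simple M_pres) xw] := allP twisted_ok _ Tp.
rewrite word_eval1 in xw.
have Dww : word_eval nsgen (wlift w) = ns_iota (rvN (tailN ks)).
  by rewrite word_eval_nsgen Dw xw.
rewrite /twist /=; case: ks lt_ks {Dw} Dww {Tp} => [|k s] lt_ks Dww.
  by rewrite Dww /= rvN0; apply: (morph1 ns_iota_morphism).
by rewrite word_evalM ns_iota_tail // Dww; apply: (iota_sqr ns_iota_morphism).
Qed.

Lemma ns_pi_gen k : ns_pi (nsgen k) = if k is inl s then x s else 1.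
Proof. by case: k. Qed.

Lemma ns_piM e : e \in ns_group -> ns_pi e \in M.
Proof.
suff /subsetP sM : ns_group \subset snd_morphism _ gT @*^-1 M.
  by move/sM; rewrite !inE => /andP[].
rewrite gen_subG; apply/subsetP=> _ /imsetP[k _ ->]; rewrite !inE /=.
by case: k => [s|r]; rewrite ?group1 //; apply: presents_gen M_pres.
Qed.

Lemma ns_iotaJ v e : e \in ns_group -> ns_iota v * e = e * ns_iota (v *m rG (ns_pi e))%R.
Proof.
case/gen_prodgP=> n [c cX ->]; elim: n c cX v => [|n IH] c cX v.
  by rewrite big_ord0 morph1 repr_mx1 mulmx1 mulg1 mul1g.
have cE i : c i \in ns_group by apply: mem_gen.
rewrite big_ord_recl; have := IH (fun i => c (lift ord0 i)) (fun i => cX (lift ord0 i)).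
set c' := \prod_i _ => IH'.
have c'E : c' \in ns_group by apply: group_prod.
rewrite morphM // repr_mxM ?ns_piM // mulmxA -mulgA -IH' !mulgA; congr (_ * _).
have /imsetP[[s|r] _ ->] := cX ord0.
  by rewrite (ns_pi_gen (inl s) : ns_pi_morphism _ = _) rGx ns_iotaJ_gen.
rewrite (ns_pi_gen (inr r) : ns_pi_morphism _ = _) repr_mx1 mulmx1 nsgen_v -!(iotaD ns_iota_morphism).
by rewrite addrC.
Qed.

(** An element of the kernel is the value of a word. Its normal form, together with [closure_lift],
    reduces this word to a vector word modulo the relators, all of which hold in [ns_group]. *)
Lemma ns_kerP e : e \in 'ker ns_pi -> exists v, ns_iota v = e.
Proof.
move=> ke; have Ee := dom_ker ke.
have [w /eqP De] := word_eval_onto (erefl : <<[set nsgen k | k : ext_gen]>> = ns_group) Ee.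
have [u [f Df]] := ext_normal_form (@module_nonsplit rho1_mx) rho1_mx_unit w.
have Dy := weq_eval ns_relators Df.
rewrite word_evalM (word_eval_vw (iota := ns_iota_morphism) nsgen_v) De in Dy.
have : word_eval x u = 1.
  have : e.2 = 1 := mker ke.
  by rewrite Dy word_eval_nsgen /= mulg1.
case/(M_pres.2 u).1/(closure_lift (@module_nonsplit rho1_mx) rho1_mx_unit) => [r|e' De'].
  exact: weq_todd_nonsplit.
exists (e' + f)%R; rewrite Dy (weq_eval ns_relators De').
by rewrite (word_eval_vw (iota := ns_iota_morphism) nsgen_v) (iotaD ns_iota_morphism).
Qed.

Lemma ns_is_extension : is_extension rG ns_iota_morphism ns_pi_morphism.
Proof.
split.
- by apply/injmP=> u v _ _ uv; apply: tau_inj; apply: (congr1 fst uv).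
- apply/setP=> e; apply/morphimP/idP => [[v _ _ ->]|/ns_kerP[v <-]]; last by exists v; rewrite ?inE.
  suff Ev : ns_iota_morphism v \in ns_group by apply/(kerP _ Ev).
  rewrite -(word_eval_vw (iota := ns_iota_morphism) nsgen_v).
  by apply: word_eval_in => k; apply: nsgen_in.
- apply/eqP; rewrite eqEsubset; apply/andP; split.
    by apply/subsetP=> _ /morphimP[e _ Ee ->]; apply: ns_piM.
  have [Mx _] := M_pres; rewrite -Mx gen_subG; apply/subsetP=> _ /imsetP[s _ ->].
  by rewrite -[x s]/(ns_pi (nsgen (inl s))) mem_morphim ?nsgen_in.
- by move=> v e Ee; rewrite conjgE [ns_iota_morphism v * e]ns_iotaJ // mulKg.
Qed.

(** A complement contains a corrected lift of every generator. Along a word trivial in M_23 the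
    product of corrected lifts lies both in the kernel and in the complement, hence is 1, which
    gives one linear equation for the corrections. The combination in [nonsplit_form] turns these
    equations into 0 = 1. *)
Lemma ns_nonsplit : ~~ [splits ns_group, over 'ker ns_pi].
Proof.
apply/negP=> /splitsP[K /complP[tiK eqK]].
have ex s : exists v, nsgen (inl s) * ns_iota v \in K.
  have : nsgen (inl s) \in 'ker ns_pi * K by rewrite eqK nsgen_in.
  case/mulsgP=> k e kk Ke Ds; have [v Dv] := ns_kerP kk.
  have sK : e \in ns_group by rewrite -eqK; apply: (subsetP (mulG_subr _ _)).
  exists (v *m rG (ns_pi e))%R; rewrite Ds -Dv ns_iotaJ // -mulgA.
  by rewrite [ns_iota _ * _](iota_sqr ns_iota_morphism) mulg1.
pose v (s : nat) : V := xchoose (ex (todd s)).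
have vK s : nsgen (inl (todd s)) * ns_iota (v s) \in K := xchooseP (ex (todd s)).
(* All corrections are collected at the right end, each acted on by the letters that follow it. *)
have Dk w : \prod_(s <- w) (nsgen (inl (todd s)) * ns_iota (v s)) =
    word_eval nsgen (wlift (tword w)) * ns_iota (lift_shift v w).
  elim: w => [|s w IH].
    rewrite big_nil word_eval_nsgen -[tword _]/(1 : gword todd_gen) !word_eval1 mul1g.
    exact/esym/(morph1 ns_iota_morphism).
  rewrite big_cons IH (erefl _ : wlift (tword (s :: w)) = (inl (todd s), false) :: wlift (tword w)).
  rewrite word_eval_cons (iotaD ns_iota_morphism) !mulgA; congr (_ * _).
  have YE : word_eval nsgen (wlift (tword w)) \in ns_group.
    by apply: word_eval_in => k; apply: nsgen_in.
  rewrite -mulgA ns_iotaJ // mulgA; congr (_ * ns_iota (_ *m _)%R).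
  have -> : ns_pi (word_eval nsgen (wlift (tword w))) = word_eval x (tword w).
    by rewrite word_eval_nsgen.
  apply: (table_repr_word M_pres _ rho1_ok) => s'; rewrite rGx; exact: rho1_mxE.
have /and3P[formP /eqP rows0 odd1] := nonsplit_okT.
suff : (pair v [::] = 1)%R by rewrite /pair big_nil.
rewrite -rows0 -[RHS]/((true : nat)%:R)%R -odd1 {rows0 odd1}.
elim: nonsplit_form formP => [|[[w c] t] F IH]; first by rewrite /pair big_nil.
case/andP=> /and3P[/= lt_w /qrelP Dw /(rho1_eq_eval M_simple M_pres) xw] /IH {}IH.
rewrite word_eval1 in xw.
have [_ ->] := adjoint_rowP v c (foldr (fun p row => (adjoint_row p.1.1 p.1.2 row).1) [::] F) lt_w.
rewrite IH natF_addb -dotNP; congr ((_ *m _) _ _ + _)%R.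
have := Dk w; rewrite word_eval_nsgen Dw xw -[(tau _, _)]/(ns_iota_morphism (rvN t)).
rewrite -[ns_iota_morphism _ * _](iotaD ns_iota_morphism) => Dtw.
have : ns_iota (rvN t + lift_shift v w)%R \in 'ker ns_pi :&: K.
  apply/setIP; split; first exact: (ext_iota_ker ns_is_extension).
  by rewrite -[ns_iota _]Dtw group_prod.
rewrite tiK => /set1P/(congr1 fst)/= t1.
have : (rvN t + lift_shift v w)%R = 0%R.
  apply: tau_inj; rewrite t1; apply/esym.
  exact: (congr1 fst (morph1 ns_iota_morphism)).
by move/eqP; rewrite addrC addr_eq0 => /eqP ->; apply/rowP=> i; rewrite mxE oppr_pchar2 ?pchar_Fp.
Qed.

End NonsplitExtension.

(** * Presentations of the split extensions *)

Section SplitExtension.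

Variables (gT : finGroupType) (M : {group gT}) (x : todd_gen -> gT).
Hypothesis M_pres : presents M x (todd_relators (@wgen todd_gen)).
Variables (rG : mx_representation 'F_2 M 11) (rho : todd_gen -> 'M['F_2]_11).
Hypothesis rGx : forall s, rG (x s) = rho s.

Local Notation sd := (split_extension rG).

Definition sd_pi (u : sd) : gT := (pair_of_sd u).1.

Lemma sd_piM : {in [set: sd] &, {morph sd_pi : u v / u * v}}.
Proof. by []. Qed.

Canonical sd_pi_morphism := Morphism sd_piM.

Let xM s : x s \in M := presents_gen s M_pres.

Lemma sd_pi1 v : sd_pi (sdpair1 ('MR rG)%gact v) = 1.
Proof. by rewrite /sd_pi /= val_insubd !inE group1. Qed.

Lemma sd_pi2 g : g \in M -> sd_pi (sdpair2 ('MR rG)%gact g) = g.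
Proof. by move=> Mg; rewrite /sd_pi /= val_insubd !inE Mg. Qed.

Lemma split_presents : presents [set: sd] (split_gens rG x) (split_relators rho).
Proof.
have modR : {subset module_relators rho <= split_relators rho}.
  by move=> r mr; rewrite /split_relators mem_cat mr orbT.
have toddR r : r \in todd_relators (@wgen todd_gen) -> wlift r \in split_relators rho.
  by move=> Tr; rewrite /split_relators mem_cat todd_relators_lift map_f.
apply: (presents_extension (iota := sdpair1_morphism ('MR rG)%gact)
  (pi := sd_pi_morphism) modR _ _ M_pres) => //.
- by move=> s; rewrite -rGx; apply: repr_mx_unit.
- by move=> r Tr; exists 0%R; rewrite vw0; apply/closure_weq/NcRel/toddR.
- exact: injm_sdpair1.
- apply/setP=> u; apply/morphimP/idP => [[v _ _ ->]|/mker u1].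
    by apply/kerP; rewrite ?inE //; apply: sd_pi1.
  exists (pair_of_sd u).2; rewrite ?inE //.
  by rewrite [LHS]sdpairE [(pair_of_sd u).1]u1 morph1 mul1g.
- apply/setP=> g; apply/morphimP/idP => [[u _ _ ->]|Mg].
    by rewrite /= /sd_pi; case: u => -[g' v] /= /setXP[].
  by exists (sdpair2 ('MR rG)%gact g); rewrite ?inE //; apply/esym/sd_pi2.
- by move=> s; rewrite inE.
- by move=> s; apply: sd_pi2 (xM s).
rewrite /split_relators => r; rewrite mem_cat todd_relators_lift.
case/orP=> [/mapP[w Tw ->]|].
  rewrite word_eval_lift -[RHS](morph1 (sdpair2_morphism ('MR rG)%gact)).
  rewrite -((M_pres.2 w).2 (NcRel Tw)) (word_eval_morph _ _ xM).
  by [].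
apply: (module_relators_hold (iota := sdpair1_morphism ('MR rG)%gact)) => // s v.
by rewrite /= conjgC -sdpair_act ?inE //= mx_repr_actE // rGx.
Qed.

End SplitExtension.

(** * Uniqueness and presentation of the non-split extension *)

Section NonsplitUniqueness.

Variables (gT : finGroupType) (M : {group gT}) (x : todd_gen -> gT).
Hypotheses (M_simple : simple M)
           (M_pres : presents M x (todd_relators (@wgen todd_gen))).
Hypothesis M_order : #|M| = (2 ^ 7 * 3 ^ 2 * 5 * 7 * 11 * 23)%N.
Variable rG : mx_representation 'F_2 M 11.
Hypothesis rGx : forall s, rG (x s) = rho1_mx s.

Lemma rho1_dichotomy f f0 : f \in cocycles2 rG -> f0 \in cocycles2 rG ->
  [\/ f \in coboundaries2 rG, f0 \in coboundaries2 rG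
    | (f - f0)%R \in coboundaries2 rG].
Proof.
apply: (cocycle_dichotomy M_simple M_pres M_order rho1_ok _ cohomology1_ok) => s.
by rewrite rGx rho1_mxE.
Qed.

Lemma nonsplit_equivalent (eT1 eT2 : finGroupType)
    (E1 : {group eT1}) (E2 : {group eT2})
    (iota1 : {morphism [set: 'rV['F_2]_11] >-> eT1}) (pi1 : {morphism E1 >-> gT})
    (iota2 : {morphism [set: 'rV['F_2]_11] >-> eT2}) (pi2 : {morphism E2 >-> gT}) :
  is_nonsplit_extension rG iota1 pi1 -> is_nonsplit_extension rG iota2 pi2 ->
  equivalent_extensions iota1 pi1 iota2 pi2.
Proof.
move=> [ext1 ns1] [ext2 ns2].
have [s1 [f1 sec1]] := section_exists ext1; have [s2 [f2 sec2]] := section_exists ext2.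
case: (rho1_dichotomy (section_cocycle ext1 sec1) (section_cocycle ext2 sec2)).
- by move/(coboundary_splits ext1 sec1) => spl; rewrite spl in ns1.
- by move/(coboundary_splits ext2 sec2) => spl; rewrite spl in ns2.
exact: cohomologous_equivalent ext1 ext2 sec1 sec2.
Qed.

Lemma ns_is_nonsplit : is_nonsplit_extension rG (ns_iota_morphism gT) (ns_pi_morphism x).
Proof.
by split; [apply: ns_is_extension | apply: (ns_nonsplit M_simple M_pres rGx)].
Qed.

Lemma rho1_dim_H2 : dim_H2 rG = 1%N.
Proof.
have [ext0 ns0] := ns_is_nonsplit; have [s0 [f0 sec0]] := section_exists ext0.
have Bf0 : f0 \notin coboundaries2 rG.
  by apply/negP=> /(coboundary_splits ext0 sec0) spl; rewrite spl in ns0.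
apply: (dim_H2_eq1 (section_cocycle ext0 sec0) Bf0) => f Zf.
case: (rho1_dichotomy Zf (section_cocycle ext0 sec0)) => H; [by left | | by right].
by rewrite H in Bf0.
Qed.

(** The generators are carried over from the constructed extension along an equivalence, which
    respects both the embedded module and the projection. *)
Lemma nonsplit_presents (eT : finGroupType) (E : {group eT})
    (iota : {morphism [set: 'rV['F_2]_11] >-> eT}) (pi : {morphism E >-> gT}) :
  is_nonsplit_extension rG iota pi ->
  exists y : ext_gen -> eT,
    [/\ forall s, pi (y (inl s)) = x s, forall r, y (inr r) = iota (delta_mx 0%R r)
      & presents E y (nonsplit_relators rho1_mx)].
Proof.
move=> nsE; have [f [isof fiota pif]] := nonsplit_equivalent ns_is_nonsplit nsE.
have [[inj_iota im_iota im_pi _] _] := nsE.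
have fE e : e \in ns_group x -> f e \in E.
  by case/isomP: isof => _ <- Ee; apply: mem_morphim.
have y_s s : pi (f (nsgen x (inl s))) = x s by rewrite pif ?nsgen_in.
have y_v r : f (nsgen x (inr r)) = iota (delta_mx 0%R r) by apply: fiota.
exists (fun k => f (nsgen x k)); split=> //.
apply: (presents_extension (@module_nonsplit rho1_mx) rho1_mx_unit _ M_pres inj_iota im_iota
  im_pi) => //; first exact: weq_todd_nonsplit.
  by move=> s; apply/fE/nsgen_in.
move=> r Rr; have := word_eval_morph f r (nsgen_in x).
by rewrite (ns_relators M_simple M_pres Rr) morph1.
Qed.

End NonsplitUniqueness.

Theorem lemma3p1 (gT : finGroupType) (M : {group gT}) (x : todd_gen -> gT)
    (M_simple : simple M)
    (M_order : #|M| = (2 ^ 7 * 3 ^ 2 * 5 * 7 * 11 * 23)%N)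
    (M_pres : presents M x (todd_relators (@wgen todd_gen))) :
  (exists f : {morphism M >-> 'S_23}, 'injm f) /\
  (exists rho1 rho2 : mx_representation 'F_2 M 11,
    [/\ (forall s, rho1 (x s) = rho1_mx s) /\ mx_irreducible rho1,
        (forall s, rho2 (x s) = rho2_mx s) /\ mx_irreducible rho2,
        ~ mx_rsim rho1 rho2 /\
        (forall W : mx_representation 'F_2 M 11,
           mx_irreducible W -> mx_rsim rho1 W \/ mx_rsim rho2 W),
        dim_H2 rho1 = 1%N /\ dim_H2 rho2 = 0%N
      & (presents [set: split_extension rho1] (split_gens rho1 x)
           (split_relators rho1_mx) /\
         presents [set: split_extension rho2] (split_gens rho2 x)
           (split_relators rho2_mx)) /\
        [/\ (exists (eT : finGroupType) (E : {group eT})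
               (iota : {morphism [set: 'rV['F_2]_11] >-> eT})
               (pi : {morphism E >-> gT}),
               is_nonsplit_extension rho1 iota pi),
            (forall (eT1 eT2 : finGroupType) (E1 : {group eT1})
               (E2 : {group eT2})
               (iota1 : {morphism [set: 'rV['F_2]_11] >-> eT1})
               (pi1 : {morphism E1 >-> gT})
               (iota2 : {morphism [set: 'rV['F_2]_11] >-> eT2})
               (pi2 : {morphism E2 >-> gT}),
               is_nonsplit_extension rho1 iota1 pi1 ->
               is_nonsplit_extension rho1 iota2 pi2 ->
               equivalent_extensions iota1 pi1 iota2 pi2)
          & (forall (eT : finGroupType) (E : {group eT})
               (iota : {morphism [set: 'rV['F_2]_11] >-> eT})
               (pi : {morphism E >-> gT}),
               is_nonsplit_extension rho1 iota pi ->
               exists y : ext_gen -> eT,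
                 [/\ forall s, pi (y (inl s)) = x s,
                     forall r, y (inr r) = iota (delta_mx 0%R r)
                   & presents E y (nonsplit_relators rho1_mx)])]]).
Proof.
have [rho1 [rho2 [[rho1x irr1] [rho2x irr2] nsim classif]]] := M23_irreducibles M_simple M_pres.
split; first exact: perm23_faithful M_simple M_pres.
exists rho1, rho2; split=> //.
- split; first exact: (rho1_dim_H2 M_simple M_pres M_order rho1x).
  apply: dim_H2_eq0 => f Zf.
  apply: (no_cohomology M_simple M_pres M_order rho2_ok _ cohomology2_ok) => // s.
  by rewrite rho2x rho2_mxE.
- split; first by split; apply: (split_presents M_pres).
  split.
  + have nsE := ns_is_nonsplit M_simple M_pres rho1x.
    by do 4!eexists; apply: nsE.
  + by move=> *; apply: (nonsplit_equivalent M_simple M_pres M_order rho1x).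
  + by move=> *; apply: (nonsplit_presents M_simple M_pres M_order rho1x).
Qed.
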